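(* Consider a sentence $\exists X\in I^n.\forall Y\in I^m.\,(\Psi_{0,\le}(X,Y)\to\Phi_{0,\le}(X,Y))$, where $\Psi_{0,\le}$ and $\Phi_{0,\le}$ are $\mathrm{QFF}_\le$-formulas. Assume that the set-valued map $F(X)=\{Y\in I^m:\Psi_{0,\le}(X,Y)\}$ either maps some $X\in I^n$ to the empty set, or is continuous as a map $I^n\to\mathcal F(I^m)$. Then one can compute in polynomial time an equivalent $\texttt{b-}\Sigma_{2,\le}$-sentence.
   Context: $\mathcal L$ is the first-order language over the signature $\langle \mathbb Z,+,\times,<,\le\rangle$ with connectives $\land,\lor$ (negation, implication, equality as abbreviations), integer constants in binary, polynomials in atoms given as terms over $\langle\mathbb Z,+,\times\rangle$, interpreted over $\mathbb R$. A $\mathrm{QFF}_\le$-formula is a quantifier-free $\mathcal L$-formula not containing $<$. $I=[-1,1]$; $|X|\le y$ abbreviates $\bigwedge_j(-y\le x_j\le y)$ and $|X|>y$ its negation. The notation $\exists X\in I^n.\forall Y\in I^m.\Phi_0(X,Y)$ abbreviates $\exists X\in\mathbb R^n.\forall Y\in\mathbb R^m.(|Y|>1\lor(|X|\le1\land\Phi_0(X,Y)))$; a $\texttt{b-}\Sigma_{2,\le}$-sentence is such a sentence with $\Phi_0$ a $\mathrm{QFF}_\le$-formula. For a metric space $M$, $\mathcal F(M)$ denotes the set of non-empty compact subsets of $M$ with the Hausdorff metric $d(K,L)=\max\{\sup_{x\in K}d(x,L),\sup_{x\in L}d(x,K)\}$, where $d(x,K)=\inf_{y\in K}d(x,y)$.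 *)

(* Defs.v *)
From Stdlib Require Import Reals ZArith List Lia.
From Coquelicot Require Import Rbar Lub.
Import ListNotations.
Open Scope R_scope.

Inductive term : Type :=
| TConst : Z -> term
| TX : nat -> term
| TY : nat -> term
| TAdd : term -> term -> term
| TMul : term -> term -> term.

(* QFF_<= formulas: quantifier-free, built from atoms s <= t with /\ and \/
   (no '<'; negation would introduce '<', so it is not available). *)
Inductive qff_le : Type :=
| FLe : term -> term -> qff_le
| FAnd : qff_le -> qff_le -> qff_le
| FOr : qff_le -> qff_le -> qff_le.

Fixpoint teval (X Y : nat -> R) (t : term) : R :=
  match t with
  | TConst z => IZR z
  | TX i => X i
  | TY j => Y j
  | TAdd a b => teval X Y a + teval X Y b
  | TMul a b => teval X Y a * teval X Y b
  end.

Fixpoint feval (X Y : nat -> R) (f : qff_le) : Prop :=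
  match f with
  | FLe s t => teval X Y s <= teval X Y t
  | FAnd a b => feval X Y a /\ feval X Y b
  | FOr a b => feval X Y a \/ feval X Y b
  end.

Fixpoint tscoped (n m : nat) (t : term) : Prop :=
  match t with
  | TConst _ => True
  | TX i => (i < n)%nat
  | TY j => (j < m)%nat
  | TAdd a b => tscoped n m a /\ tscoped n m b
  | TMul a b => tscoped n m a /\ tscoped n m b
  end.

Fixpoint scoped (n m : nat) (f : qff_le) : Prop :=
  match f with
  | FLe s t => tscoped n m s /\ tscoped n m t
  | FAnd a b => scoped n m a /\ scoped n m b
  | FOr a b => scoped n m a /\ scoped n m b
  end.

Definition boxed (n : nat) (X : nat -> R) (r : R) : Prop :=
  forall i, (i < n)%nat -> - r <= X i <= r.

(* b-Sigma_{2,<=} sentence  "exists X in I^n. forall Y in I^m. Phi0(X,Y)",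
   literally as the abbreviation
   exists X in R^n. forall Y in R^m. (|Y| > 1 \/ (|X| <= 1 /\ Phi0(X,Y))). *)
Definition bsig2_true (n m : nat) (Phi0 : qff_le) : Prop :=
  exists X : nat -> R, forall Y : nat -> R,
    ~ boxed m Y 1 \/ (boxed n X 1 /\ feval X Y Phi0).

Definition input_true (n m : nat) (Psi0 Phi0 : qff_le) : Prop :=
  exists X : nat -> R, forall Y : nat -> R,
    ~ boxed m Y 1 \/ (boxed n X 1 /\ (feval X Y Psi0 -> feval X Y Phi0)).

(* Points of R^k represented as functions nat -> R vanishing from k on. *)
Definition in_Ik (k : nat) (X : nat -> R) : Prop :=
  boxed k X 1 /\ forall i, (k <= i)%nat -> X i = 0.

Fixpoint dist_k (k : nat) (X Y : nat -> R) : R :=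
  match k with
  | O => 0
  | S k' => Rmax (Rabs (X k' - Y k')) (dist_k k' X Y)
  end.

Definition dpt (k : nat) (x : nat -> R) (K : (nat -> R) -> Prop) : R :=
  real (Glb_Rbar (fun r => exists y, K y /\ r = dist_k k x y)).

Definition hausdorff (k : nat) (K L : (nat -> R) -> Prop) : R :=
  Rmax (real (Lub_Rbar (fun r => exists x, K x /\ r = dpt k x L)))
       (real (Lub_Rbar (fun r => exists x, L x /\ r = dpt k x K))).

Definition Fmap (m : nat) (Psi0 : qff_le) (X : nat -> R) : (nat -> R) -> Prop :=
  fun Y => in_Ik m Y /\ feval X Y Psi0.

(* Hypothesis of the theorem: F maps some X in I^n to the empty set, or F is
   a continuous map I^n -> F(I^m) (values non-empty; they are automatically
   compact, being closed subsets of I^m). *)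
Definition promise (n m : nat) (Psi0 : qff_le) : Prop :=
  (exists X, in_Ik n X /\ forall Y, ~ Fmap m Psi0 X Y)
  \/
  ((forall X, in_Ik n X -> exists Y, Fmap m Psi0 X Y) /\
   (forall X, in_Ik n X -> forall eps, 0 < eps -> exists delta, 0 < delta /\
      forall X', in_Ik n X' -> dist_k n X X' < delta ->
        hausdorff m (Fmap m Psi0 X) (Fmap m Psi0 X') < eps)).

Definition enc_nat (n : nat) : list bool := repeat true n ++ [false].

Fixpoint enc_pos (p : positive) : list bool :=
  match p with
  | xI q => [true; true] ++ enc_pos q
  | xO q => [true; false] ++ enc_pos q
  | xH => [false; false]
  end.

Definition enc_Z (z : Z) : list bool :=
  match z with
  | Z0 => [false; false]
  | Zpos p => [true; false] ++ enc_pos p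
  | Zneg p => [true; true] ++ enc_pos p
  end.

Fixpoint enc_term (t : term) : list bool :=
  match t with
  | TConst z => [false; false; false] ++ enc_Z z
  | TX i => [false; false; true] ++ enc_nat i
  | TY j => [false; true; false] ++ enc_nat j
  | TAdd a b => [false; true; true] ++ enc_term a ++ enc_term b
  | TMul a b => [true; false; false] ++ enc_term a ++ enc_term b
  end.

Fixpoint enc_fml (f : qff_le) : list bool :=
  match f with
  | FLe s t => [false; false] ++ enc_term s ++ enc_term t
  | FAnd a b => [false; true] ++ enc_fml a ++ enc_fml b
  | FOr a b => [true; false] ++ enc_fml a ++ enc_fml b
  end.

Definition enc_input (n m : nat) (Psi0 Phi0 : qff_le) : list bool :=
  enc_nat n ++ enc_nat m ++ enc_fml Psi0 ++ enc_fml Phi0.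

Definition enc_sentence (n m : nat) (Phi0 : qff_le) : list bool :=
  enc_nat n ++ enc_nat m ++ enc_fml Phi0.

(* Deterministic single-tape Turing machines over {0,1,blank}.
   States 0 .. nstates-1; start state 0, halting state 1. *)
Inductive move := MLeft | MRight | MStay.

Record TM : Type := {
  nstates : nat;
  delta : nat -> option bool -> nat * option bool * move;
  nstates_ge2 : (2 <= nstates)%nat;
  delta_ok : forall q a, (q < nstates)%nat -> (fst (fst (delta q a)) < nstates)%nat
}.

(* configuration: state, left tape (nearest cell first), head cell, right tape *)
Record config : Type := mkconfig {
  cstate : nat; cleft : list (option bool); chead : option bool;
  cright : list (option bool) }.

Definition tm_step (M : TM) (c : config) : config :=
  if Nat.eqb (cstate c) 1 then c else
  match delta M (cstate c) (chead c) with
  | (q', w, MStay) => mkconfig q' (cleft c) w (cright c)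
  | (q', w, MLeft) =>
      match cleft c with
      | [] => mkconfig q' [] None (w :: cright c)
      | a :: l => mkconfig q' l a (w :: cright c)
      end
  | (q', w, MRight) =>
      match cright c with
      | [] => mkconfig q' (w :: cleft c) None []
      | a :: r => mkconfig q' (w :: cleft c) a r
      end
  end.

Definition tm_init (w : list bool) : config :=
  match w with
  | [] => mkconfig 0 [] None []
  | b :: w' => mkconfig 0 [] (Some b) (map Some w')
  end.

Definition tm_run (M : TM) (t : nat) (w : list bool) : config :=
  Nat.iter t (tm_step M) (tm_init w).

Fixpoint read_bits (l : list (option bool)) : list bool :=
  match l with
  | Some b :: l' => b :: read_bits l'
  | _ => []
  end.

Definition tm_output (c : config) : list bool := read_bits (chead c :: cright c).

(* Main.v *)
(** Write [val f] for the maximum/minimum combination of the differences [s - t] over the atoms [s <= t] of a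
    formula [f], so that [f] holds iff [val f <= 0]. The output is the closed sentence
    [exists X, forall Y, eps <= val Psi \/ val Phi <= delta], where [delta = 2^(-2^B)] and [eps = 2^(-2^(2B))] are
    defined by repeated squaring with existential variables and [B] is polynomial in the input length [l].

    If the input is true, then for every [delta > 0] this sentence is true for some [eps > 0]. If the input is
    false, continuity of [F] and compactness give a [delta > 0] for which it is false for all [eps > 0]. It remains
    to see that these thresholds are not too small.

    The set of the [(delta, eps, X, Y)] violating the matrix is open, and the product of the atoms shifted by [delta]
    or [eps] vanishes on its boundary. Projecting along [Y], passing to the interior of the complement, and projecting
    along [X] gives a subset of the plane whose boundary lies in the zero set of one nonzero integer polynomial, of
    degree [2^poly(l)] and coefficients [2^(2^poly(l))]; its roots bound the thresholds from below.

    One projection step: let [Q] vanish on the boundary of the open set [W]. On a fibre of [W], the maximum of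
    [Q^2 - t * sum_i y_i^(2d+2)], with [d] the degree of [Q], is attained at a critical point, where
    [tau * y_i^(2d+1) = d(Q^2)/dy_i] for a multiple [tau] of [t]. These equations reduce every monomial to those of
    degree at most [2d] in each [y_i], so [Q^2] is an eigenvalue of a matrix with polynomial entries and its
    characteristic polynomial relates the critical value to [tau] and the parameters. As [t] tends to 0 the critical
    value tends to the maximum of [Q^2] on the fibre, which tends to 0 at the boundary of the projection; removing the
    powers of [tau] and of the value from the relation leaves a polynomial in the parameters that vanishes there. *)

Require Import Defs.
From Stdlib Require Import Reals ZArith List.
From Stdlib Require Import Arith Lia Lra Psatz Classical FunctionalExtensionality IndefiniteDescription.
From Coquelicot Require Import Rbar Lub.
From mathcomp Require all_boot all_fingroup all_algebra Rstruct.
Import ListNotations.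
Local Open Scope R_scope.

(** * Integer polynomials *)

Module Poly.

(** The two thresholds have different scales because [eps] may depend on [delta]: at [delta = 1/M] a
    root in [eps] is bounded below only in terms of a power of [1/M]. So the boundary of a planar
    set has to be controlled, not two separate roots.

    Tracking only a polynomial that vanishes on a boundary avoids cell decompositions and sign
    conditions. What has to be carried along is that the polynomial is nonzero and that the set is
    open; openness turns a fibre maximum into a critical point. The pure powers [y_i^(2d+2)] let the
    critical equations be solved for a leading power of each variable, for every [Q] and without
    genericity assumptions; the price is the factor [tau].

    Projecting along [k] variables turns a level [s] (degree [2^s], coefficients [2^(2^s)]) into
    [(s+4)(k+2)]. With two quantifier blocks the level stays cubic in the input length, which
    dictates the cube in the choice of [B].

    The machine has one tape with bits and blanks only, so it is built in layers: structured
    programs on queues, queue instructions as passes of a finite transducer, passes as head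
    movements. *)

Definition point := nat -> R.

Definition upd (x : point) (i : nat) (r : R) : point :=
  fun j => if Nat.eqb j i then r else x j.

Lemma upd_same x i r : upd x i r i = r.
Proof. unfold upd. now rewrite Nat.eqb_refl. Qed.

Lemma upd_other x i r j : j <> i -> upd x i r j = x j.
Proof. intros H. unfold upd. apply Nat.eqb_neq in H. now rewrite H. Qed.

Fixpoint mon (V : nat) (e : nat -> nat) (x : point) : R :=
  match V with
  | O => 1
  | S v => mon v e x * x v ^ e v
  end.

Fixpoint mdeg (V : nat) (e : nat -> nat) : nat :=
  match V with
  | O => O
  | S v => (mdeg v e + e v)%nat
  end.

Definition poly := list (Z * (nat -> nat)).

Fixpoint eval (V : nat) (P : poly) (x : point) : R :=
  match P with
  | [] => 0
  | (c, e) :: P' => IZR c * mon V e x + eval V P' x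
  end.

Fixpoint nrm (P : poly) : nat :=
  match P with
  | [] => O
  | (c, _) :: P' => (Z.abs_nat c + nrm P')%nat
  end.

Definition degle (V d : nat) (P : poly) : Prop :=
  forall c e, In (c, e) P -> (mdeg V e <= d)%nat.

(** The representing list is existential, so functions are compared by values only and repeated
    monomials need not be collected; [nrm] is then additive under sums and multiplicative under
    products. *)
Definition pol (V d h : nat) (g : point -> R) : Prop :=
  exists P, degle V d P /\ (nrm P <= h)%nat /\ forall x, g x = eval V P x.

Lemma mon_ext V e e' x x' :
  (forall i, (i < V)%nat -> e i = e' i /\ x i = x' i) -> mon V e x = mon V e' x'.
Proof.
  induction V as [|v IH]; simpl; intros H; auto.
  destruct (H v) as [-> ->]; [lia|]. f_equal. apply IH. intros i Hi; apply H; lia.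
Qed.

Lemma mdeg_ext V e e' : (forall i, (i < V)%nat -> e i = e' i) -> mdeg V e = mdeg V e'.
Proof.
  induction V as [|v IH]; simpl; intros H; auto.
  rewrite H by lia. rewrite IH; auto.
Qed.

Lemma mon_0 V x : mon V (fun _ => O) x = 1.
Proof. induction V; simpl; auto. rewrite IHV; ring. Qed.

Lemma mdeg_0 V : mdeg V (fun _ => O) = O.
Proof. induction V; simpl; auto. rewrite IHV; ring. Qed.

Lemma mon_add V e e' x : mon V (fun i => (e i + e' i)%nat) x = mon V e x * mon V e' x.
Proof.
  induction V as [|v IH]; simpl; [ring|]. rewrite IH, pow_add. ring.
Qed.

Lemma mdeg_add V e e' : mdeg V (fun i => (e i + e' i)%nat) = (mdeg V e + mdeg V e')%nat.
Proof. induction V as [|v IH]; simpl; [ring|]. rewrite IH. ring. Qed.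

Definition single (i a : nat) : nat -> nat := fun j => if Nat.eqb j i then a else O.

Lemma mon_single V i a x : (i < V)%nat -> mon V (single i a) x = x i ^ a.
Proof.
  induction V as [|v IH]; simpl; intros H; [lia|].
  destruct (Nat.eq_dec i v) as [->|Hn].
  - unfold single at 2. rewrite Nat.eqb_refl.
    rewrite (mon_ext v _ (fun _ => O) x x), mon_0; [ring|].
    intros j Hj; split; auto. unfold single.
    replace (Nat.eqb j v) with false; auto. symmetry; apply Nat.eqb_neq; lia.
  - rewrite IH by lia. unfold single.
    replace (Nat.eqb v i) with false; [simpl; ring|]. symmetry; apply Nat.eqb_neq; lia.
Qed.

Lemma mdeg_coord V e i : (i < V)%nat -> (e i <= mdeg V e)%nat.
Proof.
  induction V as [|v IH]; simpl; intros Hi; [lia|].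
  destruct (Nat.eq_dec i v) as [->|]; [lia|]. assert (H : (i < v)%nat) by lia. specialize (IH H). lia.
Qed.

Lemma mdeg_bound V e c : (forall i, (i < V)%nat -> (e i <= c)%nat) -> (mdeg V e <= c * V)%nat.
Proof.
  induction V as [|v IH]; simpl; intros H; [lia|].
  assert (e v <= c)%nat by (apply H; lia). assert (mdeg v e <= c * v)%nat by (apply IH; intros; apply H; lia).
  lia.
Qed.

Lemma mdeg_single V i a : (i < V)%nat -> mdeg V (single i a) = a.
Proof.
  induction V as [|v IH]; simpl; intros H; [lia|]. unfold single at 2.
  destruct (Nat.eq_dec i v) as [->|Hn].
  - rewrite Nat.eqb_refl, (mdeg_ext v _ (fun _ => O)), mdeg_0; auto.
    intros j Hj. unfold single. replace (Nat.eqb j v) with false; auto. symmetry; apply Nat.eqb_neq; lia.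
  - rewrite IH by lia. replace (Nat.eqb v i) with false; [lia|]. symmetry; apply Nat.eqb_neq; lia.
Qed.

Lemma eval_app V P Q x : eval V (P ++ Q) x = eval V P x + eval V Q x.
Proof. induction P as [|[c e] P IH]; simpl; [ring|]. rewrite IH. ring. Qed.

Lemma nrm_app P Q : nrm (P ++ Q) = (nrm P + nrm Q)%nat.
Proof. induction P as [|[c e] P IH]; simpl; auto. rewrite IH. lia. Qed.

Lemma eval_ext V P x x' : (forall i, (i < V)%nat -> x i = x' i) -> eval V P x = eval V P x'.
Proof.
  intros H. induction P as [|[c e] P IH]; simpl; auto. rewrite IH.
  rewrite (mon_ext V e e x x'); auto.
Qed.

Definition scalemon (c : Z) (e : nat -> nat) (P : poly) : poly :=
  map (fun m => (c * fst m, fun i => (e i + snd m i)%nat)%Z) P.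

Lemma eval_scalemon V c e P x : eval V (scalemon c e P) x = IZR c * mon V e x * eval V P x.
Proof.
  induction P as [|[c' e'] P IH]; simpl; [ring|]. rewrite IH, mon_add, mult_IZR. ring.
Qed.

Lemma nrm_scalemon c e P : nrm (scalemon c e P) = (Z.abs_nat c * nrm P)%nat.
Proof.
  induction P as [|[c' e'] P IH]; simpl; [lia|]. rewrite IH, Zabs2Nat.inj_mul. ring.
Qed.

Fixpoint pmul (P Q : poly) : poly :=
  match P with
  | [] => []
  | (c, e) :: P' => scalemon c e Q ++ pmul P' Q
  end.

Lemma eval_pmul V P Q x : eval V (pmul P Q) x = eval V P x * eval V Q x.
Proof.
  induction P as [|[c e] P IH]; simpl; [ring|]. rewrite eval_app, IH, eval_scalemon. ring.
Qed.

Lemma nrm_pmul P Q : nrm (pmul P Q) = (nrm P * nrm Q)%nat.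
Proof.
  induction P as [|[c e] P IH]; simpl; [ring|]. rewrite nrm_app, IH, nrm_scalemon. ring.
Qed.

Lemma degle_app V d P Q : degle V d P -> degle V d Q -> degle V d (P ++ Q).
Proof. intros HP HQ c e H. apply in_app_or in H. destruct H; eauto. Qed.

Lemma degle_scalemon V d d' c e P :
  (mdeg V e <= d)%nat -> degle V d' P -> degle V (d + d') (scalemon c e P).
Proof.
  intros He HP c0 e0 H. apply in_map_iff in H. destruct H as [[c1 e1] [E H]].
  injection E as <- <-. simpl. rewrite mdeg_add. apply HP in H. lia.
Qed.

Lemma degle_pmul V d d' P Q : degle V d P -> degle V d' Q -> degle V (d + d') (pmul P Q).
Proof.
  intros HP HQ. induction P as [|[c e] P IH]; simpl; [intros ? ? []|].
  apply degle_app.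
  - apply degle_scalemon; auto. apply (HP c). now left.
  - apply IH. intros c' e' H. apply (HP c'). now right.
Qed.

Lemma pol_ext V d h g g' : (forall x, g x = g' x) -> pol V d h g -> pol V d h g'.
Proof. intros E (P & H1 & H2 & H3). exists P; repeat split; auto. intros; rewrite <- E; auto. Qed.

Lemma pol_le V d h d' h' g : (d <= d')%nat -> (h <= h')%nat -> pol V d h g -> pol V d' h' g.
Proof.
  intros Hd Hh (P & H1 & H2 & H3). exists P; repeat split; auto; [|lia].
  intros c e H. apply H1 in H. lia.
Qed.

Lemma pol_const V z : pol V 0 (Z.abs_nat z) (fun _ => IZR z).
Proof.
  exists [(z, fun _ => O)]. split; [|split; [simpl; lia|]].
  - intros c e [E|[]]. injection E as <- <-. rewrite mdeg_0; lia.
  - intros x; simpl. rewrite mon_0. ring.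
Qed.

Lemma pol_mon V e : pol V (mdeg V e) 1 (mon V e).
Proof.
  exists [(1%Z, e)]. split; [|split; [simpl; lia|]].
  - intros c e' [E|[]]. injection E as <- <-. lia.
  - intros x; simpl. ring.
Qed.

Lemma pol_var V i : (i < V)%nat -> pol V 1 1 (fun x => x i).
Proof.
  intros Hi. apply (pol_ext _ _ _ (mon V (single i 1))).
  - intros x. rewrite mon_single; auto. simpl. ring.
  - eapply pol_le; [|apply le_n|apply pol_mon]. rewrite mdeg_single; auto.
Qed.

Lemma pol_add V d h h' g g' :
  pol V d h g -> pol V d h' g' -> pol V d (h + h') (fun x => g x + g' x).
Proof.
  intros (P & H1 & H2 & H3) (Q & H4 & H5 & H6). exists (P ++ Q). repeat split.
  - now apply degle_app.
  - rewrite nrm_app. lia.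
  - intros x. rewrite eval_app, H3, H6. auto.
Qed.

Lemma pol_mul V d d' h h' g g' :
  pol V d h g -> pol V d' h' g' -> pol V (d + d') (h * h') (fun x => g x * g' x).
Proof.
  intros (P & H1 & H2 & H3) (Q & H4 & H5 & H6). exists (pmul P Q). repeat split.
  - now apply degle_pmul.
  - rewrite nrm_pmul. nia.
  - intros x. rewrite eval_pmul, H3, H6. auto.
Qed.

Lemma pol_opp V d h g : pol V d h g -> pol V d h (fun x => - g x).
Proof.
  intros H. apply (pol_ext _ _ _ (fun x => IZR (-1) * g x)).
  - intros; ring.
  - eapply pol_le; [| |eapply pol_mul; [apply (pol_const _ (-1))|apply H]]; simpl; lia.
Qed.

Lemma pol_sub V d h h' g g' :
  pol V d h g -> pol V d h' g' -> pol V d (h + h') (fun x => g x - g' x).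
Proof. intros H H'. apply pol_add; auto. now apply pol_opp. Qed.

(** * Continuity with respect to finitely many coordinates *)

Definition near (V : nat) (rho : R) (x x' : point) : Prop :=
  forall i, (i < V)%nat -> Rabs (x' i - x i) < rho.

Lemma near_le V V' r r' x x' : (V' <= V)%nat -> r <= r' -> near V r x x' -> near V' r' x x'.
Proof. intros HV Hr H i Hi. eapply Rlt_le_trans; [apply H; lia|auto]. Qed.

Lemma near_refl V r x : 0 < r -> near V r x x.
Proof. intros H i _. now rewrite Rminus_diag, Rabs_R0. Qed.

Lemma near_sym V r x y : near V r x y -> near V r y x.
Proof. intros H i Hi. rewrite Rabs_minus_sym. auto. Qed.

Lemma near_trans V r r' x y z : near V r x y -> near V r' y z -> near V (r + r') x z.
Proof.
  intros H H' i Hi. specialize (H i Hi). specialize (H' i Hi).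
  replace (z i - x i) with ((z i - y i) + (y i - x i)) by ring.
  eapply Rle_lt_trans; [apply Rabs_triang|lra].
Qed.

Definition cont (V : nat) (g : point -> R) : Prop :=
  forall x eta, 0 < eta -> exists rho, 0 < rho /\
    forall x', near V rho x x' -> Rabs (g x' - g x) < eta.

Lemma cont_const V c : cont V (fun _ => c).
Proof.
  intros x eta H. exists 1. split; [lra|]. intros. now rewrite Rminus_diag, Rabs_R0.
Qed.

Lemma cont_var V i : (i < V)%nat -> cont V (fun x => x i).
Proof. intros Hi x eta H. exists eta. split; auto. Qed.

Lemma cont_add V g h : cont V g -> cont V h -> cont V (fun x => g x + h x).
Proof.
  intros Hg Hh x eta H.
  destruct (Hg x (eta/2)) as (r1 & P1 & Q1); [lra|].
  destruct (Hh x (eta/2)) as (r2 & P2 & Q2); [lra|].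
  exists (Rmin r1 r2). split; [now apply Rmin_pos|]. intros x' Hx.
  assert (A := Q1 x' (near_le _ _ _ _ _ _ (le_n _) (Rmin_l _ _) Hx)).
  assert (B := Q2 x' (near_le _ _ _ _ _ _ (le_n _) (Rmin_r _ _) Hx)).
  replace (g x' + h x' - (g x + h x)) with ((g x' - g x) + (h x' - h x)) by ring.
  eapply Rle_lt_trans; [apply Rabs_triang|lra].
Qed.

Lemma cont_mul V g h : cont V g -> cont V h -> cont V (fun x => g x * h x).
Proof.
  intros Hg Hh x eta H.
  set (A := Rabs (g x) + Rabs (h x) + 1).
  assert (HA : 1 <= A) by (unfold A; pose proof (Rabs_pos (g x)); pose proof (Rabs_pos (h x)); lra).
  set (th := Rmin 1 (eta / (2 * A))).
  assert (Hth : 0 < th).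
  { apply Rmin_pos; [lra|]. apply Rdiv_lt_0_compat; lra. }
  assert (Hth1 : th <= 1) by apply Rmin_l.
  assert (Hth2 : th * A <= eta / 2).
  { apply Rle_trans with (eta / (2 * A) * A); [|right; field; lra].
    apply Rmult_le_compat_r; [lra|apply Rmin_r]. }
  destruct (Hg x th Hth) as (r1 & P1 & Q1).
  destruct (Hh x th Hth) as (r2 & P2 & Q2).
  exists (Rmin r1 r2). split; [now apply Rmin_pos|]. intros x' Hx.
  assert (B := Q1 x' (near_le _ _ _ _ _ _ (le_n _) (Rmin_l _ _) Hx)).
  assert (C := Q2 x' (near_le _ _ _ _ _ _ (le_n _) (Rmin_r _ _) Hx)).
  replace (g x' * h x' - g x * h x) with
    ((g x' - g x) * (h x' - h x) + (g x' - g x) * h x + g x * (h x' - h x)) by ring.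
  assert (T : Rabs ((g x' - g x) * (h x' - h x) + (g x' - g x) * h x + g x * (h x' - h x)) <=
     Rabs (g x' - g x) * Rabs (h x' - h x) + Rabs (g x' - g x) * Rabs (h x) + Rabs (g x) * Rabs (h x' - h x)).
  { eapply Rle_trans; [apply Rabs_triang|]. rewrite Rabs_mult.
    apply Rplus_le_compat_r. eapply Rle_trans; [apply Rabs_triang|]. rewrite !Rabs_mult. lra. }
  eapply Rle_lt_trans; [apply T|].
  pose proof (Rabs_pos (g x)); pose proof (Rabs_pos (h x)).
  pose proof (Rabs_pos (g x' - g x)); pose proof (Rabs_pos (h x' - h x)).
  assert (Rabs (g x' - g x) * Rabs (h x' - h x) <= th * 1) by (apply Rmult_le_compat; lra).
  assert (Rabs (g x' - g x) * Rabs (h x) <= th * Rabs (h x)) by (apply Rmult_le_compat_r; lra).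
  assert (Rabs (g x) * Rabs (h x' - h x) <= th * Rabs (g x))
    by (rewrite Rmult_comm; apply Rmult_le_compat_r; lra).
  unfold A in Hth2. lra.
Qed.

Lemma cont_ext V g h : (forall x, g x = h x) -> cont V g -> cont V h.
Proof.
  intros E Hg x eta H. destruct (Hg x eta H) as (r & P & Q). exists r. split; auto.
  intros. rewrite <- !E. auto.
Qed.

Lemma cont_opp V g : cont V g -> cont V (fun x => - g x).
Proof.
  intros H. apply (cont_ext _ (fun x => (-1) * g x)); [intros; ring|].
  apply cont_mul; auto. apply cont_const.
Qed.

Lemma cont_sub V g h : cont V g -> cont V h -> cont V (fun x => g x - h x).
Proof. intros. apply cont_add; auto. now apply cont_opp. Qed.

Lemma cont_abs V g : cont V g -> cont V (fun x => Rabs (g x)).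
Proof.
  intros Hg x eta H. destruct (Hg x eta H) as (r & P & Q). exists r. split; auto.
  intros x' Hx. eapply Rle_lt_trans; [apply Rabs_triang_inv2|auto].
Qed.

Lemma cont_max V g h : cont V g -> cont V h -> cont V (fun x => Rmax (g x) (h x)).
Proof.
  intros Hg Hh. apply (cont_ext _ (fun x => (1/2) * (g x + h x + Rabs (g x - h x)))).
  - intros x. unfold Rmax, Rabs. destruct (Rle_dec _ _), (Rcase_abs _); lra.
  - apply cont_mul; [apply cont_const|]. apply cont_add; [now apply cont_add|].
    apply cont_abs, cont_sub; auto.
Qed.

Lemma cont_min V g h : cont V g -> cont V h -> cont V (fun x => Rmin (g x) (h x)).
Proof.
  intros Hg Hh. apply (cont_ext _ (fun x => (1/2) * (g x + h x - Rabs (g x - h x)))).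
  - intros x. unfold Rmin, Rabs. destruct (Rle_dec _ _), (Rcase_abs _); lra.
  - apply cont_mul; [apply cont_const|]. apply cont_sub; [now apply cont_add|].
    apply cont_abs, cont_sub; auto.
Qed.

Lemma cont_pow V g n : cont V g -> cont V (fun x => g x ^ n).
Proof.
  intros Hg. induction n; simpl; [apply cont_const|now apply cont_mul].
Qed.

Lemma cont_eval V P : cont V (eval V P).
Proof.
  induction P as [|[c e] P IH]; simpl; [apply cont_const|].
  apply cont_add; auto. apply cont_mul; [apply cont_const|].
  clear. assert (H : forall v, (v <= V)%nat -> cont V (mon v e)); [|apply H; lia].
  induction v as [|v IH]; simpl; intros; [apply cont_const|].
  apply cont_mul; [apply IH; lia|]. apply cont_pow, cont_var. lia.
Qed.

Lemma pol_cont V d h g : pol V d h g -> cont V g.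
Proof.
  intros (P & _ & _ & H). apply (cont_ext _ (eval V P)); [now intros|apply cont_eval].
Qed.

(** * Polynomials on lines and density of their non-zeros *)

Fixpoint uev (l : list R) (s : R) : R :=
  match l with [] => 0 | a :: l' => a + s * uev l' s end.

Fixpoint uadd (l m : list R) : list R :=
  match l, m with
  | [], _ => m
  | _, [] => l
  | a :: l', b :: m' => (a + b) :: uadd l' m'
  end.

Fixpoint umul (l m : list R) : list R :=
  match l with
  | [] => []
  | a :: l' => uadd (map (Rmult a) m) (0 :: umul l' m)
  end.

Lemma uev_uadd l m s : uev (uadd l m) s = uev l s + uev m s.
Proof.
  revert m; induction l as [|a l IH]; intros [|b m]; simpl; try ring. rewrite IH. ring.
Qed.

Lemma uev_umul l m s : uev (umul l m) s = uev l s * uev m s.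
Proof.
  induction l as [|a l IH]; simpl; [ring|]. rewrite uev_uadd. simpl. rewrite IH.
  assert (E : uev (map (Rmult a) m) s = a * uev m s); [|rewrite E; ring].
  clear IH. induction m as [|b m IHm]; simpl; [ring|]. rewrite IHm. ring.
Qed.

Lemma uev_bounded l : exists M, 0 < M /\ forall s, 0 <= s <= 1 -> Rabs (uev l s) <= M.
Proof.
  induction l as [|a l (M & HM & IH)]; simpl.
  - exists 1. split; [lra|]. intros. rewrite Rabs_R0. lra.
  - exists (Rabs a + M). pose proof (Rabs_pos a). split; [lra|]. intros s Hs.
    eapply Rle_trans; [apply Rabs_triang|]. apply Rplus_le_compat_l.
    rewrite Rabs_mult, (Rabs_right s) by lra.
    specialize (IH s Hs). pose proof (Rabs_pos (uev l s)). nra.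
Qed.

(** Near 0 the tail contributes at most [s * M], which forces the constant coefficient to vanish;
    dividing by [s] passes to the tail. *)
Lemma uev_zero l rho : 0 < rho -> (forall s, 0 < s < rho -> uev l s = 0) -> forall s, uev l s = 0.
Proof.
  intros Hr. induction l as [|a l IH]; intros H s; simpl; auto.
  destruct (uev_bounded l) as (M & HM & Hb).
  assert (Ha : a = 0).
  { apply NNPP; intros Ha. assert (0 < Rabs a) by now apply Rabs_pos_lt.
    set (t := Rmin (Rmin (rho / 2) 1) (Rabs a / (2 * M))).
    assert (Ht : 0 < t).
    { apply Rmin_pos; [apply Rmin_pos; lra|]. apply Rdiv_lt_0_compat; lra. }
    assert (t <= rho / 2) by (eapply Rle_trans; [apply Rmin_l|apply Rmin_l]).
    assert (t <= 1) by (eapply Rle_trans; [apply Rmin_l|apply Rmin_r]).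
    assert (T : t * M <= Rabs a / 2).
    { apply Rle_trans with (Rabs a / (2 * M) * M); [|right; field; lra].
      apply Rmult_le_compat_r; [lra|apply Rmin_r]. }
    assert (E : a + t * uev l t = 0) by (apply (H t); lra).
    assert (Ea : a = - (t * uev l t)) by lra.
    assert (Rabs a <= t * M).
    { rewrite Ea, Rabs_Ropp, Rabs_mult, (Rabs_right t) by lra.
      apply Rmult_le_compat_l; [lra|]. apply Hb; lra. }
    lra. }
  rewrite Ha, IH; [ring|]. intros u Hu. assert (E := H u Hu). simpl in E.
  rewrite Ha, Rplus_0_l in E. apply Rmult_integral in E. destruct E; lra.
Qed.

Lemma pol_line V d h g (x v : point) :
  pol V d h g -> exists l, forall s, g (fun i => x i + s * v i) = uev l s.
Proof.
  intros (P & _ & _ & H).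
  assert (Hp : forall i a, exists l, forall s, (x i + s * v i) ^ a = uev l s).
  { intros i. induction a as [|a (l & IH)]; simpl.
    - exists [1]. intros; simpl; ring.
    - exists (umul [x i; v i] l). intros s. rewrite uev_umul, IH. simpl. ring. }
  assert (Hm : forall e W, exists l, forall s, mon W e (fun i => x i + s * v i) = uev l s).
  { intros e. induction W as [|w (l & IH)]; simpl.
    - exists [1]. intros; simpl; ring.
    - destruct (Hp w (e w)) as (m & Hm'). exists (umul l m). intros. now rewrite uev_umul, IH, Hm'. }
  assert (He : exists l, forall s, eval V P (fun i => x i + s * v i) = uev l s).
  { clear H. induction P as [|[c e] P (l & IH)]; simpl.
    - exists []. auto.
    - destruct (Hm e V) as (m & Hm'). exists (uadd (umul [IZR c] m) l). intros s.
      rewrite uev_uadd, uev_umul, IH, Hm'. simpl. ring. }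
  destruct He as (l & He). exists l. intros; now rewrite H.
Qed.

Definition nonzero (g : point -> R) : Prop := exists x, g x <> 0.

(** On the segment from [x] to a point where [g] is nonzero, [g] is a univariate polynomial;
    vanishing on an initial piece would make it vanish at the far end too. *)
Lemma pol_dense V d h g x rho :
  pol V d h g -> nonzero g -> 0 < rho -> exists x', near V rho x x' /\ g x' <> 0.
Proof.
  intros Hg (x1 & H1) Hr. apply NNPP; intros Hn.
  destruct (pol_line V d h g x (fun i => x1 i - x i) Hg) as (l & Hl).
  assert (HM : exists M, 0 < M /\ forall i, (i < V)%nat -> Rabs (x1 i - x i) <= M).
  { clear. induction V as [|v (M & HM & IH)].
    - exists 1. split; [lra|]. intros; lia.
    - exists (Rmax M (Rabs (x1 v - x v))). split.
      + eapply Rlt_le_trans; [apply HM|apply Rmax_l].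
      + intros i Hi. destruct (Nat.eq_dec i v) as [->|]; [apply Rmax_r|].
        eapply Rle_trans; [apply IH; lia|apply Rmax_l]. }
  destruct HM as (M & HM & HMb).
  apply H1. replace x1 with (fun i => x i + 1 * (x1 i - x i)) by (extensionality i; ring).
  rewrite Hl. apply (uev_zero l (rho / M)); [now apply Rdiv_lt_0_compat|].
  intros s Hs. rewrite <- Hl. apply NNPP; intros Hs'. apply Hn. eexists; split; [|apply Hs'].
  intros i Hi. replace (x i + s * (x1 i - x i) - x i) with (s * (x1 i - x i)) by ring.
  rewrite Rabs_mult, (Rabs_right s) by lra.
  apply Rle_lt_trans with (s * M).
  - apply Rmult_le_compat_l; [lra|auto].
  - apply Rlt_le_trans with (rho / M * M); [apply Rmult_lt_compat_r; lra|]. right; field; lra.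
Qed.

(** Continuity keeps [g] nonzero around one of its non-zeros, and density puts a non-zero of [g']
    there. *)
Lemma nonzero_mul V d h d' h' g g' :
  pol V d h g -> pol V d' h' g' -> nonzero g -> nonzero g' -> nonzero (fun x => g x * g' x).
Proof.
  intros Hg Hg' (x & Hx) Hn'.
  destruct (pol_cont _ _ _ _ Hg x (Rabs (g x))) as (r & Hr & Hc); [now apply Rabs_pos_lt|].
  destruct (pol_dense _ _ _ _ x r Hg' Hn' Hr) as (x' & Hx' & Hne).
  exists x'. apply Rmult_integral_contrapositive_currified; auto.
  intros E. specialize (Hc x' Hx'). rewrite E, Rminus_0_l, Rabs_Ropp in Hc. lra.
Qed.

(** * Division by powers of the last variable *)

Definition pdrop (V : nat) (P : poly) : poly :=
  map (fun m => (fst m, fun i => if Nat.eqb i V then (snd m i - 1)%nat else snd m i))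
      (filter (fun m => negb (Nat.eqb (snd m V) 0)) P).

Definition pat0 (V : nat) (P : poly) : poly := filter (fun m => Nat.eqb (snd m V) 0) P.

Lemma eval_split V P x :
  eval (S V) P x = eval V (pat0 V P) x + x V * eval (S V) (pdrop V P) x.
Proof.
  induction P as [|[c e] P IH]; simpl; [ring|]. rewrite IH.
  unfold pat0, pdrop. simpl. destruct (Nat.eqb (e V) 0) eqn:E; simpl.
  - apply Nat.eqb_eq in E. rewrite E. simpl. unfold pat0, pdrop. ring.
  - apply Nat.eqb_neq in E. rewrite Nat.eqb_refl.
    rewrite (mon_ext V (fun i => if Nat.eqb i V then (e i - 1)%nat else e i) e x x).
    + replace (x V ^ e V) with (x V * x V ^ (e V - 1)).
      * ring.
      * replace (e V) with (S (e V - 1)) at 2 by lia. simpl. auto.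
    + intros i Hi. split; auto. replace (Nat.eqb i V) with false; auto.
      symmetry; apply Nat.eqb_neq; lia.
Qed.

Lemma nrm_pat0 V P : (nrm (pat0 V P) <= nrm P)%nat.
Proof.
  induction P as [|[c e] P IH]; simpl; auto. unfold pat0; simpl.
  destruct (Nat.eqb (e V) 0); simpl; unfold pat0 in IH; lia.
Qed.

Lemma nrm_pdrop V P : (nrm (pdrop V P) <= nrm P)%nat.
Proof.
  induction P as [|[c e] P IH]; simpl; auto. unfold pdrop; simpl.
  destruct (Nat.eqb (e V) 0); simpl; unfold pdrop in IH; lia.
Qed.

Lemma pol_at0 V d h g : pol (S V) d h g -> pol V d h (fun x => g (upd x V 0)).
Proof.
  intros (P & H1 & H2 & H3). exists (pat0 V P). split; [|split].
  - intros c e H. apply filter_In in H. destruct H as [H E]. apply H1 in H. simpl in *. lia.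
  - eapply Nat.le_trans; [apply nrm_pat0|auto].
  - intros x. rewrite H3, eval_split, upd_same, Rmult_0_l, Rplus_0_r.
    apply eval_ext. intros i Hi. apply upd_other. lia.
Qed.

(** Induction on the degree: if setting [x_V] to 0 kills [g], then [g] is [x_V] times [pdrop], of
    smaller degree and no larger norm. This removes in turn the powers of [tau], of the critical
    value and of [eps], after which the variable can be set to 0 without losing the polynomial. *)
Lemma pol_strip V d h g : pol (S V) d h g -> nonzero g ->
  exists a g', pol (S V) d h g' /\ (forall x, g x = x V ^ a * g' x) /\
    pol V d h (fun x => g' (upd x V 0)) /\ nonzero (fun x => g' (upd x V 0)).
Proof.
  revert g. induction d as [|d IH]; intros g Hg Hn;
  (destruct (classic (nonzero (fun x => g (upd x V 0)))) as [Hz|Hz];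
    [exists O, g; split; [auto|split; [intros; simpl; ring|split; [now apply pol_at0|auto]]]|]).
  - exfalso. destruct Hg as (P & H1 & H2 & H3). destruct Hn as (x & Hx). apply Hx.
    rewrite H3. assert (E : pdrop V P = []).
    { unfold pdrop. replace (filter _ P) with (@nil (Z * (nat -> nat))); auto.
      clear - H1. induction P as [|[c e] P IH]; auto. simpl.
      assert (mdeg (S V) e <= 0)%nat by (apply (H1 c); now left). simpl in H.
      replace (Nat.eqb (e V) 0) with true by (symmetry; apply Nat.eqb_eq; lia). simpl.
      apply IH. intros c' e' H'; apply (H1 c'); now right. }
    rewrite eval_split, E. simpl. rewrite Rmult_0_r, Rplus_0_r.
    apply NNPP; intros Hne. apply Hz. exists x. rewrite H3, eval_split, upd_same, Rmult_0_l, Rplus_0_r.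
    rewrite (eval_ext V _ _ x); auto. intros; apply upd_other; lia.
  - destruct Hg as (P & H1 & H2 & H3).
    assert (E0 : forall x, eval V (pat0 V P) x = 0).
    { intros x. apply NNPP; intros Hne. apply Hz. exists x.
      rewrite H3, eval_split, upd_same, Rmult_0_l, Rplus_0_r.
      rewrite (eval_ext V _ _ x); auto. intros; apply upd_other; lia. }
    assert (E : forall x, g x = x V * eval (S V) (pdrop V P) x).
    { intros x. rewrite H3, eval_split, E0. ring. }
    destruct (IH (eval (S V) (pdrop V P))) as (a & g' & Ha & Hb & Hc & Hd).
    + exists (pdrop V P). split; [|split; auto].
      * intros c e H. apply in_map_iff in H. destruct H as [[c1 e1] [Ee H]].
        apply filter_In in H. destruct H as [H Hf]. injection Ee as <- <-. apply H1 in H.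
        cbn [mdeg snd] in *. rewrite Nat.eqb_refl.
        rewrite (mdeg_ext V _ e1). 2:{ intros i Hi. replace (Nat.eqb i V) with false; auto.
          symmetry; apply Nat.eqb_neq; lia. }
        destruct (Nat.eqb (e1 V) 0) eqn:E1; [discriminate|]. apply Nat.eqb_neq in E1. lia.
      * eapply Nat.le_trans; [apply nrm_pdrop|auto].
    + destruct Hn as (x & Hx). exists x. intros E'. apply Hx. rewrite E, E'. ring.
    + exists (S a), g'. split; [eapply pol_le; [| |apply Ha]; lia|]. split; [|split; auto].
      * intros x. rewrite E, Hb. simpl. ring.
      * eapply pol_le; [| |apply Hc]; lia.
Qed.

Fixpoint sumN (N : nat) (f : nat -> R) : R :=
  match N with O => 0 | S n => sumN n f + f n end.

End Poly.

(** * Compactness, partial derivatives and a root bound *)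

Module Analysis.
Import Poly.

Lemma inv_succ_pos j : 0 < / (INR j + 1).
Proof. apply Rinv_0_lt_compat. pose proof (pos_INR j). lra. Qed.

Lemma inv_succ_le J j : (0 < J)%nat -> (J <= j)%nat -> / (INR j + 1) <= / INR J.
Proof. intros HJ Hj. apply Rinv_le_contravar; [now apply lt_0_INR|]. apply le_INR in Hj. lra. Qed.

Lemma bounded_subseq (u : nat -> R) (B : R) : (forall j, Rabs (u j) <= B) ->
  exists l (phi : nat -> nat), (forall j, (j <= phi j)%nat) /\
    forall rho, 0 < rho -> exists J, forall j, (J <= j)%nat -> Rabs (u (phi j) - l) < rho.
Proof.
  intros HB.
  destruct (Bolzano_Weierstrass u (fun c => -B <= c <= B) (compact_P3 (-B) B)) as (l & Hl).
  { intros n. specialize (HB n). unfold Rabs in HB. destruct (Rcase_abs (u n)); lra. }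
  exists l.
  assert (H : forall k, exists p, (k <= p)%nat /\ Rabs (u p - l) < / (INR k + 1)).
  { intros k. assert (Hk : 0 < / (INR k + 1)) by (apply Rinv_0_lt_compat; pose proof (pos_INR k); lra).
    destruct (Hl (fun x => Rabs (x - l) < / (INR k + 1)) k) as (p & Hp & Hq).
    - exists (mkposreal _ Hk). intros x Hx. exact Hx.
    - eauto. }
  apply functional_choice in H. destruct H as (phi & Hphi). exists phi. split; [apply Hphi|].
  intros rho Hr. destruct (archimed_cor1 rho Hr) as (N & HN & HN0). exists N. intros j Hj.
  eapply Rlt_trans; [apply Hphi|]. eapply Rle_lt_trans; [|apply HN].
  apply inv_succ_le; auto.
Qed.

Lemma bounded_cluster (k : nat) (s : nat -> point) (B : R) :
  (forall j i, (i < k)%nat -> Rabs (s j i) <= B) ->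
  exists y : point, forall rho J, 0 < rho -> exists j, (J <= j)%nat /\ near k rho y (s j).
Proof.
  intros HB.
  (* Cluster points of single coordinates do not combine, so the induction carries a subsequence
     converging in all coordinates treated so far. *)
  assert (H : exists (y : point) (phi : nat -> nat), (forall j, (j <= phi j)%nat) /\
    forall rho, 0 < rho -> exists J, forall j, (J <= j)%nat -> near k rho y (s (phi j))).
  { induction k as [|k IH].
    - exists (fun _ => 0), (fun j => j). split; [auto|]. intros rho _. exists O. intros j _ i Hi. lia.
    - destruct IH as (y & phi & H1 & H2); [intros; apply HB; lia|].
      destruct (bounded_subseq (fun j => s (phi j) k) B) as (l & psi & H3 & H4); [intros; apply HB; lia|].
      exists (upd y k l), (fun j => phi (psi j)). split.
      + intros j. eapply Nat.le_trans; [apply H3|apply H1].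
      + intros rho Hr. destruct (H2 rho Hr) as (J1 & HJ1). destruct (H4 rho Hr) as (J2 & HJ2).
        exists (Nat.max J1 J2). intros j Hj i Hi. destruct (Nat.eq_dec i k) as [->|Hn].
        * rewrite upd_same. apply HJ2. lia.
        * rewrite upd_other by auto. apply HJ1; [specialize (H3 j); lia|lia]. }
  destruct H as (y & phi & H1 & H2). exists y. intros rho J Hr.
  destruct (H2 rho Hr) as (J' & HJ). exists (phi (Nat.max J J')). split.
  - specialize (H1 (Nat.max J J')). lia.
  - apply HJ. lia.
Qed.

Definition pder (i : nat) (P : poly) : poly :=
  map (fun m => (fst m * Z.of_nat (snd m i), fun j => if Nat.eqb j i then (snd m j - 1)%nat else snd m j)%Z) P.

Lemma mon_upd_ge V i e x s : (V <= i)%nat -> mon V e (upd x i s) = mon V e x.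
Proof.
  intros H. apply mon_ext. intros j Hj. split; auto. apply upd_other. lia.
Qed.

Lemma mon_der V i e x : (i < V)%nat ->
  derivable_pt_lim (fun s => mon V e (upd x i s)) (x i)
    (INR (e i) * mon V (fun j => if Nat.eqb j i then (e j - 1)%nat else e j) x).
Proof.
  induction V as [|v IH]; intros Hi; [lia|].
  destruct (Nat.eq_dec i v) as [->|Hn].
  - apply derivable_pt_lim_ext with (fun s => mon v e x * s ^ e v).
    + intros s. simpl. rewrite mon_upd_ge, upd_same; auto.
    + simpl. rewrite Nat.eqb_refl.
      replace (INR (e v) * (mon v (fun j => if Nat.eqb j v then (e j - 1)%nat else e j) x * x v ^ (e v - 1)))
        with (mon v e x * (INR (e v) * x v ^ (Nat.pred (e v)))).
      * apply (derivable_pt_lim_scal (fun s => s ^ e v)). apply derivable_pt_lim_pow.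
      * rewrite (mon_ext v (fun j => if Nat.eqb j v then (e j - 1)%nat else e j) e x x).
        -- replace (Nat.pred (e v)) with (e v - 1)%nat by lia. ring.
        -- intros j Hj. split; auto. replace (Nat.eqb j v) with false; auto.
           symmetry; apply Nat.eqb_neq; lia.
  - apply derivable_pt_lim_ext with (fun s => x v ^ e v * mon v e (upd x i s)).
    + intros s. simpl. rewrite upd_other by auto. ring.
    + simpl. replace (Nat.eqb v i) with false by (symmetry; apply Nat.eqb_neq; auto).
      replace (INR (e i) * (mon v (fun j => if Nat.eqb j i then (e j - 1)%nat else e j) x * x v ^ e v))
        with (x v ^ e v * (INR (e i) * mon v (fun j => if Nat.eqb j i then (e j - 1)%nat else e j) x)) by ring.
      apply (derivable_pt_lim_scal (fun s => mon v e (upd x i s))). apply IH. lia.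
Qed.

Lemma eval_der V i P x : (i < V)%nat ->
  derivable_pt_lim (fun s => eval V P (upd x i s)) (x i) (eval V (pder i P) x).
Proof.
  intros Hi. induction P as [|[c e] P IH]; simpl.
  - apply derivable_pt_lim_const.
  - apply (derivable_pt_lim_plus (fun s => IZR c * mon V e (upd x i s)) (fun s => eval V P (upd x i s))); auto.
    rewrite mult_IZR, <- INR_IZR_INZ, Rmult_assoc.
    apply (derivable_pt_lim_scal (fun s => mon V e (upd x i s))). now apply mon_der.
Qed.

Lemma nrm_pder V i d P : (i < V)%nat -> degle V d P -> (nrm (pder i P) <= d * nrm P)%nat.
Proof.
  intros Hi H. induction P as [|[c e] P IH]; simpl; [lia|].
  assert (He := mdeg_coord V e i Hi).
  assert (H1 := H c e (or_introl eq_refl)).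
  assert (H2 : (nrm (pder i P) <= d * nrm P)%nat) by (apply IH; intros c' e' H'; apply (H c'); now right).
  fold (pder i P). rewrite Zabs2Nat.inj_mul, Zabs2Nat.id.
  assert (Z.abs_nat c * e i <= d * Z.abs_nat c)%nat by (rewrite Nat.mul_comm; apply Nat.mul_le_mono_r; lia).
  rewrite Nat.mul_add_distr_l. lia.
Qed.

Lemma mdeg_le V e e' : (forall i, (i < V)%nat -> (e i <= e' i)%nat) -> (mdeg V e <= mdeg V e')%nat.
Proof.
  intros H. induction V as [|v IH]; simpl; [lia|].
  assert (e v <= e' v)%nat by (apply H; lia).
  assert (mdeg v e <= mdeg v e')%nat by (apply IH; intros; apply H; lia). lia.
Qed.

Lemma degle_pder V i d P : degle V d P -> degle V d (pder i P).
Proof.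
  intros H c e He. apply in_map_iff in He. destruct He as [[c' e'] [E He]]. injection E as <- <-.
  apply H in He. eapply Nat.le_trans; [|apply He]. apply mdeg_le. simpl. intros j _.
  destruct (Nat.eqb j i); lia.
Qed.

Lemma local_max_der (f : R -> R) (x l r : R) : 0 < r ->
  (forall s, Rabs (s - x) < r -> f s <= f x) -> derivable_pt_lim f x l -> l = 0.
Proof.
  intros Hr Hm Hd.
  set (pr := exist (fun l => derivable_pt_abs f x l) l Hd : derivable_pt f x).
  assert (E : derive_pt f x pr = l) by reflexivity.
  rewrite <- E. apply (deriv_maximum f (x - r) (x + r) x pr); try lra.
  intros y H1 H2. apply Hm. apply Rabs_def1; lra.
Qed.

(* Up to a power of the variable, [g] has a nonzero integer constant term. *)
Lemma pol1_root h g x : (exists d, pol 1 d h g) -> nonzero g ->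
  0 < x 0%nat -> x 0%nat * INR h < 1 -> g x <> 0.
Proof.
  intros (d & Hg) Hn Hx Hxh E.
  destruct (pol_strip 0 d h g Hg Hn) as (a & g' & H1 & H2 & H3 & H4).
  assert (Hg' : g' x = 0).
  { rewrite H2 in E. apply Rmult_integral in E. destruct E as [E|E]; auto.
    exfalso. apply (pow_nonzero (x 0%nat) a) in E; auto; lra. }
  destruct H1 as (P & P1 & P2 & P3).
  assert (Hz : exists z, IZR z = g' (upd x 0 0) /\ z <> 0%Z).
  { destruct H4 as (x1 & Hx1). rewrite P3 in Hx1.
    assert (Ez : forall y, exists z, IZR z = eval 0 (pat0 0 P) y).
    { intros y. induction (pat0 0 P) as [|[c e] Q (z & IH)]; simpl; [exists 0%Z; auto|].
      exists (c + z)%Z. rewrite plus_IZR, IH. ring. }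
    destruct (Ez x) as (z & Hz). exists z.
    assert (E1 : forall y, g' (upd y 0 0) = IZR z).
    { intros y. rewrite P3, eval_split, upd_same, Hz, Rmult_0_l, Rplus_0_r.
      apply eval_ext. intros; lia. }
    split; [now rewrite E1|]. intros ->. apply Hx1. rewrite <- P3. apply E1. }
  destruct Hz as (z & Hz & Hz0).
  assert (Hz1 : 1 <= Rabs (IZR z)).
  { rewrite <- abs_IZR. apply (IZR_le 1). lia. }
  assert (Hh : 1 <= INR h).
  { assert (Hh : (h <> 0)%nat).
    { intros ->. assert (E0 : forall y, eval 1 P y = 0).
      { clear - P2. induction P as [|[c e] P IH]; intros; simpl; auto. simpl in P2.
        rewrite IH by lia. assert (c = 0%Z) by lia. subst. ring. }
      rewrite P3, E0 in Hz. apply eq_IZR in Hz. auto. }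
    apply (le_INR 1). lia. }
  assert (Hx1 : x 0%nat < 1) by nra.
  (* As [0 < x < 1], every monomial of positive degree is at most [x], so the value differs from the
     integer constant term by less than 1. *)
  assert (Hd : Rabs (eval 1 P x - eval 1 P (upd x 0 0)) <= x 0%nat * INR (nrm P)).
  { clear - Hx Hx1. induction P as [|[c e] P IH]; simpl.
    - rewrite Rminus_diag, Rabs_R0. lra.
    - rewrite upd_same.
      replace (IZR c * (1 * x 0%nat ^ e 0%nat) + eval 1 P x - (IZR c * (1 * 0 ^ e 0%nat) + eval 1 P (upd x 0
        0)))
        with (IZR c * (x 0%nat ^ e 0%nat - 0 ^ e 0%nat) + (eval 1 P x - eval 1 P (upd x 0 0))) by ring.
      eapply Rle_trans; [apply Rabs_triang|]. rewrite plus_INR, Rmult_plus_distr_l.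
      apply Rplus_le_compat; auto. rewrite Rabs_mult, INR_IZR_INZ, Zabs2Nat.id_abs, abs_IZR, Rmult_comm.
      apply Rmult_le_compat_r; [apply Rabs_pos|].
      destruct (e 0%nat) as [|a]; simpl.
      + rewrite Rminus_diag, Rabs_R0. lra.
      + rewrite Rmult_0_l, Rminus_0_r.
        assert (0 < x 0%nat ^ a) by now apply pow_lt.
        assert (x 0%nat ^ a <= 1).
        { clear - Hx Hx1. induction a; simpl; [lra|]. assert (0 < x 0%nat ^ a) by now apply pow_lt. nra. }
        rewrite Rabs_right; nra. }
  rewrite <- !P3, Hg', <- Hz, Rminus_0_l, Rabs_Ropp in Hd.
  apply le_INR in P2. assert (x 0%nat * INR (nrm P) <= x 0%nat * INR h) by (apply Rmult_le_compat_l; lra).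
  lra.
Qed.

End Analysis.

(** * Elimination of the critical points *)

Module Det.
Import all_boot all_fingroup all_algebra Rstruct.
Import Poly.
Import GRing.Theory.

Lemma sumN_big N f : sumN N f = (\sum_(i < N) f (val i))%R.
Proof.
elim: N => [|N IH] /=; first by rewrite big_ord0.
by rewrite big_ord_recr /= IH.
Qed.

Lemma pol_bigsum V d h (I : Type) (r : seq I) (F : I -> point -> R) :
  (forall i, pol V d h (F i)) -> pol V d (size r * h) (fun x => \sum_(i <- r) F i x)%R.
Proof.
move=> HF; elim: r => [|i r IH] /=.
  apply: (pol_ext _ _ _ (fun _ => IZR 0)); first by move=> x; rewrite big_nil.
  by apply: (pol_le _ 0 0); [lia|lia|apply: (pol_const _ 0)].
apply: (pol_ext _ _ _ (fun x => Rplus (F i x) (\sum_(j <- r) F j x)%R)).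
  by move=> x; rewrite big_cons.
by rewrite mulSn; apply: pol_add.
Qed.

Lemma pol_bigprod V d h N (F : 'I_N -> point -> R) :
  (forall i, pol V d h (F i)) ->
  pol V (Nat.mul N d) (Nat.pow h N) (fun x => \prod_(i < N) F i x)%R.
Proof.
elim: N F => [|N IH] F HF.
  apply: (pol_ext _ _ _ (fun _ => IZR 1)); first by move=> x; rewrite big_ord0.
  by apply: (pol_le _ 0 1); [lia|simpl;lia|apply: (pol_const _ 1)].
apply: (pol_ext _ _ _ (fun x => Rmult (F ord0 x) (\prod_(i < N) F (lift ord0 i) x)%R)).
  by move=> x; rewrite big_ord_recl.
by apply: pol_mul => //; apply: IH.
Qed.

(** The determinant, characterised by its two relations to the kernel so that matrices stay inside
    this module. The Leibniz formula has [N!] terms, bounded by [N ^ N], each a product of [N]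
    entries. *)
Lemma det_pol V N D H (A : nat -> nat -> point -> R) :
  (forall i j, pol V D H (A i j)) ->
  exists g, pol V (Nat.mul N D) (Nat.mul (Nat.pow N N) (Nat.pow H N)) g /\
    (forall w v, (exists i, lt i N /\ v i <> IZR 0) ->
       (forall i, lt i N -> sumN N (fun j => Rmult (A i j w) (v j)) = IZR 0) -> g w = IZR 0) /\
    (forall w, (forall v, (forall i, lt i N -> sumN N (fun j => Rmult (A i j w) (v j)) = IZR 0) ->
       forall i, lt i N -> v i = IZR 0) -> g w <> IZR 0).
Proof.
move=> HA.
pose B w : 'M[R]_N := (\matrix_(i, j) A (val i) (val j) w)%R.
have kerB w (u : 'rV[R]_N) : (u *m (B w)^T = 0)%R <->
   (forall i, lt i N -> sumN N (fun j => Rmult (A i j w) (if insub j is Some o then u ord0 o else 0%R)) = 0%R).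
  split=> [E i /ltP Hi|E].
    rewrite sumN_big; have := congr1 (fun M : 'rV_N => M ord0 (Ordinal Hi)) E.
    rewrite !mxE => E'; apply: etrans E'.
    by apply: eq_bigr => j _; rewrite !mxE /= valK mulrC.
  apply/rowP=> i; rewrite !mxE; have := E i (elimT ltP (ltn_ord i)).
  rewrite sumN_big => E'; apply: etrans E'.
  by apply: eq_bigr => j _; rewrite !mxE /= valK mulrC.
exists (fun w => (\det (B w))%R); split; last split.
- have powE a n : Nat.pow a n = expn a n by elim: n => //= n ->; rewrite expnS.
  apply: (pol_le _ (Nat.mul N D) (Nat.mul (size (index_enum 'S_N)) (Nat.pow H N))); first by [].
    apply: PeanoNat.Nat.mul_le_mono_r; rewrite powE; apply/leP.
    have -> : expn N N = #|{ffun 'I_N -> 'I_N}| by rewrite card_ffun card_ord.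
    have -> : size (index_enum 'S_N) = #|{: 'S_N}| by rewrite cardT enumT.
    exact: (leq_card _ (@val_inj _ _ _)).
  apply: (pol_ext _ _ _ (fun w => \sum_(s : 'S_N) (-1) ^+ s * \prod_i A (val i) (val (s i)) w)%R).
    move=> w; rewrite /determinant; apply: eq_bigr => s _; congr (_ * _)%R.
    by apply: eq_bigr => i _; rewrite mxE.
  apply: pol_bigsum => s.
  case: (odd_perm s) => /=.
    apply: (pol_ext _ _ _ (fun w => Ropp (\prod_i A (val i) (val (s i)) w)%R)).
      by move=> w; rewrite expr1 mulN1r.
    by apply: pol_opp; apply: pol_bigprod.
  apply: (pol_ext _ _ _ (fun w => (\prod_i A (val i) (val (s i)) w)%R)).
    by move=> w; rewrite expr0 mul1r.
  exact: pol_bigprod.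
- move=> w v [i [/ltP Hi Hv]] E; rewrite -det_tr; apply/eqP/det0P.
  exists (\row_j v (val j))%R.
    by apply/eqP => /rowP /(_ (Ordinal Hi)); rewrite !mxE /=.
  apply/kerB => i' Hi'; rewrite -[RHS](E i' Hi') !sumN_big; apply: eq_bigr => j _.
  by rewrite valK mxE.
- move=> w E /eqP; rewrite -det_tr => /det0P [u /eqP Hu /kerB Hk]; apply: Hu.
  apply/rowP=> i; have := E _ Hk (val i) (elimT ltP (ltn_ord i)).
  by rewrite valK !mxE.
Qed.

End Det.

(** * Reduction modulo the critical equations *)

Module Elim.
Import Poly Analysis.

Lemma sumN_ext N f g : (forall j, (j < N)%nat -> f j = g j) -> sumN N f = sumN N g.
Proof.
  intros H. induction N as [|N IH]; simpl; auto. rewrite H by lia. rewrite IH; auto.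
Qed.

Lemma sumN_add N f g : sumN N (fun j => f j + g j) = sumN N f + sumN N g.
Proof. induction N as [|N IH]; simpl; [ring|]. rewrite IH. ring. Qed.

Lemma sumN_scal N a f : sumN N (fun j => a * f j) = a * sumN N f.
Proof. induction N as [|N IH]; simpl; [ring|]. rewrite IH. ring. Qed.

Lemma sumN_0 N : sumN N (fun _ => 0) = 0.
Proof. induction N as [|N IH]; simpl; [ring|]. rewrite IH. ring. Qed.

Lemma sumN_one N i a : (i < N)%nat -> sumN N (fun j => if Nat.eqb j i then a j else 0) = a i.
Proof.
  induction N as [|N IH]; simpl; intros Hi; [lia|]. destruct (Nat.eq_dec i N) as [->|Hn].
  - rewrite Nat.eqb_refl. rewrite (sumN_ext _ _ (fun _ => 0)), sumN_0; [ring|].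
    intros j Hj. replace (Nat.eqb j N) with false; auto. symmetry; apply Nat.eqb_neq; lia.
  - rewrite IH by lia. replace (Nat.eqb N i) with false; [ring|]. symmetry; apply Nat.eqb_neq; lia.
Qed.

(** Base [b] digits: [j < b ^ k] ranges over all exponent vectors of length [k] with entries below
    [b] and so indexes the basis monomials. *)
Fixpoint dig (b j i : nat) : nat :=
  match i with O => (j mod b)%nat | S i' => dig b (j / b) i' end.

Lemma dig_lt b j i : (0 < b)%nat -> (dig b j i < b)%nat.
Proof.
  intros Hb. revert j. induction i; intros j; simpl; auto. apply Nat.mod_upper_bound. lia.
Qed.

Lemma dig_onto b k (e : nat -> nat) : (forall i, (i < k)%nat -> (e i < b)%nat) ->
  exists j, (j < b ^ k)%nat /\ forall i, (i < k)%nat -> dig b j i = e i.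
Proof.
  revert e. induction k as [|k IH]; intros e H.
  - exists O. simpl. split; [lia|]. intros; lia.
  - destruct (IH (fun i => e (S i))) as (j & H1 & H2); [intros; apply H; lia|].
    assert (H0 := H O ltac:(lia)). exists (e O + j * b)%nat. split.
    + simpl. nia.
    + intros i Hi. destruct i as [|i]; simpl.
      * rewrite Nat.Div0.mod_add. apply Nat.mod_small; auto.
      * rewrite Nat.div_add by lia. rewrite Nat.div_small by auto. simpl. apply H2. lia.
Qed.

Definition shift (q : nat) {A : Type} (x : nat -> A) : nat -> A := fun i => x (q + i)%nat.

Lemma mon_split q k e x : mon (q + k) e x = mon q e x * mon k (shift q e) (shift q x).
Proof.
  induction k as [|k IH]; simpl.
  - rewrite Nat.add_0_r. ring.
  - rewrite Nat.add_succ_r. simpl. rewrite IH. unfold shift. ring.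
Qed.

Lemma mdeg_split q k e : mdeg (q + k) e = (mdeg q e + mdeg k (shift q e))%nat.
Proof.
  induction k as [|k IH]; simpl.
  - rewrite Nat.add_0_r. ring.
  - rewrite Nat.add_succ_r. simpl. rewrite IH. unfold shift. ring.
Qed.

(* [crit] rewrites [tau * x_i ^ b] into terms of lower degree, so that up to a power of [tau] every polynomial
   becomes a combination of the [b ^ k] monomials of degree below [b] in each of the last [k] variables. *)
Section Reduction.
Variables (q k b : nat) (Pf : poly) (Hf d2 : nat).
Hypothesis Hdeg : degle (q + k) d2 Pf.
Hypothesis Hb : b = S d2.
Hypothesis Hf1 : (1 <= Hf)%nat.
Hypothesis Hder : forall i, (i < k)%nat -> (nrm (pder (q + i) Pf) <= Hf)%nat.

Let N := (b ^ k)%nat.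

Definition crit (x : point) (tau : R) : Prop :=
  forall i, (i < k)%nat -> tau * x (q + i)%nat ^ b = eval (q + k) (pder (q + i) Pf) x.

Definition basis (j : nat) (x : point) : R := mon k (dig b j) (shift q x).

Definition indep (i : nat) (g : point -> R) : Prop := forall w r, g (upd w i r) = g w.

(** Coordinates of [w]: the [q] parameters, the critical value at [q], and [tau] at [S q]. The
    coefficients must not depend on coordinate [q], so that the critical value can later be varied
    with the matrix fixed. *)
Definition red (g D H : nat) (u : point -> R) : Prop :=
  exists c : nat -> point -> R,
    (forall j, pol (S (S q)) D H (c j) /\ indep q (c j)) /\
    forall x w, (forall i, (i < q)%nat -> w i = x i) -> crit x (w (S q)) ->
      w (S q) ^ g * u x = sumN N (fun j => c j w * basis j x).

Lemma red_ext g D H u u' : (forall x, u x = u' x) -> red g D H u -> red g D H u'.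
Proof.
  intros E (c & H1 & H2). exists c. split; auto. intros. rewrite <- E. auto.
Qed.

Lemma red_eval g D H P : (forall c e, In (c, e) P -> red g D H (mon (q + k) e)) ->
  red g D (nrm P * H) (eval (q + k) P).
Proof.
  induction P as [|[c e] P IH]; intros HP; simpl.
  - exists (fun _ _ => IZR 0). split.
    + intros _. split; [eapply pol_le; [| |apply (pol_const _ 0)]; simpl; lia|now intros ? ?].
    + intros. rewrite (sumN_ext _ _ (fun _ => 0)), sumN_0; [ring|]. intros; ring.
  - destruct (HP c e (or_introl eq_refl)) as (c1 & A1 & B1).
    destruct IH as (c2 & A2 & B2); [intros c' e' H'; apply (HP c'); now right|].
    exists (fun j w => IZR c * c1 j w + c2 j w). split.
    + intros j. destruct (A1 j) as [P1 I1], (A2 j) as [P2 I2]. split.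
      * rewrite Nat.mul_add_distr_r. apply pol_add; auto.
        apply (pol_mul _ 0 D (Z.abs_nat c) H (fun _ => IZR c)); auto. apply pol_const.
      * intros w r. now rewrite I1, I2.
    + intros x w Hw Hc.
      rewrite (sumN_ext _ _ (fun j => IZR c * (c1 j w * basis j x) + c2 j w * basis j x)) by (intros; ring).
      rewrite sumN_add, sumN_scal, <- B1, <- B2 by auto. ring.
Qed.

(** Each use of a critical equation trades [x_i ^ b] for terms of degree at most [d2 = b - 1], so
    the degree in the last [k] variables drops and [g] uses suffice. Each costs one factor [tau], a
    factor [Hf] in the norm and at most [b] in the degree of the coefficients. *)
Lemma red_mon g : forall D e, (mdeg k (shift q e) <= g)%nat -> (mdeg q e <= D)%nat ->
  red g (D + g * b) (Hf ^ g) (mon (q + k) e).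
Proof.
  induction g as [g IH] using (well_founded_induction lt_wf). intros D e Hg HD.
  destruct (classic (exists i, (i < k)%nat /\ (b <= e (q + i))%nat)) as [(i & Hi & Hbi)|Hn].
  - assert (Hle : (e (q + i) <= mdeg k (shift q e))%nat).
    { apply (mdeg_coord k (shift q e) i Hi). }
    destruct g as [|g']; [lia|].
    set (e' := fun j => if Nat.eqb j (q + i) then (e j - b)%nat else e j).
    assert (Ee : forall x, mon (q + k) e x = x (q + i)%nat ^ b * mon (q + k) e' x).
    { intros x. rewrite <- (mon_single (q + k) (q + i) b x) by lia. rewrite <- mon_add.
      apply mon_ext. intros j _. split; auto. unfold e', single.
      destruct (Nat.eqb j (q + i)) eqn:E; [apply Nat.eqb_eq in E; subst j|]; lia. }
    assert (Em : (mdeg k (shift q e') + b = mdeg k (shift q e))%nat).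
    { rewrite <- (mdeg_single k i b Hi) at 1. rewrite <- mdeg_add. apply mdeg_ext. intros j Hj.
    unfold shift, e', single.
      destruct (Nat.eqb j i) eqn:E.
      - apply Nat.eqb_eq in E. subst j. rewrite Nat.eqb_refl. lia.
      - apply Nat.eqb_neq in E. replace (Nat.eqb (q + j) (q + i)) with false; [lia|].
        symmetry; apply Nat.eqb_neq; lia. }
    assert (Eq : mdeg q e' = mdeg q e).
    { apply mdeg_ext. intros j Hj. unfold e'. replace (Nat.eqb j (q + i)) with false; auto.
      symmetry; apply Nat.eqb_neq; lia. }
    set (P := scalemon 1 e' (pder (q + i) Pf)).
    assert (HP : red g' (D + d2 + g' * b) (nrm P * Hf ^ g') (eval (q + k) P)).
    { apply red_eval. intros c0 e0 H0. apply in_map_iff in H0. destruct H0 as [[c1 e1] [E1 H1]].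
      injection E1 as <- <-. simpl.
      apply (degle_pder _ (q + i) _ _ Hdeg) in H1. rewrite mdeg_split in H1.
      apply IH; [lia| |].
      - change (shift q (fun i0 => (e' i0 + e1 i0)%nat)) with (fun i0 => (shift q e' i0 + shift q e1 i0)%nat).
        rewrite mdeg_add. lia.
      - rewrite mdeg_add. lia. }
    destruct HP as (c & A & B). exists c. split.
    + intros j. destruct (A j) as [A1 A2]. split; auto. eapply pol_le; [| |apply A1].
      * simpl. lia.
      * simpl. apply Nat.mul_le_mono_r. unfold P. rewrite nrm_scalemon.
        specialize (Hder i Hi). simpl. lia.
    + intros x w Hw Hc. rewrite <- B by auto. unfold P. rewrite eval_scalemon, <- (Hc i Hi), Ee. simpl. ring.
  - destruct (dig_onto b k (shift q e)) as (j0 & Hj0 & Hd).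
    { intros i Hi. unfold shift. apply Nat.nle_gt. intros H. apply Hn. eauto. }
    (* No reduction is left, but the unspent power of [tau] is still multiplied in: all monomials
       must carry the same power to be added. *)
    exists (fun j w => if Nat.eqb j j0 then w (S q) ^ g * mon q e w else 0). split.
    + assert (Hpow : (1 <= Hf ^ g)%nat) by (apply Nat.neq_0_lt_0, Nat.pow_nonzero; lia).
      intros j. destruct (Nat.eqb j j0); split.
      * set (e1 := fun i => if Nat.ltb i q then e i else if Nat.eqb i (S q) then g else O).
        assert (Eq : forall x, mon q e1 x = mon q e x).
        { intros x. apply mon_ext. intros i Hi. split; auto. unfold e1.
          replace (Nat.ltb i q) with true; auto. symmetry; apply Nat.ltb_lt; auto. }
        assert (Eq' : mdeg q e1 = mdeg q e).
        { apply mdeg_ext. intros i Hi. unfold e1.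
          replace (Nat.ltb i q) with true; auto. symmetry; apply Nat.ltb_lt; auto. }
        assert (E2 : e1 q = O).
        { unfold e1. rewrite Nat.ltb_irrefl. replace (Nat.eqb q (S q)) with false; auto.
          symmetry; apply Nat.eqb_neq; lia. }
        assert (E3 : e1 (S q) = g).
        { unfold e1. rewrite Nat.eqb_refl. replace (Nat.ltb (S q) q) with false; auto.
          symmetry; apply Nat.ltb_ge; lia. }
        apply (pol_ext _ _ _ (mon (S (S q)) e1)).
        -- intros w. simpl. rewrite Eq, E2, E3. simpl. ring.
        -- eapply pol_le; [| |apply pol_mon]; auto. simpl. rewrite Eq', E2, E3. clear - HD Hb. nia.
      * intros w r. rewrite upd_other by lia. f_equal. apply mon_ext. intros i Hi. split; auto.
        apply upd_other. lia.
      * eapply pol_le; [| |apply (pol_const _ 0)]; simpl; lia.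
      * intros w r. auto.
    + intros x w Hw Hc.
      rewrite (sumN_ext _ _ (fun j => if Nat.eqb j j0 then (w (S q) ^ g * mon q e w) * basis j x else 0)).
      * rewrite (sumN_one N j0 (fun j => w (S q) ^ g * mon q e w * basis j x)) by auto.
        rewrite mon_split. unfold basis.
        rewrite (mon_ext k (dig b j0) (shift q e) _ (shift q x)) by (intros; auto).
        rewrite (mon_ext q e e w x) by (intros; auto). ring.
      * intros j _. destruct (Nat.eqb j j0); ring.
Qed.

(** The degree of [Pf] plus the largest degree [d2 * k] of a basis monomial, hence enough reductions
    for their product. *)
Definition Gexp : nat := (d2 + d2 * k)%nat.

Lemma red_step j0 : red Gexp (d2 + Gexp * b) (nrm Pf * Hf ^ Gexp) (fun x => eval (q + k) Pf x * basis j0 x).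
Proof.
  set (e0 := fun i => if Nat.ltb i q then O else dig b j0 (i - q)).
  assert (E1 : forall x, mon (q + k) e0 x = basis j0 x).
  { intros x. rewrite mon_split. rewrite (mon_ext q e0 (fun _ => O) x x), mon_0.
    - rewrite Rmult_1_l. apply mon_ext. intros i Hi. split; auto. unfold shift, e0.
      replace (Nat.ltb (q + i) q) with false by (symmetry; apply Nat.ltb_ge; lia). f_equal. lia.
    - intros i Hi. split; auto. unfold e0. replace (Nat.ltb i q) with true; auto.
      symmetry; apply Nat.ltb_lt; auto. }
  assert (E2 : mdeg q e0 = O).
  { rewrite (mdeg_ext q e0 (fun _ => O)), mdeg_0; auto. intros i Hi. unfold e0.
    replace (Nat.ltb i q) with true; auto. symmetry; apply Nat.ltb_lt; auto. }
  assert (E3 : (mdeg k (shift q e0) <= d2 * k)%nat).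
  { apply mdeg_bound. intros i Hi. unfold shift, e0.
    replace (Nat.ltb (q + i) q) with false by (symmetry; apply Nat.ltb_ge; lia).
    assert (Hl : (dig b j0 (q + i - q) < b)%nat) by (apply dig_lt; lia). lia. }
  apply (red_ext _ _ _ (eval (q + k) (scalemon 1 e0 Pf))).
  { intros x. rewrite eval_scalemon, E1. simpl. ring. }
  replace (nrm Pf) with (nrm (scalemon 1 e0 Pf)) by (rewrite nrm_scalemon; simpl; lia).
  apply red_eval. intros c e H. apply in_map_iff in H. destruct H as [[c1 e1] [E H]].
  injection E as <- <-. simpl. apply Hdeg in H. rewrite mdeg_split in H.
  apply red_mon.
  - change (shift q (fun i0 => (e0 i0 + e1 i0)%nat)) with (fun i0 => (shift q e0 i0 + shift q e1 i0)%nat).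
    rewrite mdeg_add. unfold Gexp. lia.
  - rewrite mdeg_add. lia.
Qed.

(* The critical value is an eigenvalue of the matrix of multiplication by [Pf], up to [tau ^ Gexp]. *)
Lemma critical_value_pol : exists g,
  pol (S (S q)) (N * (d2 + Gexp * b + 1)) (N ^ N * (nrm Pf * Hf ^ Gexp + 1) ^ N) g /\ nonzero g /\
  forall x w, (forall i, (i < q)%nat -> w i = x i) -> crit x (w (S q)) ->
    w q = eval (q + k) Pf x -> g w = 0.
Proof.
  destruct (functional_choice _ (fun j => red_step j)) as (M & HM).
  (* Multiplication by [Pf] minus the critical value times the identity, both scaled by
     [tau ^ Gexp]. *)
  set (A := fun i j w => M i j w + (if Nat.eqb j i then - (w (S q) ^ Gexp * w q) else 0)).
  destruct (Det.det_pol (S (S q)) N (d2 + Gexp * b + 1) (nrm Pf * Hf ^ Gexp + 1) A) as (g & H1 & H2 & H3).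
  { intros i j. unfold A. apply pol_add.
    - destruct (HM i) as [HM1 _]. eapply pol_le; [| |apply HM1]; lia.
    - destruct (Nat.eqb j i).
      + apply pol_opp. apply (pol_ext _ _ _ (fun w => mon (S (S q)) (fun i => if Nat.eqb i q then 1%nat else if
          Nat.eqb i (S q) then Gexp else O) w)).
        * intros w. cbn [mon]. rewrite !Nat.eqb_refl.
          replace (Nat.eqb (S q) q) with false by (symmetry; apply Nat.eqb_neq; lia).
          rewrite (mon_ext q _ (fun _ => O) w w), mon_0; [ring|]. intros i' Hi'. split; auto.
          replace (Nat.eqb i' q) with false by (symmetry; apply Nat.eqb_neq; lia).
          replace (Nat.eqb i' (S q)) with false by (symmetry; apply Nat.eqb_neq; lia). auto.
        * eapply pol_le; [| |apply pol_mon]; auto. cbn [mdeg]. rewrite !Nat.eqb_refl.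
          replace (Nat.eqb (S q) q) with false by (symmetry; apply Nat.eqb_neq; lia).
          rewrite (mdeg_ext q _ (fun _ => O)), mdeg_0; [clear - Hb; nia|]. intros i' Hi'.
          replace (Nat.eqb i' q) with false by (symmetry; apply Nat.eqb_neq; lia).
          replace (Nat.eqb i' (S q)) with false by (symmetry; apply Nat.eqb_neq; lia). auto.
      + eapply pol_le; [| |apply (pol_const _ 0)]; simpl; lia. }
  assert (HN : (0 < N)%nat) by (apply Nat.neq_0_lt_0, Nat.pow_nonzero; lia).
  exists g. split; [auto|split].
  (* For nonvanishing, take the parameters 0, [tau = 1] and a critical value [C] above all absolute
     row sums: such a [C] is not an eigenvalue, as the coordinate of largest absolute value of an
     eigenvector shows. *)
  - set (w1 := fun i : nat => if Nat.eqb i (S q) then 1 else 0).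
    assert (HC : exists C, 0 < C /\ forall i, (i < N)%nat -> sumN N (fun j => Rabs (M i j w1)) < C).
    { assert (HC : forall n, exists C, 0 < C /\ forall i, (i < n)%nat -> sumN N (fun j => Rabs (M i j w1)) < C).
      { induction n as [|n (C & HC & IH)]; [exists 1; split; [lra|intros; lia]|].
        set (a := sumN N (fun j => Rabs (M n j w1))).
        exists (Rmax C (a + 1)). split; [eapply Rlt_le_trans; [apply HC|apply Rmax_l]|].
        intros i Hi. destruct (Nat.eq_dec i n) as [->|].
        - fold a. eapply Rlt_le_trans; [|apply Rmax_r]. lra.
        - eapply Rlt_le_trans; [apply IH; lia|apply Rmax_l]. }
      apply HC. }
    destruct HC as (C & HC0 & HC). set (w := upd w1 q C). exists w. apply H3. intros v Hv.
    assert (E : forall i, (i < N)%nat -> sumN N (fun j => M i j w1 * v j) = C * v i).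
    { intros i Hi. specialize (Hv i Hi). unfold A in Hv.
      rewrite (sumN_ext _ _ (fun j => M i j w1 * v j + (if Nat.eqb j i then - C * v j else 0))) in Hv.
      - rewrite sumN_add, (sumN_one N i (fun j => - C * v j) Hi) in Hv.
        apply Rplus_eq_reg_r with (- C * v i). etransitivity; [exact Hv|ring].
      - intros j _. destruct (HM i) as [HMi _]. destruct (HMi j) as [_ Hi']. unfold w. rewrite (Hi' w1 C).
        rewrite upd_same, upd_other by lia. unfold w1 at 2. rewrite Nat.eqb_refl, pow1.
        destruct (Nat.eqb j i); ring. }
    assert (Hmax : exists m, (m < N)%nat /\ forall i, (i < N)%nat -> Rabs (v i) <= Rabs (v m)).
    { clear - HN. induction N as [|n IH]; [lia|]. destruct n as [|n].
      - exists O. split; auto. intros i Hi. replace i with O by lia. lra.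
      - destruct IH as (m & Hm & IH); [lia|]. destruct (Rle_dec (Rabs (v (S n))) (Rabs (v m))).
        + exists m. split; [lia|]. intros i Hi. destruct (Nat.eq_dec i (S n)) as [->|]; auto. apply IH; lia.
        + exists (S n). split; [lia|]. intros i Hi. destruct (Nat.eq_dec i (S n)) as [->|]; [lra|].
          assert (Hi2 : (i < S n)%nat) by lia. specialize (IH i Hi2). lra. }
    destruct Hmax as (m & Hm & Hmax).
    assert (Hle : forall n, (n <= N)%nat -> Rabs (sumN n (fun j => M m j w1 * v j)) <= sumN n (fun j => Rabs (M
      m j w1)) * Rabs (v m)).
    { induction n as [|n IH]; simpl; intros Hn; [rewrite Rabs_R0; lra|].
      eapply Rle_trans; [apply Rabs_triang|]. rewrite Rmult_plus_distr_r.
      apply Rplus_le_compat; [apply IH; lia|].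
      rewrite Rabs_mult. apply Rmult_le_compat_l; [apply Rabs_pos|]. apply Hmax. lia. }
    specialize (Hle N (le_n _)). rewrite (E m Hm), Rabs_mult, (Rabs_right C) in Hle by lra.
    specialize (HC m Hm). pose proof (Rabs_pos (v m)).
    assert (Hz : Rabs (v m) = 0) by nra.
    intros i Hi. specialize (Hmax i Hi). rewrite Hz in Hmax. pose proof (Rabs_pos (v i)).
    destruct (Req_dec (v i) 0) as [|Hne]; auto. apply Rabs_pos_lt in Hne. lra.
  (* The kernel vector consists of the values of the basis monomials at [x]; it is nonzero because
     monomial 0 is the constant 1. *)
  - intros x w Hw Hc Hz. apply (H2 w (fun j => basis j x)).
    + exists O. split; auto. unfold basis. rewrite (mon_ext k (dig b 0) (fun _ => O) _ (shift q x)), mon_0.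
      * apply R1_neq_R0.
      * assert (Hd0 : forall i, dig b 0 i = O).
        { induction i; simpl; [apply Nat.Div0.mod_0_l|]. now rewrite Nat.Div0.div_0_l. }
        intros; auto.
    + intros i Hi. unfold A. destruct (HM i) as [_ HMi]. specialize (HMi x w Hw Hc).
      rewrite (sumN_ext _ _ (fun j => M i j w * basis j x + (if Nat.eqb j i then - (w (S q) ^ Gexp * w q) *
        basis j x else 0))).
      * rewrite sumN_add, (sumN_one N i (fun j => - (w (S q) ^ Gexp * w q) * basis j x) Hi).
        cbv beta in HMi. rewrite <- HMi, Hz. ring.
      * intros j _. destruct (Nat.eqb j i); ring.
Qed.

End Reduction.
End Elim.

(** * Boundaries of projections *)

Module Proj.
Import Poly Analysis Elim.

Definition opn (V : nat) (W : point -> Prop) : Prop :=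
  forall x, W x -> exists rho, 0 < rho /\ forall x', near V rho x x' -> W x'.

Definition cls (V : nat) (W : point -> Prop) (x : point) : Prop :=
  forall rho, 0 < rho -> exists x', near V rho x x' /\ W x'.

Definition bdry (V : nat) (W : point -> Prop) (x : point) : Prop := cls V W x /\ ~ W x.

Definition agree (q : nat) (x y : point) : Prop := forall i, (i < q)%nat -> x i = y i.

Definition proj (q : nat) (W : point -> Prop) (p : point) : Prop := exists x, agree q x p /\ W x.

Lemma coord_bound V (x : point) : exists B, 0 < B /\ forall i, (i < V)%nat -> Rabs (x i) <= B.
Proof.
  induction V as [|v (M & HM & IH)].
  - exists 1. split; [lra|]. intros; lia.
  - exists (Rmax M (Rabs (x v))). split.
    + eapply Rlt_le_trans; [apply HM|apply Rmax_l].
    + intros i Hi. destruct (Nat.eq_dec i v) as [->|]; [apply Rmax_r|].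
      eapply Rle_trans; [apply IH; lia|apply Rmax_l].
Qed.

Lemma near_eq V rho x y : 0 < rho -> agree V x y -> near V rho x y.
Proof. intros Hr H i Hi. now rewrite H, Rminus_diag, Rabs_R0. Qed.

Lemma agree_cluster q (y z : point) :
  (forall rho, 0 < rho -> near q rho y z) -> agree q y z.
Proof.
  intros H i Hi. apply NNPP; intros Hn.
  specialize (H (Rabs (z i - y i)) ltac:(apply Rabs_pos_lt; lra) i Hi). lra.
Qed.

Lemma opn_cls_sep V W x : ~ cls V W x -> exists rho, 0 < rho /\ forall x', near V rho x x' -> ~ W x'.
Proof.
  intros H. apply NNPP; intros Hn. apply H. intros rho Hr. apply NNPP; intros Hn'.
  apply Hn. exists rho. split; auto. intros x' Hx' HW. apply Hn'. eauto.
Qed.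

(** The first [q] coordinates converge and the others stay bounded, so the sequence clusters over
    [p]; the cluster point is only known to lie in the closure of [W]. *)
Lemma fibre_cluster V q (W : point -> Prop) (s : nat -> point) p B : (q <= V)%nat ->
  (forall j, W (s j)) -> (forall j, near q (/ (INR j + 1)) p (s j)) ->
  (forall j i, (q <= i < V)%nat -> Rabs (s j i) <= B) ->
  exists y, cls V W y /\ agree q y p /\
    forall rho J, 0 < rho -> exists j, (J <= j)%nat /\ near V rho y (s j).
Proof.
  intros HqV HW Hp HB. destruct (coord_bound q p) as (C & HC0 & HC).
  destruct (bounded_cluster V s (Rmax B (C + 1))) as (y & Hy).
  { intros j i Hi. destruct (Nat.lt_ge_cases i q) as [Hq|Hq].
    - eapply Rle_trans; [|apply Rmax_r]. specialize (HC i Hq). specialize (Hp j i Hq).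
      assert (/ (INR j + 1) <= 1).
      { rewrite <- Rinv_1. apply Rinv_le_contravar; pose proof (pos_INR j); lra. }
      replace (s j i) with (p i + (s j i - p i)) by ring.
      eapply Rle_trans; [apply Rabs_triang|]. lra.
    - eapply Rle_trans; [apply HB; lia|apply Rmax_l]. }
  exists y. split; [|split; auto].
  - intros rho Hr. destruct (Hy rho O Hr) as (j & _ & Hj). eauto.
  - apply agree_cluster. intros rho Hr.
    destruct (archimed_cor1 (rho / 2)) as (J & HJ & HJ0); [lra|].
    destruct (Hy (rho / 2) J) as (j & Hj & Hn); [lra|].
    apply (near_le q q (rho / 2 + rho / 2) rho); [lia|lra|].
    apply (near_trans q (rho / 2) (rho / 2) y (s j) p).
    + eapply near_le; [apply HqV|apply Rle_refl|auto].
    + apply near_sym. apply (near_le q q (/ (INR j + 1)) (rho / 2)); [lia| |auto].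
      apply Rlt_le. eapply Rle_lt_trans; [|apply HJ].
      apply inv_succ_le; auto.
Qed.

(** * Maxima over bounded fibres *)

Section Maximum.
Variables (V q : nat) (W : point -> Prop) (B : R).
Hypothesis HqV : (q <= V)%nat.
Hypothesis HB : forall x, W x -> forall i, (q <= i < V)%nat -> Rabs (x i) <= B.

Lemma cont_fibre_bounded (F : point -> R) (x0 : point) : cont V F ->
  exists M, forall x, W x -> agree q x x0 -> F x <= M.
Proof.
  intros HF. apply NNPP; intros Hn.
  assert (H : forall j, exists x, W x /\ agree q x x0 /\ INR j < F x).
  { intros j. apply NNPP; intros Hj. apply Hn. exists (INR j). intros x Hx Ha.
    apply Rnot_lt_le. intros Hl. apply Hj. eauto. }
  apply functional_choice in H. destruct H as (s & Hs).
  destruct (fibre_cluster V q W s x0 B HqV) as (y & _ & _ & Hy).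
  - intros j; apply Hs.
  - intros j. apply near_eq; [apply inv_succ_pos|].
    intros i Hi. symmetry. now apply Hs.
  - intros j. apply HB, Hs.
  - destruct (HF y 1) as (rho & Hr & Hc); [lra|].
    destruct (INR_unbounded (F y + 1)) as (J & HJ).
    destruct (Hy rho J Hr) as (j & Hj & Hn').
    specialize (Hc _ Hn'). apply Rabs_def2 in Hc. apply le_INR in Hj.
    destruct (Hs j) as (_ & _ & Hs'). lra.
Qed.

Lemma fibre_lub (F : point -> R) (x0 : point) : cont V F -> W x0 ->
  exists M, (forall x, W x -> agree q x x0 -> F x <= M) /\
    forall eta, 0 < eta -> exists x, W x /\ agree q x x0 /\ M - eta < F x.
Proof.
  intros HF Hx0. destruct (cont_fibre_bounded F x0 HF) as (M0 & HM0).
  destruct (completeness (fun r => exists x, W x /\ agree q x x0 /\ r = F x)) as (M & HM1 & HM2).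
  - exists M0. intros r (x & Hx & Ha & ->). auto.
  - exists (F x0), x0. repeat split; auto.
  - exists M. split.
    + intros x Hx Ha. apply HM1. eauto.
    + intros eta He. apply NNPP; intros Hn.
      assert (M <= M - eta); [|lra]. apply HM2. intros r (x & Hx & Ha & ->).
      apply Rnot_lt_le. intros Hl. apply Hn. eauto.
Qed.

(** A maximising sequence clusters in the closure of [W] at a point where [F] is at least the
    supremum, hence positive; as [F] is not positive on the boundary, this point is in [W]. *)
Lemma fibre_max (F : point -> R) (x0 : point) : cont V F -> W x0 -> 0 < F x0 ->
  (forall x, bdry V W x -> F x <= 0) ->
  exists x, W x /\ agree q x x0 /\ forall x', W x' -> agree q x' x0 -> F x' <= F x.
Proof.
  intros HF Hx0 Hpos Hb. destruct (fibre_lub F x0 HF Hx0) as (M & HM1 & HM2).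
  assert (H : forall j, exists x, W x /\ agree q x x0 /\ M - / (INR j + 1) < F x).
  { intros j. apply HM2. apply inv_succ_pos. }
  apply functional_choice in H. destruct H as (s & Hs).
  destruct (fibre_cluster V q W s x0 B HqV) as (y & Hcl & Hag & Hy).
  - intros j; apply Hs.
  - intros j. apply near_eq; [apply inv_succ_pos|].
    intros i Hi. symmetry. now apply Hs.
  - intros j. apply HB, Hs.
  - assert (HyM : M <= F y).
    { apply Rnot_lt_le. intros Hl. set (eta := (M - F y) / 2).
      destruct (HF y eta) as (rho & Hr & Hc); [unfold eta; lra|].
      destruct (archimed_cor1 eta) as (J & HJ & HJ0); [unfold eta; lra|].
      destruct (Hy rho J Hr) as (j & Hj & Hn').
      specialize (Hc _ Hn'). apply Rabs_def2 in Hc.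
      destruct (Hs j) as (_ & _ & Hs').
      assert (/ (INR j + 1) < eta).
      { eapply Rle_lt_trans; [|apply HJ]. apply inv_succ_le; auto. }
      unfold eta in *. lra. }
    exists y. assert (HWy : W y).
    { apply NNPP; intros Hn. assert (F y <= 0) by (apply Hb; split; auto).
      assert (F x0 <= M) by (apply HM1; [auto|intros i _; auto]). lra. }
    split; auto. split; auto. intros x' Hx' Ha. specialize (HM1 x' Hx' Ha). lra.
Qed.

End Maximum.

(** One number serves both bounds since they grow together: a determinant of size [N] multiplies the
    degree by about [N] and raises the norm to about the [N]-th power. *)
Definition cx (V s : nat) (g : point -> R) : Prop := pol V (2 ^ s) (2 ^ 2 ^ s) g.

Lemma cx_le V s s' g : (s <= s')%nat -> cx V s g -> cx V s' g.
Proof.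
  intros H. assert (2 ^ s <= 2 ^ s')%nat by (apply Nat.pow_le_mono_r; lia).
  apply pol_le; auto. apply Nat.pow_le_mono_r; lia.
Qed.

Lemma pow2_ge1 a : (1 <= 2 ^ a)%nat.
Proof. apply Nat.neq_0_lt_0, Nat.pow_nonzero. lia. Qed.

Lemma lt_pow2 a : (a < 2 ^ a)%nat.
Proof. apply Nat.pow_gt_lin_r. lia. Qed.

(** The bounds of [critical_value_pol] for [Pf = Q ^ 2] with [Q] of level [s]. The size [N] is at
    most [2 ^ ((s + 2) * k)] and the entries have degree at most [2 ^ (2 * s + k + 5)]; these
    exponents add up to less than [(s + 4) * (k + 2)], even with the additional unit that the
    logarithm of the norm requires. *)
Lemma elimination_bounds s k d2 b G N Hf h :
  d2 = (2 * 2 ^ s)%nat -> b = S d2 -> G = (d2 + d2 * k)%nat -> N = (b ^ k)%nat ->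
  h = (2 ^ 2 ^ s * 2 ^ 2 ^ s)%nat -> Hf = (d2 * h)%nat ->
  (N * (d2 + G * b + 1) <= 2 ^ ((s + 4) * (k + 2)))%nat /\
  (N ^ N * (h * Hf ^ G + 1) ^ N <= 2 ^ 2 ^ ((s + 4) * (k + 2)))%nat.
Proof.
  intros Ed Eb EG EN Eh EHf.
  assert (Hd : d2 = (2 ^ (s + 1))%nat) by (rewrite Ed, Nat.add_1_r, Nat.pow_succ_r'; auto).
  assert (Hb : (b <= 2 ^ (s + 2))%nat).
  { replace (s + 2)%nat with (S (s + 1)) by lia. rewrite Nat.pow_succ_r', <- Hd.
    pose proof (pow2_ge1 (s + 1)). lia. }
  assert (HG : (G <= 2 ^ (s + 1 + k))%nat).
  { rewrite EG, Nat.pow_add_r, <- Hd. pose proof (lt_pow2 k). nia. }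
  assert (HN : (N <= 2 ^ ((s + 2) * k))%nat).
  { rewrite EN, Nat.pow_mul_r. now apply Nat.pow_le_mono_l. }
  assert (HGb : (G * b <= 2 ^ (2 * s + k + 3))%nat).
  { replace (2 * s + k + 3)%nat with (s + 1 + k + (s + 2))%nat by lia. rewrite (Nat.pow_add_r _ (s + 1 + k)).
    now apply Nat.mul_le_mono. }
  assert (HD : (d2 + G * b + 1 <= 2 ^ (2 * s + k + 5))%nat).
  { replace (2 * s + k + 5)%nat with (S (S (2 * s + k + 3))) by lia. rewrite !Nat.pow_succ_r'.
    assert (d2 <= 2 ^ (2 * s + k + 3))%nat by (rewrite Hd; apply Nat.pow_le_mono_r; lia).
    pose proof (pow2_ge1 (2 * s + k + 3)). lia. }
  split.
  - apply Nat.le_trans with (2 ^ ((s + 2) * k) * 2 ^ (2 * s + k + 5))%nat; [now apply Nat.mul_le_mono|].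
    rewrite <- Nat.pow_add_r. apply Nat.pow_le_mono_r; lia.
  - assert (Hh : h = (2 ^ (2 ^ (s + 1)))%nat).
    { rewrite Eh, <- Nat.pow_add_r. f_equal. rewrite Nat.add_1_r, Nat.pow_succ_r'. lia. }
    assert (HHf : (Hf <= 2 ^ 2 ^ (s + 2))%nat).
    { rewrite EHf, Hh, Hd, <- Nat.pow_add_r. apply Nat.pow_le_mono_r; [lia|].
      replace (s + 2)%nat with (S (s + 1)) by lia. rewrite Nat.pow_succ_r'. pose proof (lt_pow2 (s + 1)). lia. }
    assert (HHfG : (Hf ^ G <= 2 ^ 2 ^ (2 * s + k + 3))%nat).
    { apply Nat.le_trans with ((2 ^ 2 ^ (s + 2)) ^ G)%nat; [now apply Nat.pow_le_mono_l|].
      rewrite <- Nat.pow_mul_r. apply Nat.pow_le_mono_r; [lia|].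
      replace (2 * s + k + 3)%nat with (s + 2 + (s + 1 + k))%nat by lia. rewrite (Nat.pow_add_r _ (s + 2)).
      now apply Nat.mul_le_mono_l. }
    assert (Hent : (h * Hf ^ G + 1 <= 2 ^ 2 ^ (2 * s + k + 5))%nat).
    { apply Nat.le_trans with (2 ^ (2 ^ (s + 1) + 2 ^ (2 * s + k + 3) + 1))%nat.
      - rewrite (Nat.pow_add_r 2 _ 1), (Nat.pow_add_r 2 (2 ^ (s + 1))), <- Hh.
        assert (1 <= h)%nat by (rewrite Hh; apply pow2_ge1).
        pose proof (pow2_ge1 (2 ^ (2 * s + k + 3))). change (2 ^ 1)%nat with 2%nat. nia.
      - apply Nat.pow_le_mono_r; [lia|].
        replace (2 * s + k + 5)%nat with (S (S (2 * s + k + 3))) by lia.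
        rewrite !(Nat.pow_succ_r' _ (S _)), !(Nat.pow_succ_r' 2 (2 * s + k + 3)).
        assert (2 ^ (s + 1) <= 2 ^ (2 * s + k + 3))%nat by (apply Nat.pow_le_mono_r; lia).
        pose proof (pow2_ge1 (2 * s + k + 3)). lia. }
    assert (HNN : (N ^ N <= 2 ^ ((s + 2) * k * N))%nat).
    { rewrite Nat.pow_mul_r. now apply Nat.pow_le_mono_l. }
    assert (HEN : ((h * Hf ^ G + 1) ^ N <= 2 ^ (2 ^ (2 * s + k + 5) * N))%nat).
    { rewrite Nat.pow_mul_r. now apply Nat.pow_le_mono_l. }
    eapply Nat.le_trans; [apply Nat.mul_le_mono; [apply HNN|apply HEN]|].
    rewrite <- Nat.pow_add_r. apply Nat.pow_le_mono_r; [lia|].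
    rewrite <- Nat.mul_add_distr_r.
    assert (Hs : ((s + 2) * k + 2 ^ (2 * s + k + 5) <= 2 ^ (2 * s + k + 6))%nat).
    { assert ((s + 2) * k <= 2 ^ (s + 2 + k))%nat.
      { rewrite Nat.pow_add_r. pose proof (lt_pow2 (s + 2)). pose proof (lt_pow2 k).
      apply Nat.mul_le_mono; lia. }
      assert (2 ^ (s + 2 + k) <= 2 ^ (2 * s + k + 5))%nat by (apply Nat.pow_le_mono_r; lia).
      replace (2 * s + k + 6)%nat with (S (2 * s + k + 5)) by lia. rewrite Nat.pow_succ_r'. lia. }
    eapply Nat.le_trans; [apply Nat.mul_le_mono; [apply Hs|apply HN]|].
    rewrite <- Nat.pow_add_r. apply Nat.pow_le_mono_r; lia.
Qed.

Section Projection.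
Variables (q k s : nat) (W : point -> Prop) (Q : point -> R).
Hypothesis HQ : cx (q + k) s Q.
Hypothesis Hnz : nonzero Q.
Hypothesis Hopn : opn (q + k) W.
Hypothesis Hbnd : forall x, W x -> forall i, (q <= i < q + k)%nat -> Rabs (x i) <= 1.
Hypothesis Hbdry : forall x, bdry (q + k) W x -> Q x = 0.

(* [m] is the maximum of [Q ^ 2] on the fibre; it is approached by the critical values of
   [Q ^ 2 - t * sum_i x_i ^ (2 deg Q + 2)] as [t] tends to 0. *)
Lemma fibre_max_root : exists g2, cx (S q) ((s + 4) * (k + 2)) g2 /\ nonzero g2 /\
  forall x0, W x0 -> Q x0 <> 0 ->
  exists m, 0 < m /\ g2 (upd x0 q m) = 0 /\
    forall eta, 0 < eta -> exists x, W x /\ agree q x x0 /\ m - eta < Q x * Q x.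
Proof.
  destruct HQ as (P & HP1 & HP2 & HP3).
  set (d2 := (2 * 2 ^ s)%nat). set (b := S d2). set (h := (2 ^ 2 ^ s * 2 ^ 2 ^ s)%nat).
  set (Hf := (d2 * h)%nat). set (Pf := pmul P P). set (V := (q + k)%nat).
  assert (Hd2 : (1 <= d2)%nat) by (unfold d2; pose proof (pow2_ge1 s); lia).
  assert (Hdeg : degle V d2 Pf).
  { unfold d2. replace (2 * 2 ^ s)%nat with (2 ^ s + 2 ^ s)%nat by lia. now apply degle_pmul. }
  assert (Hnrm : (nrm Pf <= h)%nat).
  { unfold Pf, h. rewrite nrm_pmul. now apply Nat.mul_le_mono. }
  assert (Hh1 : (1 <= h)%nat).
  { unfold h. pose proof (pow2_ge1 (2 ^ s)). nia. }
  assert (HHf1 : (1 <= Hf)%nat) by (unfold Hf; nia).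
  assert (Hder : forall i, (i < k)%nat -> (nrm (pder (q + i) Pf) <= Hf)%nat).
  { intros i Hi. eapply Nat.le_trans; [apply (nrm_pder V (q + i) d2); [unfold V; lia|auto]|].
    unfold Hf. now apply Nat.mul_le_mono_l. }
  assert (Ef : forall x, eval V Pf x = Q x * Q x).
  { intros x. unfold Pf. now rewrite eval_pmul, HP3. }
  destruct (critical_value_pol q k b Pf Hf d2 Hdeg eq_refl HHf1 Hder) as (g & Hg & Hgn & Hg0).
  assert (Hgc : cx (S (S q)) ((s + 4) * (k + 2)) g).
  { destruct (elimination_bounds s k d2 b (Gexp k d2) (b ^ k) Hf h) as [B1 B2]; auto.
    eapply pol_le; [apply B1| |apply Hg]. eapply Nat.le_trans; [|apply B2].
    apply Nat.mul_le_mono_l, Nat.pow_le_mono_l, Nat.add_le_mono_r, Nat.mul_le_mono_r. auto. }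
  (* Without the powers of [tau] the relation stays nontrivial at [tau = 0], where the supremum [m]
     without penalty is to be a root. *)
  destruct (pol_strip _ _ _ _ Hgc Hgn) as (a & g1 & H1 & H2 & H3 & H4).
  exists (fun x => g1 (upd x (S q) 0)). split; [exact H3|split; [exact H4|]].
  intros x0 Hx0 HQx0.
  assert (Hcont : cont V (fun x => Q x * Q x)).
  { apply (cont_ext _ (eval V Pf)); auto. apply cont_eval. }
  assert (HqV : (q <= V)%nat) by (unfold V; lia).
  destruct (fibre_lub V q W 1 HqV Hbnd _ x0 Hcont Hx0) as (m & Hm1 & Hm2).
  assert (Hm : 0 < m).
  { apply Rlt_le_trans with (Q x0 * Q x0); [nra|]. apply Hm1; auto. intros i _; auto. }
  exists m. split; auto. split; [|auto].
  apply NNPP; intros Hne.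
  set (w0 := upd (upd x0 q m) (S q) 0) in *.
  destruct (pol_cont _ _ _ _ H1 w0 (Rabs (g1 w0))) as (rho & Hr & Hc); [now apply Rabs_pos_lt|].
  (* Two losses of [r] are allowed: [xs] misses the supremum by less than [r], and the penalty costs
     at most [r]. Then [F xs > m - 2 * r >= 0], and the critical value is within [rho] of [m]. *)
  set (r := Rmin (rho / 2) (m / 2)). assert (Hr0 : 0 < r) by (apply Rmin_pos; lra).
  assert (Hr1 : r <= rho / 2) by apply Rmin_l. assert (Hr2 : r <= m / 2) by apply Rmin_r.
  destruct (Hm2 r Hr0) as (xs & Hxs & Has & Hxsm).
  (* The first term keeps the penalty on [W] below [r], the second keeps [tau = t * INR (S b)]
     within [rho / 2] of 0. *)
  set (t := Rmin (r / (INR k + 1)) (rho / (2 * INR (S b)))).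
  assert (HSb : 0 < INR (S b)) by (apply lt_0_INR; lia).
  pose proof (pos_INR k) as Hk0.
  assert (Ht0 : 0 < t) by (apply Rmin_pos; apply Rdiv_lt_0_compat; lra).
  assert (Ht1 : t * (INR k + 1) <= r).
  { apply Rle_trans with (r / (INR k + 1) * (INR k + 1)); [|right; field; lra].
    apply Rmult_le_compat_r; [lra|apply Rmin_l]. }
  assert (Ht2 : t * INR (S b) <= rho / 2).
  { apply Rle_trans with (rho / (2 * INR (S b)) * INR (S b)); [|right; field; lra].
    apply Rmult_le_compat_r; [lra|apply Rmin_r]. }
  (* The exponent [S b] is the even number [2 * (2 ^ s + 1)], so the penalty is nonnegative. *)
  set (reg := fun x : point => sumN k (fun i => x (q + i)%nat ^ S b)).
  assert (Hreg0 : forall x, 0 <= reg x).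
  { intros x. unfold reg. clear. induction k as [|k' IH]; simpl; [lra|].
    assert (0 <= x (q + k')%nat ^ S b); [|simpl in *; lra].
    unfold b, d2. replace (S (S (2 * 2 ^ s))) with (2 * (2 ^ s + 1))%nat by lia.
    rewrite pow_mult. apply pow_le. nra. }
  assert (Hreg1 : forall x, W x -> reg x <= INR k).
  { intros x Hx. unfold reg.
    assert (Hreg : forall n, (n <= k)%nat -> sumN n (fun i => x (q + i)%nat ^ S b) <= INR n); [|apply Hreg;
      lia].
    induction n as [|n IH]; cbn [sumN]; intros Hn; [simpl; lra|].
    rewrite S_INR. apply Rplus_le_compat; [apply IH; lia|].
    eapply Rle_trans; [apply Rle_abs|]. rewrite <- RPow_abs. rewrite <- (pow1 (S b)).
    apply pow_incr. split; [apply Rabs_pos|]. apply Hbnd; auto. lia. }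
  set (F := fun x => Q x * Q x - t * reg x).
  assert (HFc : cont V F).
  { unfold F. apply cont_sub; auto. apply cont_mul; [apply cont_const|]. unfold reg.
    assert (Hreg : forall n, (n <= k)%nat -> cont V (fun x => sumN n (fun i => x (q + i)%nat ^ S b))); [|apply
      Hreg; lia].
    induction n as [|n IH]; cbn [sumN]; intros Hn; [apply cont_const|].
    apply cont_add; [apply IH; lia|]. apply cont_pow, cont_var. unfold V; lia. }
  assert (HFs : m - r - r < F xs).
  { unfold F. specialize (Hreg1 xs Hxs).
    assert (t * reg xs <= t * INR k) by (apply Rmult_le_compat_l; lra). lra. }
  destruct (fibre_max V q W 1 HqV Hbnd F xs HFc Hxs) as (x & HWx & Hax & Hmax).
  { lra. }
  { intros y Hy. unfold F. rewrite (Hbdry y Hy). specialize (Hreg0 y).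
    assert (0 <= t * reg y) by (apply Rmult_le_pos; lra). lra. }
  assert (Hax0 : agree q x x0) by (intros i Hi; rewrite Hax, Has; auto).
  (* Differentiating [t * y ^ S b] yields [tau * y ^ b], the shape that [crit] asks for. *)
  set (tau := t * INR (S b)). assert (Htau : 0 < tau) by (apply Rmult_lt_0_compat; lra).
  assert (Hcrit : crit q k b Pf x tau).
  { intros i Hi.
    set (phi := fun z => eval V Pf (upd x (q + i) z) - t * (sumN k (fun j => if Nat.eqb j i then 0 else x (q +
      j)%nat ^ S b) + z ^ S b)).
    assert (Ephi : forall z, phi z = F (upd x (q + i) z)).
    { intros z. unfold phi, F. rewrite Ef. apply f_equal. apply (f_equal (Rmult t)). unfold reg.
      rewrite <- (sumN_one k i (fun _ => z ^ S b) Hi), <- sumN_add.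
      apply sumN_ext. intros j _. destruct (Nat.eqb j i) eqn:E.
      - apply Nat.eqb_eq in E. subst j. rewrite upd_same. apply Rplus_0_l.
      - apply Nat.eqb_neq in E. rewrite upd_other by lia. apply Rplus_0_r. }
    assert (Hx' : upd x (q + i) (x (q + i)%nat) = x).
    { extensionality j. unfold upd. destruct (Nat.eqb j (q + i)) eqn:E; auto. apply Nat.eqb_eq in E. now subst.
    }
    assert (Hz : eval V (pder (q + i) Pf) x - t * (0 + INR (S b) * x (q + i)%nat ^ (Nat.pred (S b))) = 0).
    { destruct (Hopn x HWx) as (r1 & Hr1' & HW1).
      apply (local_max_der phi (x (q + i)%nat) _ r1 Hr1').
      - intros z Hz. rewrite !Ephi, Hx'. apply Hmax.
        + apply HW1. intros j Hj. unfold upd. destruct (Nat.eqb j (q + i)) eqn:E.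
          * apply Nat.eqb_eq in E. now subst.
          * now rewrite Rminus_diag, Rabs_R0.
        + intros j Hj. rewrite upd_other by lia. now apply Hax.
      - apply (derivable_pt_lim_minus (fun z => eval V Pf (upd x (q + i) z))
          (fun z => t * (sumN k (fun j => if Nat.eqb j i then 0 else x (q + j)%nat ^ S b) + z ^ S b))).
        + apply eval_der. unfold V; lia.
        + apply (derivable_pt_lim_scal (fun z => sumN k (fun j => if Nat.eqb j i then 0 else x (q + j)%nat ^ S
            b) + z ^ S b)).
          apply (derivable_pt_lim_plus (fun _ => sumN k (fun j => if Nat.eqb j i then 0 else x (q + j)%nat ^ S
            b)) (fun z => z ^ S b)).
          * apply derivable_pt_lim_const.
          * apply derivable_pt_lim_pow. }
    simpl Nat.pred in Hz. unfold tau. fold V.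
    apply Rminus_diag_uniq. rewrite <- Ropp_0, <- Hz. ring. }
  set (w := upd (upd x q (Q x * Q x)) (S q) tau).
  assert (Hgw : g w = 0).
  { apply (Hg0 x w).
    - intros i Hi. unfold w. now rewrite !upd_other by lia.
    - unfold w. now rewrite upd_same.
    - unfold w. rewrite upd_other, upd_same by lia. now rewrite <- Ef. }
  rewrite H2 in Hgw. unfold w at 1 in Hgw. rewrite upd_same in Hgw.
  apply Rmult_integral in Hgw. destruct Hgw as [Hgw|Hgw].
  { apply (pow_nonzero tau a) in Hgw; auto; lra. }
  assert (Hnear : near (S (S q)) rho w0 w).
  { intros i Hi. unfold w, w0. destruct (Nat.eq_dec i (S q)) as [->|Hi1].
    - rewrite !upd_same, Rminus_0_r, Rabs_right by lra. unfold tau. lra.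
    - rewrite !(upd_other _ (S q)) by auto. destruct (Nat.eq_dec i q) as [->|Hi2].
      + rewrite !upd_same. assert (F xs <= F x) by (apply Hmax; [auto|intros ? _; auto]).
        assert (Q x * Q x <= m) by (apply Hm1; auto).
        assert (F x <= Q x * Q x).
        { unfold F. specialize (Hreg0 x). assert (0 <= t * reg x) by (apply Rmult_le_pos; lra). lra. }
        rewrite Rabs_minus_sym. rewrite Rabs_right by lra. lra.
      + rewrite !upd_other by auto. rewrite Hax0 by lia. rewrite Rminus_diag, Rabs_R0. lra. }
  specialize (Hc w Hnear). rewrite Hgw, Rminus_0_l, Rabs_Ropp in Hc. lra.
Qed.

(** Over points tending to a boundary point [p] of the projection, the maximum of [Q ^ 2] becomes
    arbitrarily small: otherwise points with [Q ^ 2] bounded away from 0 would cluster over [p] in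
    the closure of [W], off its boundary, and [p] would be in the projection. So [p] with value 0 is
    a limit of roots of the relation freed of powers of the value. *)
Theorem proj_boundary : exists P, cx q ((s + 4) * (k + 2)) P /\ nonzero P /\
  forall p, bdry q (proj q W) p -> P p = 0.
Proof.
  destruct fibre_max_root as (g2 & Hg2 & Hg2n & Hroot).
  destruct (pol_strip _ _ _ _ Hg2 Hg2n) as (a & g3 & H1 & H2 & H3 & H4).
  exists (fun x => g3 (upd x q 0)). split; [exact H3|split; [exact H4|]].
  intros p (Hcl & Hnp). apply NNPP; intros Hne.
  set (V := (q + k)%nat). assert (HqV : (q <= V)%nat) by (unfold V; lia).
  destruct (pol_cont _ _ _ _ H1 (upd p q 0) (Rabs (g3 (upd p q 0)))) as (rho & Hr & Hc); [now apply
    Rabs_pos_lt|].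
  (* [Q x <> 0] makes the fibre maximum positive, so that the power of the value can be cancelled;
     density of the non-zeros provides such points in the open set. *)
  assert (Hseq : forall j, exists x, W x /\ near q (/ (INR j + 1)) p x /\ Q x <> 0).
  { intros j. assert (Hj : 0 < / (INR j + 1)) by (apply inv_succ_pos).
    destruct (Hcl (/ (INR j + 1) / 2)) as (p' & Hp' & x & Hx & HWx); [lra|].
    destruct (Hopn x HWx) as (r & Hr0 & HrW).
    destruct (pol_dense _ _ _ _ x (Rmin r (/ (INR j + 1) / 2)) HQ Hnz) as (x' & Hx' & HQx'); [apply Rmin_pos;
      lra|].
    exists x'. split; [|split; auto].
    - apply HrW. eapply near_le; [apply le_n|apply Rmin_l|apply Hx'].
    - apply (near_le q q (/ (INR j + 1) / 2 + / (INR j + 1) / 2)); [lia|lra|].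
      apply (near_trans q _ _ p x x').
      + intros i Hi. rewrite (Hx i Hi). auto.
      + eapply near_le; [apply HqV|apply Rmin_r|apply Hx']. }
  assert (Hclaim : exists x, W x /\ near q rho p x /\ Q x <> 0 /\
    forall x', W x' -> agree q x' x -> Q x' * Q x' <= rho / 2).
  { apply NNPP; intros Hn.
    (* The second alternative fills in the finitely many indices whose radius is not below [rho], so
       that a full sequence can be chosen. *)
    assert (Hbad : forall j, exists x, W x /\ near q (/ (INR j + 1)) p x /\ (rho / 2 < Q x * Q x \/ rho <= /
      (INR j + 1))).
    { intros j. destruct (Hseq j) as (x & Hx1 & Hx2 & Hx3).
      destruct (Rle_dec rho (/ (INR j + 1))) as [Hle|Hgt]; [exists x; auto|].
      apply NNPP; intros Hb. apply Hn. exists x. split; auto. split.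
      - eapply near_le; [apply le_n| |apply Hx2]. lra.
      - split; auto. intros x' Hx' Ha. apply Rnot_lt_le. intros Hl. apply Hb. exists x'.
        split; auto. split; auto. intros i Hi. rewrite Ha by auto. apply Hx2; auto. }
    apply functional_choice in Hbad. destruct Hbad as (sq & Hsq).
    destruct (fibre_cluster V q W sq p 1 HqV) as (y & Hy1 & Hy2 & Hy3).
    - intros j; apply Hsq.
    - intros j; apply Hsq.
    - intros j. apply Hbnd, Hsq.
    - assert (HQy : Q y <> 0).
      { intros Ey.
        assert (Hcont : cont V (fun x => Q x * Q x)) by (apply cont_mul; eapply pol_cont; apply HQ).
        destruct (Hcont y (rho / 2)) as (r & Hr0 & Hrc); [lra|].
        destruct (archimed_cor1 rho Hr) as (J & HJ & HJ0).
        destruct (Hy3 r J Hr0) as (j & Hj & Hn'). specialize (Hrc _ Hn'). rewrite Ey in Hrc.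
        apply Rabs_def2 in Hrc. destruct (Hsq j) as (_ & _ & [Hs|Hs]); [lra|].
        assert (/ (INR j + 1) <= / INR J).
        { apply inv_succ_le; auto. }
        lra. }
      apply HQy. apply Hbdry. split; auto. intros HWy. apply Hnp. exists y. split; auto. }
  destruct Hclaim as (x & Hx1 & Hx2 & Hx3 & Hx4).
  destruct (Hroot x Hx1 Hx3) as (m & Hm0 & Hgm & Hmx).
  assert (Hm : m <= rho / 2).
  { apply Rnot_lt_le. intros Hl. destruct (Hmx (m - rho / 2)) as (x' & A1 & A2 & A3); [lra|].
    specialize (Hx4 x' A1 A2). lra. }
  rewrite H2, upd_same in Hgm. apply Rmult_integral in Hgm. destruct Hgm as [Hgm|Hgm].
  { apply (pow_nonzero m a) in Hgm; auto; lra. }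
  assert (Hn : near (S q) rho (upd p q 0) (upd x q m)).
  { intros i Hi. destruct (Nat.eq_dec i q) as [->|Hi'].
    - rewrite !upd_same, Rminus_0_r, Rabs_right; lra.
    - rewrite !upd_other by auto. apply Hx2. lia. }
  specialize (Hc _ Hn). rewrite Hgm, Rminus_0_l, Rabs_Ropp in Hc. lra.
Qed.

End Projection.
End Proj.

(** * Thresholds *)

Module Plane.
Import Poly Analysis Elim Proj.

(** Take the supremum of the parameters whose points are not in [T]: it is attained because the
    complement of an open set is closed, and points of [T] follow it immediately. *)
Lemma segment_bdry V (T : point -> Prop) (x y : point) : opn V T -> ~ T x -> T y ->
  exists s, 0 <= s <= 1 /\ bdry V T (fun i => x i + s * (y i - x i)).
Proof.
  intros Ho Hx Hy. set (z := fun s i => x i + s * (y i - x i)).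
  assert (z0 : z 0 = x) by (extensionality i; unfold z; ring).
  assert (z1 : z 1 = y) by (extensionality i; unfold z; ring).
  destruct (coord_bound V (fun i => y i - x i)) as (M & HM & HMb).
  assert (Hz : forall rho, 0 < rho -> exists eta, 0 < eta /\ forall s s', Rabs (s' - s) < eta -> near V rho (z
    s) (z s')).
  { intros rho Hr. exists (rho / M). split; [now apply Rdiv_lt_0_compat|]. intros s s' Hs i Hi.
    unfold z. replace (x i + s' * (y i - x i) - (x i + s * (y i - x i))) with ((s' - s) * (y i - x i)) by ring.
    rewrite Rabs_mult. apply Rle_lt_trans with (Rabs (s' - s) * M).
    - apply Rmult_le_compat_l; [apply Rabs_pos|]. apply HMb; auto.
    - apply Rlt_le_trans with (rho / M * M); [now apply Rmult_lt_compat_r|right; field; lra]. }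
  destruct (completeness (fun s => 0 <= s <= 1 /\ ~ T (z s))) as (s & Hs1 & Hs2).
  - exists 1. intros s [H _]. lra.
  - exists 0. split; [lra|now rewrite z0].
  - assert (H0 : 0 <= s) by (apply Hs1; split; [lra|now rewrite z0]).
    assert (H1 : s <= 1) by (apply Hs2; intros u [H _]; lra).
    assert (HT : ~ T (z s)).
    { intros HT. destruct (Ho _ HT) as (rho & Hr & HW). destruct (Hz rho Hr) as (eta & He & Hn).
      assert (s <= s - eta); [|lra]. apply Hs2. intros u [Hu1 Hu2]. apply Rnot_lt_le. intros Hl.
      apply Hu2, HW, Hn. assert (u <= s) by (apply Hs1; auto). apply Rabs_def1; lra. }
    assert (Hs : s < 1).
    { apply Rnot_le_lt. intros H. apply HT. replace s with 1 by lra. now rewrite z1. }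
    exists s. split; [auto|]. split; auto. intros rho Hr. destruct (Hz rho Hr) as (eta & He & Hn).
    set (u := Rmin 1 (s + eta / 2)). exists (z u).
    assert (u <= 1) by apply Rmin_l. assert (u <= s + eta / 2) by apply Rmin_r.
    assert (s < u) by (apply Rmin_glb_lt; lra).
    split; [apply Hn; apply Rabs_def1; lra|]. apply NNPP; intros HTu.
    assert (u <= s); [|lra]. apply Hs1. split; [lra|auto].
Qed.

(* With [d = 1/M], the number [M ^ D * g(d,0)] is a nonzero integer, and [g(d,e)] is [h e]-close to [g(d,0)]. *)
Lemma pol2_root D h g M (p : point) : pol 2 D h g -> (1 <= M)%nat ->
  p 0%nat = / INR M -> 0 < p 1%nat <= 1 -> g p = 0 -> g (upd p 1 0) <> 0 ->
  1 <= p 1%nat * INR h * INR M ^ D.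
Proof.
  intros (P & P1 & P2 & P3) HM Hp0 Hp1 Hg Hg0.
  assert (HM0 : 0 < INR M) by (apply lt_0_INR; lia).
  assert (Hd0 : 0 < p 0%nat) by (rewrite Hp0; now apply Rinv_0_lt_compat).
  assert (Hd1 : p 0%nat <= 1).
  { rewrite Hp0, <- Rinv_1. apply Rinv_le_contravar; [lra|]. apply (le_INR 1). auto. }
  assert (Hpw : forall r a, 0 <= r <= 1 -> 0 <= r ^ a <= 1).
  { intros r a Hr. induction a; simpl; [lra|]. split; nra. }
  assert (Hz : exists z, IZR z = INR M ^ D * g (upd p 1 0)).
  { rewrite P3. clear - P1 Hp0 HM0. induction P as [|[c e] P IH]; simpl.
    - exists 0%Z. ring.
    - destruct IH as (z & IH); [intros c' e' H'; apply (P1 c'); now right|].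
      assert (He : (mdeg 2 e <= D)%nat) by (apply (P1 c); now left). simpl in He.
      assert (H0 : exists z0, IZR z0 = INR M ^ D * (1 * upd p 1 0 0%nat ^ e 0%nat * upd p 1 0 1%nat ^ e 1%nat)).
      { rewrite upd_same, upd_other, Hp0 by lia. destruct (e 1%nat) as [|a].
        - exists (Z.of_nat (M ^ (D - e 0%nat))). rewrite <- INR_IZR_INZ, pow_INR, pow_inv.
          replace D with ((D - e 0%nat) + e 0%nat)%nat at 2 by lia. rewrite pow_add. simpl. field.
          apply pow_nonzero. lra.
        - exists 0%Z. simpl. ring. }
      destruct H0 as (z0 & Hz0). exists (c * z0 + z)%Z. rewrite plus_IZR, mult_IZR, IH, Hz0. ring. }
  destruct Hz as (z & Hz).
  assert (Hpos : 0 < INR M ^ D) by now apply pow_lt.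
  assert (Hz0 : z <> 0%Z).
  { intros ->. symmetry in Hz. apply Rmult_integral in Hz. destruct Hz; [lra|auto]. }
  assert (Hz1 : 1 <= Rabs (IZR z)) by (rewrite <- abs_IZR; apply (IZR_le 1); lia).
  assert (Hd : Rabs (eval 2 P p - eval 2 P (upd p 1 0)) <= p 1%nat * INR (nrm P)).
  { clear - Hp1 Hd0 Hd1 Hpw. induction P as [|[c e] P IH]; cbn [eval nrm mon].
    - rewrite Rminus_diag, Rabs_R0. simpl. lra.
    - rewrite upd_same, upd_other by lia.
      replace (IZR c * (1 * p 0%nat ^ e 0%nat * p 1%nat ^ e 1%nat) + eval 2 P p - (IZR c * (1 * p 0%nat ^ e
        0%nat * 0 ^ e 1%nat) + eval 2 P (upd p 1 0)))
        with (IZR c * (p 0%nat ^ e 0%nat * (p 1%nat ^ e 1%nat - 0 ^ e 1%nat)) + (eval 2 P p - eval 2 P (upd p 1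
          0))) by ring.
      eapply Rle_trans; [apply Rabs_triang|]. rewrite plus_INR, Rmult_plus_distr_l.
      apply Rplus_le_compat; auto. rewrite Rabs_mult, INR_IZR_INZ, Zabs2Nat.id_abs, abs_IZR, Rmult_comm.
      apply Rmult_le_compat_r; [apply Rabs_pos|].
      destruct (Hpw (p 0%nat) (e 0%nat)) as [A1 A2]; [lra|].
      destruct (e 1%nat) as [|a]; simpl.
      + rewrite Rminus_diag, Rmult_0_r, Rabs_R0. lra.
      + rewrite Rmult_0_l, Rminus_0_r. destruct (Hpw (p 1%nat) a) as [B1 B2]; [lra|].
        rewrite Rabs_right; [|apply Rle_ge; repeat apply Rmult_le_pos; lra].
        apply Rle_trans with (1 * (p 1%nat * 1)); [|lra]. apply Rmult_le_compat; try lra.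
        * apply Rmult_le_pos; lra.
        * apply Rmult_le_compat_l; lra. }
  rewrite <- !P3, Hg, Rminus_0_l, Rabs_Ropp in Hd.
  rewrite Hz, Rabs_mult, (Rabs_right (INR M ^ D)) in Hz1 by lra.
  apply le_INR in P2.
  apply Rle_trans with (INR M ^ D * (p 1%nat * INR h)); [|right; ring].
  eapply Rle_trans; [apply Hz1|]. apply Rmult_le_compat_l; [lra|].
  eapply Rle_trans; [apply Hd|]. apply Rmult_le_compat_l; lra.
Qed.

Definition pt (d e : R) : point := fun i => match i with O => d | 1%nat => e | _ => 0 end.

Section Endgame.
Variables (s B : nat) (T : point -> Prop) (G : point -> R).
Hypothesis HG : cx 2 s G.
Hypothesis HGn : nonzero G.
Hypothesis HT : opn 2 T.
Hypothesis HTG : forall p, bdry 2 T p -> G p = 0.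
Hypothesis Hmono : forall d e d' e', T (pt d e) -> d <= d' -> e' <= e -> T (pt d' e').
Hypothesis HB : (s + 2 <= B)%nat.

Definition del : R := / 2 ^ (2 ^ B).
Definition eps : R := / 2 ^ (2 ^ (2 * B)).

Lemma del_pos : 0 < del.
Proof. apply Rinv_0_lt_compat, pow_lt. lra. Qed.

Lemma eps_pos : 0 < eps.
Proof. apply Rinv_0_lt_compat, pow_lt. lra. Qed.

Lemma pow2_INR a : 2 ^ a = INR (2 ^ a).
Proof. rewrite pow_INR. reflexivity. Qed.

(** Without its power of [e], the polynomial [G] restricts to a nonzero polynomial in [d] on the
    axis [e = 0], whose positive roots are bounded below by the inverse of its norm. *)
Lemma strip_plane : exists g' a, pol 2 (2 ^ s) (2 ^ 2 ^ s) g' /\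
  (forall x, G x = x 1%nat ^ a * g' x) /\
  (forall d, 0 < d -> d * 2 ^ (2 ^ s) < 1 -> g' (pt d 0) <> 0).
Proof.
  destruct (pol_strip 1 _ _ _ HG HGn) as (a & g' & H1 & H2 & H3 & H4).
  exists g', a. split; auto. split; auto. intros d Hd Hd1.
  assert (E : g' (pt d 0) = g' (upd (pt d 0) 1 0)).
  { f_equal. extensionality i. unfold upd. destruct (Nat.eqb i 1) eqn:E; auto.
    apply Nat.eqb_eq in E. now subst. }
  rewrite E. apply (pol1_root (2 ^ 2 ^ s) (fun x => g' (upd x 1 0)) (pt d 0)); eauto.
  simpl. now rewrite <- pow2_INR.
Qed.

(* If no point with small [d] lies in [T], the infimum of the [d]-projection of [T] near [e = 0] is a root
   of [G] with its factor [e ^ a] removed. *)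
Lemma plane_false d0 : 0 < d0 -> (forall d e, d <= d0 -> 0 < e -> ~ T (pt d e)) ->
  forall e, 0 < e -> ~ T (pt (2 * del) e).
Proof.
  intros Hd0 Hno e1 He1 HTe. destruct strip_plane as (g' & a & H1 & H2 & H3).
  pose proof del_pos as Hdel.
  assert (Hinf : exists d1, (forall d e, d < d1 -> 0 < e -> ~ T (pt d e)) /\
     (forall eta, 0 < eta -> exists e, 0 < e /\ T (pt (d1 + eta) e)) /\ d0 <= d1 /\ d1 <= 2 * del).
  { destruct (completeness (fun d => forall e, 0 < e -> ~ T (pt d e))) as (d1 & A1 & A2).
    - exists (2 * del). intros d Hd. apply Rnot_lt_le. intros Hl. apply (Hd e1 He1).
      apply (Hmono (2 * del) e1); lra || auto.
    - exists d0. intros e He. apply Hno; lra.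
    - exists d1. split; [|split; [|split]].
      + intros d e Hd He HTd. assert (d1 <= d); [|lra]. apply A2. intros d2 Hd2.
        apply Rnot_lt_le. intros Hl. apply (Hd2 e He). apply (Hmono d e); lra || auto.
      + intros eta Heta. apply NNPP; intros Hn. assert (d1 + eta <= d1); [|lra]. apply A1.
        intros e He HTd. apply Hn. eauto.
      + apply A1. intros e He. apply Hno; lra.
      + apply A2. intros d Hd. apply Rnot_lt_le. intros Hl. apply (Hd e1 He1).
        apply (Hmono (2 * del) e1); lra || auto. }
  destruct Hinf as (d1 & A1 & A2 & A3 & A4).
  apply (H3 d1); [lra| |].
  - apply Rle_lt_trans with (2 * del * 2 ^ 2 ^ s).
    { apply Rmult_le_compat_r; [apply pow_le; lra|auto]. }
    unfold del. apply Rmult_lt_reg_r with (2 ^ 2 ^ B); [apply pow_lt; lra|].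
    replace (2 * / 2 ^ 2 ^ B * 2 ^ 2 ^ s * 2 ^ 2 ^ B) with (2 ^ (S (2 ^ s))).
    + rewrite Rmult_1_l. apply Rlt_pow; [lra|].
      apply Nat.lt_le_trans with (2 ^ (s + 2))%nat; [|apply Nat.pow_le_mono_r; lia].
      rewrite Nat.pow_add_r. simpl (2 ^ 2)%nat. pose proof (pow2_ge1 s). lia.
    + simpl (2 ^ S _). field. apply pow_nonzero. lra.
  - apply NNPP; intros Hne.
    destruct (pol_cont _ _ _ _ H1 (pt d1 0) (Rabs (g' (pt d1 0)))) as (rho & Hr & Hc); [now apply Rabs_pos_lt|].
    destruct (A2 (rho / 2)) as (e2 & He2 & HT2); [lra|].
    set (e := Rmin e2 (rho / 2)). assert (He : 0 < e) by (apply Rmin_pos; lra).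
    assert (HT3 : T (pt (d1 + rho / 2) e)) by (apply (Hmono (d1 + rho / 2) e2); [auto|lra|apply Rmin_l]).
    (* The horizontal segment at height [e] leads from outside [T] into [T], so [G] has a zero on
       it; since [e > 0] this is a zero of [g'] within [rho] of [(d1, 0)]. *)
    destruct (segment_bdry 2 T (pt (d1 - rho / 2) e) (pt (d1 + rho / 2) e) HT) as (u & Hu & Hbd);
      [apply A1; lra|auto|].
    apply HTG in Hbd.
    assert (Eu : (fun i => pt (d1 - rho / 2) e i + u * (pt (d1 + rho / 2) e i - pt (d1 - rho / 2) e i)) = pt
      (d1 - rho / 2 + u * rho) e).
    { extensionality i. destruct i as [|[|i]]; simpl; try ring. field. }
    rewrite Eu, H2 in Hbd. apply Rmult_integral in Hbd. destruct Hbd as [Hbd|Hbd].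
    { simpl in Hbd. apply (pow_nonzero e a) in Hbd; auto; lra. }
    assert (Hn : near 2 rho (pt d1 0) (pt (d1 - rho / 2 + u * rho) e)).
    { intros i Hi. assert (e <= rho / 2) by apply Rmin_r.
      destruct i as [|[|i]]; [| |lia]; simpl; apply Rabs_def1; nra. }
    specialize (Hc _ Hn). rewrite Hbd, Rminus_0_l, Rabs_Ropp in Hc. lra.
Qed.

(** Otherwise the vertical segment at [d = del] from [eps] down to [e0] meets the boundary of [T] in
    a root of [g']. By [pol2_root] with [M = 2 ^ (2 ^ B)] such a root is at least the inverse of
    [2 ^ (2 ^ s + 2 ^ (B + s))], which exceeds [eps] because [B >= s + 2]. *)
Lemma plane_true : (exists e, 0 < e /\ T (pt del e)) -> T (pt del eps).
Proof.
  intros (e0 & He0 & HTe). apply NNPP; intros Hn.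
  destruct strip_plane as (g' & a & H1 & H2 & H3).
  pose proof eps_pos as Heps. pose proof del_pos as Hdel.
  assert (Hlt : e0 < eps).
  { apply Rnot_le_lt. intros Hl. apply Hn. apply (Hmono del e0); lra || auto. }
  destruct (segment_bdry 2 T (pt del eps) (pt del e0) HT Hn HTe) as (u & Hu & Hbd).
  apply HTG in Hbd.
  assert (Eu : (fun i => pt del eps i + u * (pt del e0 i - pt del eps i)) = pt del (eps + u * (e0 - eps))).
  { extensionality i. destruct i as [|[|i]]; simpl; ring. }
  rewrite Eu, H2 in Hbd. set (e := eps + u * (e0 - eps)) in *.
  assert (He : 0 < e <= eps) by (unfold e; nra).
  assert (Heps1 : eps <= 1).
  { unfold eps. rewrite <- Rinv_1. apply Rinv_le_contravar; [lra|]. apply pow_R1_Rle. lra. }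
  apply Rmult_integral in Hbd. destruct Hbd as [Hbd|Hbd].
  { simpl in Hbd. apply (pow_nonzero e a) in Hbd; auto; lra. }
  assert (Hroot := pol2_root (2 ^ s) (2 ^ 2 ^ s) g' (2 ^ 2 ^ B) (pt del e) H1 (pow2_ge1 _)).
  simpl in Hroot. rewrite <- !pow2_INR in Hroot.
  assert (1 <= e * 2 ^ 2 ^ s * (2 ^ 2 ^ B) ^ 2 ^ s).
  { apply Hroot; auto; [lra|].
    replace (upd (pt del e) 1 0) with (pt del 0).
    - apply H3; auto. unfold del. apply Rmult_lt_reg_l with (2 ^ 2 ^ B); [apply pow_lt; lra|].
      replace (2 ^ 2 ^ B * (/ 2 ^ 2 ^ B * 2 ^ 2 ^ s)) with (2 ^ 2 ^ s) by (field; apply pow_nonzero; lra).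
      rewrite Rmult_1_r. apply Rlt_pow; [lra|]. apply Nat.pow_lt_mono_r; lia.
    - extensionality i. unfold upd. destruct i as [|[|i]]; reflexivity. }
  assert (eps * 2 ^ 2 ^ s * (2 ^ 2 ^ B) ^ 2 ^ s < 1).
  { unfold eps. rewrite <- pow_mult. apply Rmult_lt_reg_l with (2 ^ 2 ^ (2 * B)); [apply pow_lt; lra|].
    replace (2 ^ 2 ^ (2 * B) * (/ 2 ^ 2 ^ (2 * B) * 2 ^ 2 ^ s * 2 ^ (2 ^ B * 2 ^ s)))
      with (2 ^ (2 ^ s + 2 ^ B * 2 ^ s)) by (rewrite pow_add; field; apply pow_nonzero; lra).
    rewrite Rmult_1_r. apply Rlt_pow; [lra|]. rewrite <- Nat.pow_add_r.
    apply Nat.le_lt_trans with (2 * 2 ^ (B + s))%nat.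
    - assert (2 ^ s <= 2 ^ (B + s))%nat by (apply Nat.pow_le_mono_r; lia). lia.
    - rewrite <- Nat.pow_succ_r'. apply Nat.pow_lt_mono_r; lia. }
  assert (e * 2 ^ 2 ^ s * (2 ^ 2 ^ B) ^ 2 ^ s <= eps * 2 ^ 2 ^ s * (2 ^ 2 ^ B) ^ 2 ^ s).
  { apply Rmult_le_compat_r; [apply pow_le, pow_le; lra|]. apply Rmult_le_compat_r; [apply pow_le; lra|lra]. }
  lra.
Qed.

End Endgame.
End Plane.

(** * Relaxed sentences and the set of good thresholds *)

Module Gap.
Import Poly Analysis Elim Proj Plane.

Fixpoint val (X Y : nat -> R) (f : qff_le) : R :=
  match f with
  | FLe s t => teval X Y s - teval X Y t
  | FAnd a b => Rmax (val X Y a) (val X Y b)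
  | FOr a b => Rmin (val X Y a) (val X Y b)
  end.

Lemma feval_val X Y f : feval X Y f <-> val X Y f <= 0.
Proof.
  induction f as [s t|a IHa b IHb|a IHa b IHb]; simpl.
  - split; lra.
  - rewrite IHa, IHb. unfold Rmax. destruct (Rle_dec _ _); split; lra.
  - rewrite IHa, IHb. unfold Rmin. destruct (Rle_dec _ _); split; lra.
Qed.

Lemma teval_local n m X Y X' Y' t : tscoped n m t ->
  (forall i, (i < n)%nat -> X i = X' i) -> (forall j, (j < m)%nat -> Y j = Y' j) ->
  teval X Y t = teval X' Y' t.
Proof.
  intros Hs HX HY. induction t; simpl in *; auto; rewrite IHt1, IHt2; tauto.
Qed.

Lemma val_local n m X Y X' Y' f : scoped n m f ->
  (forall i, (i < n)%nat -> X i = X' i) -> (forall j, (j < m)%nat -> Y j = Y' j) ->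
  val X Y f = val X' Y' f.
Proof.
  intros Hs HX HY. induction f; simpl in *.
  - destruct Hs. rewrite (teval_local n m X Y X' Y' t), (teval_local n m X Y X' Y' t0); auto.
  - rewrite IHf1, IHf2; tauto.
  - rewrite IHf1, IHf2; tauto.
Qed.

(* A point of [R^(2+n+m)] has coordinates [delta, eps, X, Y]. *)
Definition zX (z : point) : nat -> R := shift 2 z.
Definition zY (n : nat) (z : point) : nat -> R := shift (2 + n) z.

Definition mk (n : nat) (d e : R) (X Y : nat -> R) : point :=
  fun i => match i with O => d | S O => e | S (S i') => if Nat.ltb i' n then X i' else Y (i' - n)%nat end.

Lemma zX_mk n d e X Y i : (i < n)%nat -> zX (mk n d e X Y) i = X i.
Proof. intros H. unfold zX, shift. simpl. apply Nat.ltb_lt in H. now rewrite H. Qed.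

Lemma zY_mk n d e X Y j : zY n (mk n d e X Y) j = Y j.
Proof.
  unfold zY, shift. simpl. replace (Nat.ltb (n + j) n) with false by (symmetry; apply Nat.ltb_ge; lia).
  f_equal. lia.
Qed.

Definition zval (n : nat) (f : qff_le) (z : point) : R := val (zX z) (zY n z) f.

Lemma zval_mk n m d e X Y f : scoped n m f -> zval n f (mk n d e X Y) = val X Y f.
Proof.
  intros H. apply (val_local n m); auto; intros; [now apply zX_mk|apply zY_mk].
Qed.

Lemma enc_Z_bound z : (Z.abs_nat z <= 2 ^ length (enc_Z z))%nat.
Proof.
  assert (H : forall p, (Pos.to_nat p <= 2 ^ length (enc_pos p))%nat).
  { induction p; simpl enc_pos; cbn [length app]; rewrite !Nat.pow_succ_r'.
    - rewrite Pos2Nat.inj_xI. assert (1 <= 2 ^ length (enc_pos p))%nat by apply pow2_ge1. lia.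
    - rewrite Pos2Nat.inj_xO. lia.
    - simpl. lia. }
  destruct z as [|p|p]; [simpl; lia| |]; simpl enc_Z; cbn [length]; rewrite !Nat.pow_succ_r';
    specialize (H p); simpl Z.abs_nat; lia.
Qed.

Notation tlen t := (length (enc_term t)).
Notation flen f := (length (enc_fml f)).

Lemma tlen_pos t : (3 <= tlen t)%nat.
Proof. destruct t; simpl; lia. Qed.

(** Encoding lengths add under both operations, just as degrees and logarithms of norms do under
    products; binary constants account for the exponential norm. *)
Lemma teval_pol n m t : tscoped n m t ->
  pol (2 + n + m) (tlen t) (2 ^ tlen t) (fun z => teval (zX z) (zY n z) t).
Proof.
  induction t as [c|i|j|a IHa b IHb|a IHa b IHb]; cbn [tscoped teval]; intros Hs.
  - eapply pol_le; [| |apply (pol_const _ c)]; [lia|].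
    eapply Nat.le_trans; [apply enc_Z_bound|]. apply Nat.pow_le_mono_r; [lia|]. simpl. lia.
  - eapply pol_le; [| |apply (pol_var _ (2 + i))]; [pose proof (tlen_pos (TX i)); lia|apply pow2_ge1|lia].
  - eapply pol_le; [| |apply (pol_var _ (2 + n + j))]; [pose proof (tlen_pos (TY j)); lia|apply pow2_ge1|lia].
  - destruct Hs as [Ha Hb]. cbn [enc_term length app]. rewrite !length_app.
    eapply pol_le; [| |apply (pol_add _ (tlen a + tlen b) (2 ^ tlen a) (2 ^ tlen b))]; [lia| | |].
    + rewrite !Nat.pow_succ_r', Nat.pow_add_r. pose proof (pow2_ge1 (tlen a)). pose proof (pow2_ge1 (tlen b)).
      nia.
    + eapply pol_le; [| |apply IHa; auto]; lia.
    + eapply pol_le; [| |apply IHb; auto]; lia.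
  - destruct Hs as [Ha Hb]. cbn [enc_term length app]. rewrite !length_app.
    eapply pol_le; [| |apply (pol_mul _ (tlen a) (tlen b) (2 ^ tlen a) (2 ^ tlen b))]; [lia| |auto|auto].
    rewrite <- Nat.pow_add_r. apply Nat.pow_le_mono_r; lia.
Qed.

(** [val f] always equals one of the differences [s - t], so this product vanishes wherever [val f]
    equals coordinate [o]. No factor is identically zero, as coordinate [o] occurs in it with
    coefficient -1. *)
Fixpoint atoms (n o : nat) (f : qff_le) (z : point) : R :=
  match f with
  | FLe s t => teval (zX z) (zY n z) s - teval (zX z) (zY n z) t - z o
  | FAnd a b => atoms n o a z * atoms n o b z
  | FOr a b => atoms n o a z * atoms n o b z
  end.

Lemma atoms_pol n m o f : scoped n m f -> (o < 2)%nat ->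
  pol (2 + n + m) (flen f) (2 ^ flen f) (atoms n o f) /\ nonzero (atoms n o f).
Proof.
  intros Hs Ho. induction f as [s t|a IHa b IHb|a IHa b IHb]; cbn [scoped atoms] in *.
  - destruct Hs as [Hs Ht]. pose proof (tlen_pos s). pose proof (tlen_pos t). split.
    + cbn [enc_fml length app]. rewrite !length_app.
      eapply pol_le; [| |apply (pol_sub _ (tlen s + tlen t) (2 ^ tlen s + 2 ^ tlen t) 1)]; [lia| | |].
      * rewrite !Nat.pow_succ_r', Nat.pow_add_r. pose proof (pow2_ge1 (tlen s)).
        pose proof (pow2_ge1 (tlen t)). nia.
      * apply pol_sub; eapply pol_le; [| |apply teval_pol; auto| | |apply teval_pol; auto]; lia.
      * eapply pol_le; [| |apply pol_var]; lia.
    + set (c := teval (fun _ => 0) (fun _ => 0) s - teval (fun _ => 0) (fun _ => 0) t).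
      exists (upd (fun _ => 0) o (c - 1)).
      assert (E : forall u, teval (zX (upd (fun _ => 0) o (c - 1))) (zY n (upd (fun _ => 0) o (c - 1))) u =
        teval (fun _ => 0) (fun _ => 0) u).
      { intros u. f_equal; extensionality i; unfold zX, zY, shift; apply upd_other; lia. }
      rewrite !E, upd_same. fold c. lra.
  - destruct Hs as [Ha Hb]. destruct IHa as [A1 A2], IHb as [B1 B2]; auto. split.
    + cbn [enc_fml length app]. rewrite !length_app.
      eapply pol_le; [| |apply (pol_mul _ _ _ _ _ _ _ A1 B1)]; [lia|].
      rewrite <- Nat.pow_add_r. apply Nat.pow_le_mono_r; lia.
    + eapply nonzero_mul; eauto.
  - destruct Hs as [Ha Hb]. destruct IHa as [A1 A2], IHb as [B1 B2]; auto. split.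
    + cbn [enc_fml length app]. rewrite !length_app.
      eapply pol_le; [| |apply (pol_mul _ _ _ _ _ _ _ A1 B1)]; [lia|].
      rewrite <- Nat.pow_add_r. apply Nat.pow_le_mono_r; lia.
    + eapply nonzero_mul; eauto.
Qed.

Lemma atoms_zero n o f z : zval n f z = z o -> atoms n o f z = 0.
Proof.
  unfold zval. induction f as [s t|a IHa b IHb|a IHa b IHb]; simpl; intros H.
  - lra.
  - unfold Rmax in H. destruct (Rle_dec _ _); [rewrite IHb|rewrite IHa]; auto; ring.
  - unfold Rmin in H. destruct (Rle_dec _ _); [rewrite IHa|rewrite IHb]; auto; ring.
Qed.

Lemma zval_cont n m f : scoped n m f -> cont (2 + n + m) (zval n f).
Proof.
  unfold zval. induction f; simpl; intros [H1 H2].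
  - apply cont_sub; eapply pol_cont; apply teval_pol; auto.
  - apply cont_max; auto.
  - apply cont_min; auto.
Qed.

Fixpoint boxp (q k : nat) (z : point) : R :=
  match k with O => 1 | S k' => boxp q k' z * (1 - z (q + k')%nat * z (q + k')%nat) end.

Lemma boxp_pol q k V : (q + k <= V)%nat -> pol V (2 * k) (2 ^ k) (boxp q k) /\ nonzero (boxp q k).
Proof.
  induction k as [|k IH]; intros HV; cbn [boxp].
  - split; [eapply pol_le; [| |apply (pol_const _ 1)]; simpl; lia|]. exists (fun _ => 0). lra.
  - destruct IH as [H1 H2]; [lia|].
    assert (Hp : pol V 2 2 (fun z => 1 - z (q + k)%nat * z (q + k)%nat)).
    { apply (pol_sub _ 2 1 1 (fun _ => IZR 1)).
      - eapply pol_le; [| |apply (pol_const _ 1)]; simpl; lia.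
      - apply (pol_mul _ 1 1 1 1); apply pol_var; lia. }
    split.
    + eapply pol_le; [| |apply (pol_mul _ _ _ _ _ _ _ H1 Hp)]; simpl; lia.
    + apply (nonzero_mul _ _ _ _ _ _ _ H1 Hp H2). exists (fun _ => 0). lra.
Qed.

Lemma boxp_zero q k z : (exists i, (i < k)%nat /\ Rabs (z (q + i)%nat) = 1) -> boxp q k z = 0.
Proof.
  induction k as [|k IH]; intros (i & Hi & H); simpl; [lia|]. destruct (Nat.eq_dec i k) as [->|].
  - assert (E : z (q + k)%nat * z (q + k)%nat = 1).
    { transitivity (Rabs (z (q + k)%nat) * Rabs (z (q + k)%nat)); [|rewrite H; ring].
      rewrite <- Rabs_mult. symmetry. apply Rabs_right. nra. }
    rewrite E. ring.
  - rewrite IH; [ring|]. exists i. split; auto. lia.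
Qed.

Definition inbox (q k : nat) (z : point) : Prop := forall i, (i < k)%nat -> Rabs (z (q + i)%nat) < 1.

Lemma opn_and V (A B : point -> Prop) : opn V A -> opn V B -> opn V (fun z => A z /\ B z).
Proof.
  intros HA HB z [Ha Hb]. destruct (HA z Ha) as (r1 & P1 & Q1). destruct (HB z Hb) as (r2 & P2 & Q2).
  exists (Rmin r1 r2). split; [now apply Rmin_pos|]. intros z' Hz.
  split; [apply Q1|apply Q2]; (eapply near_le; [apply le_n| |apply Hz]); [apply Rmin_l|apply Rmin_r].
Qed.

Lemma opn_lt V f g : cont V f -> cont V g -> opn V (fun z => f z < g z).
Proof.
  intros Hf Hg z Hz. destruct (cont_sub V g f Hg Hf z (g z - f z)) as (r & Hr & Hc); [lra|].
  exists r. split; auto. intros z' Hz'. specialize (Hc z' Hz'). apply Rabs_def2 in Hc. lra.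
Qed.

Lemma opn_inbox q k V : (q + k <= V)%nat -> opn V (inbox q k).
Proof.
  induction k as [|k IH]; intros HV.
  - intros z _. exists 1. split; [lra|]. intros z' _ i Hi. lia.
  - assert (H : opn V (fun z => inbox q k z /\ Rabs (z (q + k)%nat) < 1)).
    { apply opn_and; [apply IH; lia|]. apply opn_lt; [|apply cont_const]. apply cont_abs, cont_var. lia. }
    intros z Hz. destruct (H z) as (r & Hr & Hw).
    + split; [intros i Hi; apply Hz; lia|apply Hz; lia].
    + exists r. split; auto. intros z' Hz' i Hi. destruct (Hw z' Hz') as [A B].
      destruct (Nat.eq_dec i k) as [->|]; auto. apply A. lia.
Qed.

Lemma cls_le V (W : point -> Prop) f g z : cont V f -> cont V g -> (forall z', W z' -> f z' <= g z') ->
  cls V W z -> f z <= g z.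
Proof.
  intros Hf Hg HW Hc. apply Rnot_lt_le. intros Hl.
  destruct (opn_lt V g f Hg Hf z Hl) as (r & Hr & Hn). destruct (Hc r Hr) as (z' & Hz' & HWz).
  specialize (HW z' HWz). specialize (Hn z' Hz'). lra.
Qed.

Lemma proj_opn q k W : opn (q + k) W -> opn q (proj q W).
Proof.
  intros HW p (x & Hx & HWx). destruct (HW x HWx) as (r & Hr & Hn). exists r. split; auto.
  intros p' Hp'. exists (fun i => if Nat.ltb i q then p' i else x i). split.
  - intros i Hi. apply Nat.ltb_lt in Hi. now rewrite Hi.
  - apply Hn. intros i Hi. destruct (Nat.ltb i q) eqn:E.
    + apply Nat.ltb_lt in E. rewrite (Hx i E). auto.
    + now rewrite Rminus_diag, Rabs_R0.
Qed.

Section Sentence.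
Variables (n m : nat) (Psi Phi : qff_le).
Hypothesis HPsi : scoped n m Psi.
Hypothesis HPhi : scoped n m Phi.

Let L := (n + m + flen Psi + flen Phi)%nat.

Definition relaxed (d e : R) : Prop :=
  exists X, boxed n X 1 /\ forall Y, boxed m Y 1 -> e <= val X Y Psi \/ val X Y Phi <= d.

Definition viol (z : point) : Prop :=
  inbox (2 + n) m z /\ zval n Psi z < z 1%nat /\ z 0%nat < zval n Phi z.

(** The complement of the closure rather than of the projection itself, so that the set is open and
    can be projected once more. The loss against [relaxed] is made up by moving [d] up and [e]
    down. *)
Definition good (z : point) : Prop := inbox 2 n z /\ ~ cls (2 + n) (proj (2 + n) viol) z.

Lemma viol_opn : opn (2 + n + m) viol.
Proof.
  apply opn_and; [apply opn_inbox; lia|].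
  apply opn_and; apply opn_lt; try (eapply zval_cont; eassumption); apply cont_var; lia.
Qed.

(** On the closure all defining inequalities hold weakly; off [viol] one of them is an equality, and
    each equality kills one factor. *)
Lemma viol_bdry z : bdry (2 + n + m) viol z ->
  boxp (2 + n) m z * atoms n 1 Psi z * atoms n 0 Phi z = 0.
Proof.
  intros (Hc & Hn).
  assert (H1 : zval n Psi z <= z 1%nat).
  { apply (cls_le (2 + n + m) viol _ (fun z => z 1%nat)); auto.
    - eapply zval_cont; eassumption.
    - apply cont_var; lia.
    - intros z' (_ & H & _). lra. }
  assert (H2 : z 0%nat <= zval n Phi z).
  { apply (cls_le (2 + n + m) viol (fun z => z 0%nat)); auto.
    - apply cont_var; lia.
    - eapply zval_cont; eassumption.
    - intros z' (_ & _ & H). lra. }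
  assert (H3 : forall i, (i < m)%nat -> Rabs (z (2 + n + i)%nat) <= 1).
  { intros i Hi. apply (cls_le (2 + n + m) viol (fun z => Rabs (z (2 + n + i)%nat)) (fun _ => 1)); auto.
    - apply cont_abs, cont_var; lia.
    - apply cont_const.
    - intros z' (H & _ & _). left. apply H. auto. }
  destruct (Rle_lt_or_eq_dec _ _ H1) as [L1|E1]; [|rewrite (atoms_zero n 1 Psi); [ring|auto]].
  destruct (Rle_lt_or_eq_dec _ _ H2) as [L2|E2]; [|rewrite (atoms_zero n 0 Phi); [ring|auto]].
  rewrite boxp_zero; [ring|]. apply NNPP; intros Hne. apply Hn. split; [|split; auto].
  intros i Hi. destruct (Rle_lt_or_eq_dec _ _ (H3 i Hi)) as [|E]; auto. exfalso. apply Hne. eauto.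
Qed.

Lemma good_opn : opn (2 + n) good.
Proof.
  apply opn_and; [apply opn_inbox; lia|]. intros z Hz.
  destruct (opn_cls_sep _ _ _ Hz) as (r & Hr & Hn). exists (r / 2). split; [lra|].
  intros z' Hz' Hc. destruct (Hc (r / 2)) as (z2 & Hz2 & Hp); [lra|].
  apply (Hn z2); auto. apply (near_le (2 + n) (2 + n) (r / 2 + r / 2)); [lia|lra|].
  eapply near_trans; eauto.
Qed.

(** Inside the open box, a boundary point of [good] is in the closure of the projected violations
    but not among them, because the projection is open and would swallow nearby good points; so it
    is a boundary point of that projection. *)
Lemma good_bdry P1 z : (forall p, bdry (2 + n) (proj (2 + n) viol) p -> P1 p = 0) ->
  bdry (2 + n) good z -> P1 z * boxp 2 n z = 0.
Proof.
  intros HP (Hc & Hn).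
  assert (H3 : forall i, (i < n)%nat -> Rabs (z (2 + i)%nat) <= 1).
  { intros i Hi. apply (cls_le (2 + n) good (fun z => Rabs (z (2 + i)%nat)) (fun _ => 1)); auto.
    - apply cont_abs, cont_var; lia.
    - apply cont_const.
    - intros z' (H & _). left. apply H. auto. }
  destruct (classic (inbox 2 n z)) as [Hb|Hb].
  - rewrite HP; [ring|]. split.
    + apply NNPP; intros Hc'. apply Hn. split; auto.
    + intros Hv. destruct (proj_opn _ _ _ viol_opn z Hv) as (r & Hr & Hw).
      destruct (Hc r Hr) as (z' & Hz' & _ & Hz2). apply Hz2. intros rho Hrho. exists z'. split; auto.
      now apply near_refl.
  - rewrite (boxp_zero 2 n); [ring|]. apply NNPP; intros Hne. apply Hb.
    intros i Hi. destruct (Rle_lt_or_eq_dec _ _ (H3 i Hi)) as [|E]; auto. exfalso. apply Hne. eauto.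
Qed.

(** An upper bound for two projections starting from level [L + 1]:
    [((L + 5) * (m + 2) + 6) * (n + 2)], the 6 including 2 for the factor [boxp] in between. *)
Definition level : nat := ((L + 5) * (L + 5) * (L + 5))%nat.

Lemma plane_poly : exists G, cx 2 level G /\ nonzero G /\ forall p, bdry 2 (proj 2 good) p -> G p = 0.
Proof.
  destruct (boxp_pol (2 + n) m (2 + n + m) (le_n _)) as [B1 B2].
  destruct (atoms_pol n m 1 Psi HPsi ltac:(lia)) as [C1 C2].
  destruct (atoms_pol n m 0 Phi HPhi ltac:(lia)) as [D1 D2].
  set (Q := fun z => boxp (2 + n) m z * atoms n 1 Psi z * atoms n 0 Phi z).
  assert (HLL : (L < 2 ^ L)%nat) by apply lt_pow2.
  assert (HQ : cx (2 + n + m) (L + 1) Q).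
  { eapply pol_le; [| |apply (pol_mul _ _ _ _ _ _ _ (pol_mul _ _ _ _ _ _ _ B1 C1) D1)].
    - rewrite Nat.add_1_r, Nat.pow_succ_r'. unfold L in *. lia.
    - rewrite <- !Nat.pow_add_r. apply Nat.pow_le_mono_r; [lia|].
      apply Nat.le_trans with L; [unfold L; lia|]. rewrite Nat.add_1_r, Nat.pow_succ_r'. lia. }
  assert (HQn : nonzero Q).
  { eapply nonzero_mul; [apply (pol_mul _ _ _ _ _ _ _ B1 C1)|apply D1| |auto]. eapply nonzero_mul; eauto. }
  destruct (proj_boundary (2 + n) m (L + 1) viol Q HQ HQn viol_opn) as (P1 & E1 & E2 & E3).
  { intros x (Hb & _) i Hi. left. replace i with (2 + n + (i - (2 + n)))%nat by lia. apply Hb. lia. }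
  { apply viol_bdry. }
  set (s1 := ((L + 1 + 4) * (m + 2))%nat) in *.
  destruct (boxp_pol 2 n (2 + n) (le_n _)) as [F1 F2].
  set (Q2 := fun z => P1 z * boxp 2 n z).
  assert (Hs1 : (n <= s1)%nat) by (unfold s1, L; nia).
  assert (Hs2 : (s1 < 2 ^ s1)%nat) by apply lt_pow2.
  assert (HQ2 : cx (2 + n) (s1 + 2) Q2).
  { eapply pol_le; [| |apply (pol_mul _ _ _ _ _ _ _ E1 F1)].
    - replace (s1 + 2)%nat with (S (S s1)) by lia. rewrite !Nat.pow_succ_r'. lia.
    - rewrite <- !Nat.pow_add_r. apply Nat.pow_le_mono_r; [lia|].
      replace (s1 + 2)%nat with (S (S s1)) by lia. rewrite !Nat.pow_succ_r'. lia. }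
  assert (HQ2n : nonzero Q2) by (eapply nonzero_mul; eauto).
  destruct (proj_boundary 2 n (s1 + 2) good Q2 HQ2 HQ2n good_opn) as (G & G1 & G2 & G3).
  { intros x (Hb & _) i Hi. left. replace i with (2 + (i - 2))%nat by lia. apply Hb. lia. }
  { intros x Hx. now apply good_bdry. }
  exists G. split; auto. eapply cx_le; [|apply G1]. unfold level, s1.
  assert (Hn : (n + 2 <= L + 2)%nat) by (unfold L; lia). assert (Hm : (m + 2 <= L + 2)%nat) by (unfold L; lia).
  apply Nat.le_trans with (((L + 1 + 4) * (L + 2) + 2 + 4) * (L + 2))%nat.
  - apply Nat.mul_le_mono; auto. apply Nat.add_le_mono_r, Nat.add_le_mono_r, Nat.mul_le_mono_l. auto.
  - nia.
Qed.

Lemma viol_mk d e X Y : viol (mk n d e X Y) <->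
  ((forall j, (j < m)%nat -> Rabs (Y j) < 1) /\ val X Y Psi < e /\ d < val X Y Phi).
Proof.
  unfold viol. rewrite !(zval_mk n m) by auto. change (mk n d e X Y 0%nat) with d.
  change (mk n d e X Y 1%nat) with e.
  assert (E : inbox (2 + n) m (mk n d e X Y) <-> forall j, (j < m)%nat -> Rabs (Y j) < 1).
  { split; intros H j Hj; specialize (H j Hj); fold (shift (2 + n) (mk n d e X Y) j) in *;
    fold (zY n (mk n d e X Y)) in *; rewrite zY_mk in *; auto. }
  rewrite E. tauto.
Qed.

Lemma viol_ext z z' : agree (2 + n + m) z z' -> viol z -> viol z'.
Proof.
  intros H Hv. destruct (viol_opn z Hv) as (r & Hr & Hw). apply Hw. apply near_eq; auto.
Qed.

Lemma mk_eta z : z = mk n (z 0%nat) (z 1%nat) (zX z) (zY n z).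
Proof.
  extensionality i. destruct i as [|[|i]]; simpl; auto. unfold zX, zY, shift. simpl.
  destruct (Nat.ltb i n) eqn:E; auto. apply Nat.ltb_ge in E. do 3 f_equal. lia.
Qed.

Lemma mk_eta_at z i : z i = mk n (z 0%nat) (z 1%nat) (zX z) (zY n z) i.
Proof. exact (f_equal (fun f => f i) (mk_eta z)). Qed.

Lemma proj_viol_mk d e X : proj (2 + n) viol (mk n d e X (fun _ => 0)) <->
  exists Y, (forall j, (j < m)%nat -> Rabs (Y j) < 1) /\ val X Y Psi < e /\ d < val X Y Phi.
Proof.
  split.
  - intros (z & Hz & Hv). exists (zY n z). apply (viol_mk d e X). apply (viol_ext z); auto.
    intros i Hi. rewrite (mk_eta_at z i). destruct i as [|[|i]].
    + apply (Hz O). lia.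
    + apply (Hz 1%nat). lia.
    + simpl. destruct (Nat.ltb i n) eqn:E; auto. apply Nat.ltb_lt in E. unfold zX, shift. simpl.
      rewrite (Hz (S (S i))) by lia. simpl. replace (Nat.ltb i n) with true; auto.
      symmetry; now apply Nat.ltb_lt.
  - intros (Y & HY). exists (mk n d e X Y). split; [|now apply viol_mk].
    intros i Hi. destruct i as [|[|i]]; simpl; auto. replace (Nat.ltb i n) with true; auto.
    symmetry; apply Nat.ltb_lt. lia.
Qed.

Lemma proj_viol_mono z a b : 0 <= a -> 0 <= b -> proj (2 + n) viol z ->
  proj (2 + n) viol (upd (upd z 0 (z 0%nat - a)) 1 (z 1%nat + b)).
Proof.
  intros Ha Hb (x & Hx & Hv). exists (upd (upd x 0 (x 0%nat - a)) 1 (x 1%nat + b)). split.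
  - intros i Hi. unfold upd. destruct i as [|[|i]]; simpl.
    + rewrite (Hx O); auto; lia.
    + rewrite (Hx 1%nat); auto; lia.
    + apply Hx; auto.
  - rewrite (mk_eta x) in Hv. apply (proj1 (viol_mk _ _ _ _)) in Hv.
    rewrite (mk_eta (upd _ _ _)). apply (proj2 (viol_mk _ _ _ _)).
    destruct Hv as (A & B & C). unfold upd at 1 2. simpl (Nat.eqb _ _). cbn iota.
    change (zX (upd (upd x 0 (x 0%nat - a)) 1 (x 1%nat + b))) with (zX x).
    change (zY n (upd (upd x 0 (x 0%nat - a)) 1 (x 1%nat + b))) with (zY n x).
    split; auto. unfold upd. simpl. split; lra.
Qed.

(** Lowering [d] and raising [e] preserves violations, so a violated point near the new pair
    translates to one equally near the old pair. *)
Lemma good_mono d e d' e' : proj 2 good (pt d e) -> d <= d' -> e' <= e -> proj 2 good (pt d' e').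
Proof.
  intros (z & Hz & Hb & Hc) Hd He.
  assert (E0 : z 0%nat = d) by (apply (Hz O); lia).
  assert (E1 : z 1%nat = e) by (apply (Hz 1%nat); lia).
  exists (upd (upd z 0 d') 1 e'). split; [|split].
  - intros i Hi. destruct i as [|[|i]]; [reflexivity|reflexivity|lia].
  - intros i Hi. unfold upd. simpl. apply Hb. auto.
  - intros Hc'. apply Hc. intros rho Hr. destruct (Hc' rho Hr) as (z1 & Hn1 & Hp1).
    eexists. split; [|apply (proj_viol_mono z1 (d' - d) (e - e')); [lra|lra|apply Hp1]].
    intros i Hi. specialize (Hn1 i Hi). unfold upd in *. destruct i as [|[|i]]; simpl in *; auto.
    + rewrite E0. replace (z1 0%nat - (d' - d) - d) with (z1 0%nat - d') by ring. auto.
    + rewrite E1. replace (z1 1%nat + (e - e') - e) with (z1 1%nat - e') by ring. auto.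
Qed.

Lemma boxed_abs k (X : nat -> R) : boxed k X 1 <-> forall i, (i < k)%nat -> Rabs (X i) <= 1.
Proof.
  split; intros H i Hi; specialize (H i Hi).
  - apply Rabs_le. lra.
  - unfold Rabs in H. destruct (Rcase_abs (X i)); lra.
Qed.

Lemma shrink k (X : nat -> R) rho : boxed k X 1 -> 0 < rho ->
  exists X', (forall i, (i < k)%nat -> Rabs (X' i) < 1) /\ near k rho X X'.
Proof.
  intros HX Hr. rewrite boxed_abs in HX. set (c := Rmin (rho / 2) (1 / 2)).
  assert (Hc : 0 < c) by (apply Rmin_pos; lra).
  assert (Hc1 : c <= rho / 2) by apply Rmin_l. assert (Hc2 : c <= 1 / 2) by apply Rmin_r.
  exists (fun i => (1 - c) * X i). split; intros i Hi; specialize (HX i Hi); pose proof (Rabs_pos (X i)).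
  - rewrite Rabs_mult, (Rabs_right (1 - c)) by lra. nra.
  - replace ((1 - c) * X i - X i) with (- (c * X i)) by ring.
    rewrite Rabs_Ropp, Rabs_mult, (Rabs_right c) by lra. nra.
Qed.

Lemma near_mk d e X X' Y Y' rho : 0 < rho -> near n rho X X' -> near m rho Y Y' ->
  near (2 + n + m) rho (mk n d e X Y) (mk n d e X' Y').
Proof.
  intros Hr HX HY i Hi. destruct i as [|[|i]]; simpl; try (rewrite Rminus_diag, Rabs_R0; auto).
  destruct (Nat.ltb i n) eqn:E.
  - apply Nat.ltb_lt in E. now apply HX.
  - apply Nat.ltb_ge in E. apply HY. lia.
Qed.

(** A strict violation at [Y] in the closed box persists at a slightly shrunk [Y], which puts the
    point into the projection of [viol]. *)
Lemma good_relaxed d e : proj 2 good (pt d e) -> relaxed d e.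
Proof.
  intros (z & Hz & Hb & Hc).
  assert (E0 : z 0%nat = d) by (apply (Hz O); lia).
  assert (E1 : z 1%nat = e) by (apply (Hz 1%nat); lia).
  exists (zX z). split.
  { apply boxed_abs. intros i Hi. left. apply Hb; auto. }
  intros Y HY. apply NNPP; intros Hn. apply not_or_and in Hn. destruct Hn as [N1 N2].
  apply Hc. intros rho Hr.
  exists (mk n d e (zX z) (fun _ => 0)). split.
  - apply near_eq; auto. intros i Hi. rewrite (mk_eta_at z i). rewrite E0, E1.
    destruct i as [|[|i]]; simpl; auto. replace (Nat.ltb i n) with true; auto.
    symmetry; apply Nat.ltb_lt; lia.
  - apply proj_viol_mk.
    assert (Ho : opn (2 + n + m) (fun z => zval n Psi z < z 1%nat /\ z 0%nat < zval n Phi z)).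
    { apply opn_and; apply opn_lt; try (eapply zval_cont; eassumption); apply cont_var; lia. }
    destruct (Ho (mk n d e (zX z) Y)) as (r & Hr0 & Hw).
    + rewrite !(zval_mk n m) by auto. simpl. split; lra.
    + destruct (shrink m Y r HY Hr0) as (Y' & A & B). exists Y'. split; auto.
      assert (C := Hw (mk n d e (zX z) Y') (near_mk d e _ _ _ _ r Hr0 (near_refl n r _ Hr0) B)).
      rewrite !(zval_mk n m) in C by auto. simpl in C. lra.
Qed.

(** Uniformity in [Y] comes from compactness of the box: counterexamples with radius tending to 0
    would cluster at some [Y], against continuity of [val] at [(X, Y)]. *)
Lemma val_uniform X f eta : scoped n m f -> boxed n X 1 -> 0 < eta ->
  exists rho, 0 < rho /\ forall X' Y, near n rho X X' -> boxed m Y 1 ->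
    Rabs (val X' Y f - val X Y f) < eta.
Proof.
  intros Hs HX Heta. apply NNPP; intros Hn.
  assert (H : forall j, exists w : (nat -> R) * (nat -> R), near n (/ (INR j + 1)) X (fst w) /\ boxed m (snd w)
    1 /\
    eta <= Rabs (val (fst w) (snd w) f - val X (snd w) f)).
  { intros j. apply NNPP; intros Hj. apply Hn. exists (/ (INR j + 1)).
    split; [apply inv_succ_pos|]. intros X' Y HX' HY.
    apply Rnot_le_lt. intros Hl. apply Hj. exists (X', Y). auto. }
  apply functional_choice in H. destruct H as (s & Hs').
  destruct (bounded_cluster m (fun j => snd (s j)) 1) as (Y & HY).
  { intros j. apply (proj1 (boxed_abs m _)), Hs'. }
  destruct (zval_cont n m f Hs (mk n 0 0 X Y) (eta / 2)) as (rho & Hr & Hc); [lra|].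
  destruct (archimed_cor1 rho Hr) as (J & HJ & HJ0).
  destruct (HY rho J Hr) as (j & Hj & Hnear). destruct (Hs' j) as (A & B & C).
  assert (Hj2 : near n rho X (fst (s j))).
  { eapply near_le; [apply le_n| |apply A]. apply Rlt_le. eapply Rle_lt_trans; [|apply HJ].
    apply inv_succ_le; auto. }
  assert (D1 := Hc _ (near_mk 0 0 _ _ _ _ rho Hr Hj2 Hnear)).
  assert (D2 := Hc _ (near_mk 0 0 _ _ _ _ rho Hr (near_refl n rho X Hr) Hnear)).
  rewrite !(zval_mk n m) in D1, D2 by auto. apply Rabs_def2 in D1, D2.
  assert (Rabs (val (fst (s j)) (snd (s j)) f - val X (snd (s j)) f) < eta); [|lra].
  apply Rabs_def1; lra.
Qed.

(** The slack in both thresholds pays for moving [X] into the open box and for freeing a whole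
    neighbourhood of the new point from violations, as membership in [good] demands. *)
Lemma relaxed_good d e d' e' : relaxed d e -> d < d' -> e' < e -> proj 2 good (pt d' e').
Proof.
  intros (X & HX & HXY) Hd He.
  set (eta := Rmin ((d' - d) / 2) ((e - e') / 2)). assert (Heta : 0 < eta) by (apply Rmin_pos; lra).
  assert (He1 : eta <= (d' - d) / 2) by apply Rmin_l. assert (He2 : eta <= (e - e') / 2) by apply Rmin_r.
  destruct (val_uniform X Psi eta HPsi HX Heta) as (r1 & R1 & U1).
  destruct (val_uniform X Phi eta HPhi HX Heta) as (r2 & R2 & U2).
  (* [X] moves twice by [rho], to [X'] and on to the nearby [zX z], whence the halved radius. *)
  set (rho := Rmin (Rmin r1 r2 / 2) eta).
  assert (Hr : 0 < rho) by (assert (0 < Rmin r1 r2) by (now apply Rmin_pos); apply Rmin_pos; lra).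
  assert (Hr1 : rho <= Rmin r1 r2 / 2) by apply Rmin_l. assert (Hr2 : rho <= eta) by apply Rmin_r.
  pose proof (Rmin_l r1 r2). pose proof (Rmin_r r1 r2).
  destruct (shrink n X rho HX Hr) as (X' & A & B).
  exists (mk n d' e' X' (fun _ => 0)). split; [|split].
  - intros i Hi. destruct i as [|[|i]]; [reflexivity|reflexivity|lia].
  - intros i Hi. fold (shift 2 (mk n d' e' X' (fun _ => 0)) i). fold (zX (mk n d' e' X' (fun _ => 0))).
    rewrite zX_mk; auto.
  - intros Hc. destruct (Hc rho Hr) as (z & Hz & Hp).
    assert (Hp' : proj (2 + n) viol (mk n (z 0%nat) (z 1%nat) (zX z) (fun _ => 0))).
    { destruct Hp as (x & Hx & Hv). exists x. split; auto. intros i Hi. rewrite Hx by auto.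
      rewrite (mk_eta_at z i). destruct i as [|[|i]]; simpl; auto. replace (Nat.ltb i n) with true; auto.
      symmetry; apply Nat.ltb_lt; lia. }
    apply proj_viol_mk in Hp'. destruct Hp' as (Y & HY & V1 & V2).
    assert (HYb : boxed m Y 1) by (apply boxed_abs; intros; left; auto).
    assert (HzX : near n (rho + rho) X (zX z)).
    { apply (near_trans n rho rho X X' (zX z) B). intros i Hi. specialize (Hz (2 + i)%nat ltac:(lia)).
      change (mk n d' e' X' (fun _ => 0) (2 + i)%nat) with (zX (mk n d' e' X' (fun _ => 0)) i) in Hz.
      rewrite zX_mk in Hz; auto. }
    assert (W1 := U1 (zX z) Y (near_le n n (rho + rho) r1 _ _ (le_n _) ltac:(lra) HzX) HYb).
    assert (W2 := U2 (zX z) Y (near_le n n (rho + rho) r2 _ _ (le_n _) ltac:(lra) HzX) HYb).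
    apply Rabs_def2 in W1, W2.
    assert (Z0 := Hz O ltac:(lia)). assert (Z1 := Hz 1%nat ltac:(lia)). simpl in Z0, Z1.
    apply Rabs_def2 in Z0, Z1. destruct (HXY Y HYb); lra.
Qed.

Definition trunc (k : nat) (X : nat -> R) : nat -> R := fun i => if Nat.ltb i k then X i else 0.

Lemma trunc_lt k X i : (i < k)%nat -> trunc k X i = X i.
Proof. intros H. unfold trunc. apply Nat.ltb_lt in H. now rewrite H. Qed.

Lemma trunc_in_Ik k X : boxed k X 1 -> in_Ik k (trunc k X).
Proof.
  intros H. split.
  - intros i Hi. rewrite trunc_lt by auto. now apply H.
  - intros i Hi. unfold trunc. apply Nat.ltb_ge in Hi. now rewrite Hi.
Qed.

(** If no [e] worked for a solution [X], counterexamples for [e] tending to 0 would cluster at some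
    [Y] with [val X Y Psi <= 0] and [val X Y Phi >= d > 0]. *)
Lemma input_relaxed d : input_true n m Psi Phi -> 0 < d -> exists e, 0 < e /\ relaxed d e.
Proof.
  intros (X & HX) Hd.
  assert (HXb : boxed n X 1).
  { destruct (HX (fun _ => 0)) as [H|[H _]]; auto. exfalso. apply H. intros i Hi. lra. }
  apply NNPP; intros Hn.
  assert (H : forall j, exists Y, boxed m Y 1 /\ val X Y Psi < / (INR j + 1) /\ d < val X Y Phi).
  { intros j. apply NNPP; intros Hj. apply Hn. exists (/ (INR j + 1)).
    split; [apply inv_succ_pos|]. exists X. split; auto.
    intros Y HY. apply NNPP; intros Ho. apply not_or_and in Ho. apply Hj. exists Y.
    split; auto. lra. }
  apply functional_choice in H. destruct H as (s & Hs).
  destruct (bounded_cluster m s 1) as (Y & HY); [intros j; apply (proj1 (boxed_abs _ _)), Hs|].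
  assert (HYb : boxed m Y 1).
  { apply boxed_abs. intros i Hi. apply Rnot_lt_le. intros Hl.
    destruct (HY (Rabs (Y i) - 1) O) as (j & _ & Hj); [lra|]. specialize (Hj i Hi).
    destruct (Hs j) as (A & _). apply (proj1 (boxed_abs m (s j))) with (i := i) in A; auto.
    assert (Rabs (Y i) <= Rabs (s j i) + Rabs (s j i - Y i)).
    { rewrite (Rabs_minus_sym (s j i)). replace (Y i) with (s j i + (Y i - s j i)) at 1 by ring.
    apply Rabs_triang. }
    lra. }
  assert (Hlim : val X Y Psi <= 0 /\ d <= val X Y Phi).
  { split; apply Rnot_lt_le; intros Hl.
    - destruct (zval_cont n m Psi HPsi (mk n 0 0 X Y) (val X Y Psi / 2)) as (r & Hr & Hc); [lra|].
      destruct (archimed_cor1 (val X Y Psi / 2)) as (J & HJ & HJ0); [lra|].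
      destruct (HY r J Hr) as (j & Hj & Hnear).
      specialize (Hc _ (near_mk 0 0 _ _ _ _ r Hr (near_refl n r X Hr) Hnear)).
      rewrite !(zval_mk n m) in Hc by auto. apply Rabs_def2 in Hc. destruct (Hs j) as (_ & A & _).
      assert (/ (INR j + 1) <= / INR J).
      { apply inv_succ_le; auto. }
      lra.
    - destruct (zval_cont n m Phi HPhi (mk n 0 0 X Y) (d - val X Y Phi)) as (r & Hr & Hc); [lra|].
      destruct (HY r O Hr) as (j & _ & Hnear).
      specialize (Hc _ (near_mk 0 0 _ _ _ _ r Hr (near_refl n r X Hr) Hnear)).
      rewrite !(zval_mk n m) in Hc by auto. apply Rabs_def2 in Hc. destruct (Hs j) as (_ & _ & A). lra. }
  destruct (HX Y) as [H|[_ H]]; auto. rewrite !feval_val in H. lra.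
Qed.

Lemma dist_k_lt k X Y r : 0 < r -> (dist_k k X Y < r <-> near k r Y X).
Proof.
  intros Hr. induction k as [|k IH]; simpl.
  - split; [intros _ i Hi; lia|lra].
  - split.
    + intros H i Hi. assert (H1 := Rmax_l (Rabs (X k - Y k)) (dist_k k X Y)).
      assert (H2 := Rmax_r (Rabs (X k - Y k)) (dist_k k X Y)).
      destruct (Nat.eq_dec i k) as [->|]; [lra|]. apply IH; [lra|lia].
    + intros H. apply Rmax_lub_lt; [apply H; lia|]. apply IH. intros i Hi. apply H. lia.
Qed.

Lemma dist_k_pos k X Y : 0 <= dist_k k X Y.
Proof.
  induction k; simpl; [lra|]. eapply Rle_trans; [apply IHk|apply Rmax_r].
Qed.

Lemma dist_k_le2 k X Y : boxed k X 1 -> boxed k Y 1 -> dist_k k X Y <= 2.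
Proof.
  intros HX HY. induction k as [|k IH]; simpl; [lra|].
  apply Rmax_lub.
  - destruct (HX k), (HY k); try lia. apply Rabs_le. lra.
  - apply IH; intros i Hi; [apply HX|apply HY]; lia.
Qed.

Lemma dpt_lt k x (K : (nat -> R) -> Prop) r : (exists y, K y) -> dpt k x K < r -> exists y, K y /\ dist_k k x y
  < r.
Proof.
  intros (y0 & Hy0) H. unfold dpt in H. set (E := fun r => exists y, K y /\ r = dist_k k x y) in *.
  destruct (Glb_Rbar_correct E) as [G1 G2].
  apply NNPP; intros Hn.
  assert (Hlb : Rbar.Rbar_le (Rbar.Finite r) (Glb_Rbar E)).
  { apply G2. intros u (y & Hy & ->). simpl. apply Rnot_lt_le. intros Hl. apply Hn. eauto. }
  assert (Hub : Rbar.Rbar_le (Glb_Rbar E) (Rbar.Finite (dist_k k x y0))) by (apply G1; exists y0; auto).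
  destruct (Glb_Rbar E) as [g| |]; simpl in *; try contradiction. lra.
Qed.

(** [real] maps infinite bounds to 0, so a supremum in [hausdorff] says nothing about its members
    until it is known to be finite; the cube gives the bound 2. *)
Lemma dpt_bounds k x (K : (nat -> R) -> Prop) : (exists y, K y) -> boxed k x 1 ->
  (forall y, K y -> boxed k y 1) -> 0 <= dpt k x K <= 2.
Proof.
  intros (y0 & Hy0) Hx HK. unfold dpt. set (E := fun r => exists y, K y /\ r = dist_k k x y) in *.
  destruct (Glb_Rbar_correct E) as [G1 G2].
  assert (Hlb : Rbar.Rbar_le (Rbar.Finite 0) (Glb_Rbar E)).
  { apply G2. intros u (y & Hy & ->). apply dist_k_pos. }
  assert (Hub : Rbar.Rbar_le (Glb_Rbar E) (Rbar.Finite (dist_k k x y0))) by (apply G1; exists y0; auto).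
  assert (dist_k k x y0 <= 2) by (apply dist_k_le2; auto).
  destruct (Glb_Rbar E) as [g| |]; simpl in *; try contradiction. lra.
Qed.

Lemma hausdorff_lt k (K L' : (nat -> R) -> Prop) r x : (exists y, L' y) ->
  (forall y, K y -> boxed k y 1) -> (forall y, L' y -> boxed k y 1) ->
  K x -> hausdorff k K L' < r -> exists y, L' y /\ dist_k k x y < r.
Proof.
  intros HL HKb HLb Hx H. apply dpt_lt; auto. eapply Rle_lt_trans; [|apply H].
  unfold hausdorff. eapply Rle_trans; [|apply Rmax_l].
  set (E := fun r => exists x, K x /\ r = dpt k x L').
  destruct (Lub_Rbar_correct E) as [G1 G2].
  assert (A : Rbar.Rbar_le (Rbar.Finite (dpt k x L')) (Lub_Rbar E)) by (apply G1; exists x; auto).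
  assert (B : Rbar.Rbar_le (Lub_Rbar E) (Rbar.Finite 2)).
  { apply G2. intros u (y & Hy & ->). apply dpt_bounds; auto. }
  destruct (Lub_Rbar E) as [g| |]; simpl in *; try contradiction. lra.
Qed.

(** This is where the promise enters. Solutions [s j] for [d] tending to 0 cluster at some [X]; as
    the input is false, some [Y] in the fibre over [X] has [val X Y Phi > 0], and continuity of the
    fibre supplies points over [s j] so close to [Y] that [Phi] still has a value bounded away from
    0. *)
Lemma not_input_gap : promise n m Psi -> ~ input_true n m Psi Phi ->
  exists d0, 0 < d0 /\ forall d e, d <= d0 -> 0 < e -> ~ relaxed d e.
Proof.
  intros Hp Hni.
  assert (Hviol : forall X, boxed n X 1 -> exists Y, in_Ik m Y /\ feval X Y Psi /\ 0 < val X Y Phi).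
  { intros X HX. apply NNPP; intros Hn. apply Hni. exists X. intros Y.
    destruct (classic (boxed m Y 1)) as [HY|HY]; auto. right. split; auto. intros HPs.
    apply NNPP; intros HPh. apply Hn. exists (trunc m Y). split; [now apply trunc_in_Ik|].
    rewrite feval_val in *.
    rewrite (val_local n m X (trunc m Y) X Y Psi), (val_local n m X (trunc m Y) X Y Phi);
      auto using trunc_lt. lra. }
  (* An empty fibre over [X] would make the input true at [X]. *)
  destruct Hp as [(X & [HX _] & HF)|[Hne Hc]].
  { destruct (Hviol X HX) as (Y & A & B & _). exfalso. apply (HF Y). split; auto. }
  apply NNPP; intros Hn.
  (* Whatever [e > 0] is, points of the fibre have [val X Y Psi <= 0 < e], so only the bound on
     [Phi] remains. *)
  assert (H : forall j, exists X, in_Ik n X /\ forall Y, Fmap m Psi X Y -> val X Y Phi <= / (INR j + 1)).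
  { intros j. apply NNPP; intros Hj. apply Hn. exists (/ (INR j + 1)).
    split; [apply inv_succ_pos|].
    intros d e Hd He (X & HX & HXY). apply Hj. exists (trunc n X). split; [now apply trunc_in_Ik|].
    intros Y [[HY _] HPs]. rewrite feval_val in HPs.
    rewrite (val_local n m (trunc n X) Y X Y) in * by (auto using trunc_lt).
    destruct (HXY Y HY); lra. }
  apply functional_choice in H. destruct H as (s & Hs).
  destruct (bounded_cluster n s 1) as (X0 & HX0); [intros j; apply (proj1 (boxed_abs _ _)), Hs|].
  set (X := trunc n X0).
  assert (HX : forall rho J, 0 < rho -> exists j, (J <= j)%nat /\ near n rho X (s j)).
  { intros rho J Hr. destruct (HX0 rho J Hr) as (j & Hj & Hnear). exists j. split; auto.
    intros i Hi. unfold X. rewrite trunc_lt by auto. now apply Hnear. }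
  assert (HXb : boxed n X 1).
  { apply boxed_abs. intros i Hi. apply Rnot_lt_le. intros Hl.
    destruct (HX (Rabs (X i) - 1) O) as (j & _ & Hj); [lra|]. specialize (Hj i Hi).
    destruct (Hs j) as ((A & _) & _). apply (proj1 (boxed_abs n (s j))) with (i := i) in A; auto.
    assert (Rabs (X i) <= Rabs (s j i) + Rabs (s j i - X i)).
    { rewrite (Rabs_minus_sym (s j i)). replace (X i) with (s j i + (X i - s j i)) at 1 by ring.
    apply Rabs_triang. }
    lra. }
  assert (HXI : in_Ik n X).
  { split; auto. intros i Hi. unfold X, trunc. apply Nat.ltb_ge in Hi. now rewrite Hi. }
  destruct (Hviol X HXb) as (Y & HY & HPs & HPh).
  destruct (zval_cont n m Phi HPhi (mk n 0 0 X Y) (val X Y Phi / 2)) as (r & Hr & Hcont); [lra|].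
  destruct (Hc X HXI r Hr) as (dl & Hdl & Hcl).
  destruct (archimed_cor1 (val X Y Phi / 2)) as (J & HJ & HJ0); [lra|].
  destruct (HX (Rmin dl r) J) as (j & Hj & Hnear); [now apply Rmin_pos|].
  destruct (Hs j) as (Hsj & Hsj2).
  assert (Hd : dist_k n X (s j) < dl).
  { apply dist_k_lt; auto. apply near_sym. eapply near_le; [apply le_n|apply Rmin_l|apply Hnear]. }
  destruct (hausdorff_lt m (Fmap m Psi X) (Fmap m Psi (s j)) r Y) as (Y' & HY' & HdY).
  - now apply Hne.
  - now intros y [[A _] _].
  - now intros y [[A _] _].
  - split; auto.
  - now apply Hcl.
  - apply dist_k_lt in HdY; auto. apply near_sym in HdY.
    assert (Hnr : near n r X (s j)) by (eapply near_le; [apply le_n|apply Rmin_r|apply Hnear]).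
    specialize (Hcont _ (near_mk 0 0 _ _ _ _ r Hr Hnr HdY)).
    rewrite !(zval_mk n m) in Hcont by auto. apply Rabs_def2 in Hcont. specialize (Hsj2 Y' HY').
    assert (/ (INR j + 1) <= / INR J).
    { apply inv_succ_le; auto. }
    lra.
Qed.

(** The factors 2 applied to [del] and [eps] are the slack that [relaxed_good] consumes. *)
Theorem relaxed_iff B : promise n m Psi -> (level + 2 <= B)%nat ->
  (relaxed (del B) (eps B) <-> input_true n m Psi Phi).
Proof.
  intros Hp HB. destruct plane_poly as (G & G1 & G2 & G3).
  assert (Ho : opn 2 (proj 2 good)) by (apply (proj_opn 2 n), good_opn).
  pose proof (del_pos B) as Hdel. pose proof (eps_pos B) as Heps.
  split.
  - intros Hr. apply NNPP; intros Hni.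
    destruct (not_input_gap Hp Hni) as (d0 & Hd0 & Hgap).
    apply (plane_false level B (proj 2 good) G G1 G2 Ho G3 good_mono HB d0 Hd0) with (e := eps B / 2).
    + intros d e Hd He Hg. apply (Hgap d e Hd He). now apply good_relaxed.
    + lra.
    + apply (relaxed_good (del B) (eps B)); auto; lra.
  - intros Hi. apply good_relaxed. apply (plane_true level B (proj 2 good) G G1 G2 Ho G3 good_mono HB).
    destruct (input_relaxed (del B / 2) Hi) as (e & He & Hre); [lra|].
    exists (e / 2). split; [lra|]. apply (relaxed_good (del B / 2) e); auto; lra.
Qed.

End Sentence.
End Gap.

(** * The output sentence *)

Module Out.
Import Plane Gap.

Definition neg1 : term := TConst (-1).

(* The sign is pushed to the leaves so that a machine can rewrite the encoding token by token; the renaming of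
   [X_i] to [X_(3i)] makes room for the variables of the chain below. *)
Fixpoint ttr (b : bool) (t : term) : term :=
  match t with
  | TConst c => if b then TMul neg1 (TConst c) else TConst c
  | TX i => if b then TMul neg1 (TX (3 * i)) else TX (3 * i)
  | TY j => if b then TMul neg1 (TY j) else TY j
  | TAdd s t => TAdd (ttr b s) (ttr b t)
  | TMul s t => if b then TMul neg1 (TMul (ttr b s) (ttr b t)) else TMul (ttr b s) (ttr b t)
  end.

(* [X_1] and [X_2] hold [delta] and [eps]: [ftr true f] says [eps <= val f], and
   [ftr false f] says [val f <= delta]. *)
Fixpoint ftr (b : bool) (f : qff_le) : qff_le :=
  match f with
  | FLe s t => FLe (TAdd (if b then TX 2 else TMul neg1 (TX 1)) (ttr b s)) (ttr b t)
  | FAnd f g => if b then FOr (ftr b f) (ftr b g) else FAnd (ftr b f) (ftr b g)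
  | FOr f g => if b then FAnd (ftr b f) (ftr b g) else FOr (ftr b f) (ftr b g)
  end.

Definition eqf (s t : term) : qff_le := FAnd (FLe s t) (FLe t s).

(** The squarings run from index [B] down to 0, so that [delta] and [eps] end up in [X_1] and [X_2]
    whatever [B] is; solutions satisfy [X_(3j+1) = 2^(-2^(B-j))] and [X_(3j+2) = 2^(-2^(2B-j))]. *)
Definition block (j : nat) : qff_le :=
  FAnd (eqf (TX (3 * j + 1)) (TMul (TX (3 * j + 4)) (TX (3 * j + 4))))
       (eqf (TX (3 * j + 2)) (TMul (TX (3 * j + 5)) (TX (3 * j + 5)))).

(** A doubled variable equated to 1 expresses 1/2 with integer constants; the second tower starts
    where the first one ends, at [delta]. *)
Definition init (B : nat) : qff_le :=
  FAnd (eqf (TAdd (TX (3 * B + 1)) (TX (3 * B + 1))) (TConst 1))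
       (eqf (TX (3 * B + 2)) (TX 1)).

Fixpoint chain (j : nat) (g : qff_le) : qff_le :=
  match j with O => g | S j' => FAnd (block j') (chain j' g) end.

Definition output (B : nat) (Psi Phi : qff_le) : qff_le :=
  FAnd (init B) (chain B (FOr (ftr true Psi) (ftr false Phi))).

Lemma ttr_eval b X Y t : teval X Y (ttr b t) =
  (if b then -1 else 1) * teval (fun i => X (3 * i)%nat) Y t.
Proof.
  induction t as [c|i|j|s IHs t IHt|s IHs t IHt]; cbn [ttr teval].
  - destruct b; simpl; ring.
  - destruct b; cbn [teval neg1]; ring.
  - destruct b; cbn [teval neg1]; ring.
  - rewrite IHs, IHt. ring.
  - destruct b; cbn [teval neg1]; rewrite IHs, IHt; ring.
Qed.

Lemma ftr_eval b X Y f : feval X Y (ftr b f) <->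
  (if b then X 2%nat <= val (fun i => X (3 * i)%nat) Y f else val (fun i => X (3 * i)%nat) Y f <= X 1%nat).
Proof.
  induction f as [s t|f IHf g IHg|f IHf g IHg]; cbn [ftr feval val].
  - cbn [teval]. rewrite !ttr_eval. destruct b; cbn [teval neg1]; split; lra.
  - destruct b; cbn [feval]; rewrite IHf, IHg; unfold Rmax; destruct (Rle_dec _ _); split; lra.
  - destruct b; cbn [feval]; rewrite IHf, IHg; unfold Rmin; destruct (Rle_dec _ _); split; lra.
Qed.

Lemma eqf_eval X Y s t : feval X Y (eqf s t) <-> teval X Y s = teval X Y t.
Proof. simpl. split; lra. Qed.

Lemma chain_eval X Y g j : feval X Y (chain j g) <->
  ((forall i, (i < j)%nat -> feval X Y (block i)) /\ feval X Y g).
Proof.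
  induction j as [|j IH]; cbn [chain feval].
  - split; [intros H; split; auto; intros; lia|tauto].
  - rewrite IH. split.
    + intros (H1 & H2 & H3). split; auto. intros i Hi. destruct (Nat.eq_dec i j) as [->|]; auto. apply H2. lia.
    + intros (H1 & H2). split; [apply H1; lia|]. split; auto.
Qed.

Definition chain_ok (B : nat) (X : nat -> R) : Prop :=
  X (3 * B + 1)%nat = 1 / 2 /\ X (3 * B + 2)%nat = X 1%nat /\
  forall j, (j < B)%nat -> X (3 * j + 1)%nat = X (3 * j + 4)%nat * X (3 * j + 4)%nat /\
    X (3 * j + 2)%nat = X (3 * j + 5)%nat * X (3 * j + 5)%nat.

Lemma output_eval B X Y Psi Phi : feval X Y (output B Psi Phi) <->
  (chain_ok B X /\ (X 2%nat <= val (fun i => X (3 * i)%nat) Y Psi \/ val (fun i => X (3 * i)%nat) Y Phi <= X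
    1%nat)).
Proof.
  unfold output. cbn [feval]. rewrite chain_eval. cbn [feval]. rewrite !ftr_eval.
  unfold init. cbn [feval]. rewrite !eqf_eval. cbn [teval].
  assert (E : (forall i, (i < B)%nat -> feval X Y (block i)) <->
    forall j, (j < B)%nat -> X (3 * j + 1)%nat = X (3 * j + 4)%nat * X (3 * j + 4)%nat /\
    X (3 * j + 2)%nat = X (3 * j + 5)%nat * X (3 * j + 5)%nat).
  { split; intros H j Hj; specialize (H j Hj); unfold block in *; cbn [feval] in *; rewrite !eqf_eval in *;
    cbn [teval] in *; auto. }
  rewrite E. unfold chain_ok. split; intros H.
  - destruct H as ((H1 & H2) & H3 & H4). split; auto. split; [lra|auto].
  - destruct H as ((H1 & H2 & H3) & H4). split; auto. split; auto. lra.
Qed.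

Lemma inv_pow_sq a : / 2 ^ (2 ^ S a) = / 2 ^ (2 ^ a) * / 2 ^ (2 ^ a).
Proof.
  replace (2 ^ S a)%nat with (2 ^ a + 2 ^ a)%nat by (simpl; lia). rewrite pow_add.
  field. apply pow_nonzero. lra.
Qed.

Lemma chain_value B X j : chain_ok B X -> (j <= B)%nat ->
  X (3 * (B - j) + 1)%nat = / 2 ^ (2 ^ j).
Proof.
  intros (H1 & H2 & H3). induction j as [|j IH]; intros Hj.
  - rewrite Nat.sub_0_r, H1. simpl. lra.
  - destruct (H3 (B - S j)%nat) as [E _]; [lia|]. rewrite E.
    replace (3 * (B - S j) + 4)%nat with (3 * (B - j) + 1)%nat by lia.
    rewrite IH by lia. now rewrite inv_pow_sq.
Qed.

Lemma chain_del B X : chain_ok B X -> X 1%nat = del B.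
Proof.
  intros H. assert (E := chain_value B X B H (le_n _)). rewrite Nat.sub_diag in E. exact E.
Qed.

Lemma chain_value2 B X j : chain_ok B X -> (j <= B)%nat ->
  X (3 * (B - j) + 2)%nat = / 2 ^ (2 ^ (B + j)).
Proof.
  intros H. assert (Hd := chain_del B X H). destruct H as (H1 & H2 & H3). induction j as [|j IH]; intros Hj.
  - rewrite Nat.sub_0_r, H2, Nat.add_0_r. exact Hd.
  - destruct (H3 (B - S j)%nat) as [_ E]; [lia|]. rewrite E.
    replace (3 * (B - S j) + 5)%nat with (3 * (B - j) + 2)%nat by lia.
    rewrite IH by lia. replace (B + S j)%nat with (S (B + j)) by lia. now rewrite inv_pow_sq.
Qed.

Lemma chain_eps B X : chain_ok B X -> X 2%nat = eps B.
Proof.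
  intros H. assert (E := chain_value2 B X B H (le_n _)). rewrite Nat.sub_diag in E.
  unfold eps. replace (2 * B)%nat with (B + B)%nat by lia. exact E.
Qed.

Definition witness (B n : nat) (X : nat -> R) : nat -> R := fun k =>
  let j := (k / 3)%nat in
  match (k mod 3)%nat with
  | O => if Nat.ltb j n then X j else 0
  | S O => / 2 ^ (2 ^ (B - j))
  | _ => / 2 ^ (2 ^ (B + (B - j)))
  end.

Lemma witness_at B n X j r : (r < 3)%nat -> witness B n X (3 * j + r) =
  match r with
  | O => if Nat.ltb j n then X j else 0
  | S O => / 2 ^ (2 ^ (B - j))
  | _ => / 2 ^ (2 ^ (B + (B - j)))
  end.
Proof.
  intros Hr. unfold witness.
  replace ((3 * j + r) / 3)%nat with j by (apply (Nat.div_unique _ _ _ r); lia).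
  replace ((3 * j + r) mod 3)%nat with r by (apply (Nat.mod_unique _ _ j r); lia). auto.
Qed.

Lemma witness_ok B n X : chain_ok B (witness B n X).
Proof.
  assert (A1 : forall j, witness B n X (3 * j + 1)%nat = / 2 ^ (2 ^ (B - j))) by (intros; apply (witness_at B n
    X j 1); lia).
  assert (A2 : forall j, witness B n X (3 * j + 2)%nat = / 2 ^ (2 ^ (B + (B - j)))) by (intros; apply
    (witness_at B n X j 2); lia).
  split; [|split].
  - rewrite A1, Nat.sub_diag. simpl. lra.
  - rewrite A2. change 1%nat with (3 * 0 + 1)%nat at 2. rewrite A1. do 3 f_equal. lia.
  - intros j Hj. replace (3 * j + 4)%nat with (3 * (S j) + 1)%nat by lia.
    replace (3 * j + 5)%nat with (3 * (S j) + 2)%nat by lia. rewrite !A1, !A2.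
    replace (B - j)%nat with (S (B - S j)) by lia. rewrite Nat.add_succ_r, !inv_pow_sq. auto.
Qed.

Lemma witness_boxed B n X k : boxed n X 1 -> boxed k (witness B n X) 1.
Proof.
  intros HX i _. rewrite (Nat.div_mod i 3) by lia.
  assert (Hr := Nat.mod_upper_bound i 3 ltac:(lia)). rewrite witness_at by auto.
  assert (Hp : forall a, -(1) <= / 2 ^ a <= 1).
  { intros a. assert (0 < / 2 ^ a) by (apply Rinv_0_lt_compat, pow_lt; lra).
    assert (/ 2 ^ a <= 1); [|lra]. rewrite <- Rinv_1. apply Rinv_le_contravar; [lra|]. apply pow_R1_Rle. lra. }
  destruct (i mod 3) as [|[|r]]; auto. destruct (Nat.ltb _ n) eqn:E; [|lra].
  apply Nat.ltb_lt in E. now apply HX.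
Qed.

(** Indices 0 to [B] with three variables each give [3 * S B] variables, and [n <= S B] ensures that
    all renamed [X_(3i)] are among them. The chain determines the tower variables, whose values all
    lie in the unit interval. *)
Lemma output_relaxed n m B Psi Phi : scoped n m Psi -> scoped n m Phi -> (n <= S B)%nat ->
  (bsig2_true (3 * S B) m (output B Psi Phi) <-> relaxed n m Psi Phi (del B) (eps B)).
Proof.
  intros HPsi HPhi Hn. split.
  - intros (X & HX). assert (H0 : boxed m (fun _ => 0) 1) by (intros i _; lra).
    assert (HX' : forall Y, boxed m Y 1 -> boxed (3 * S B) X 1 /\ feval X Y (output B Psi Phi)).
    { intros Y HY. destruct (HX Y); tauto. }
    exists (fun i => X (3 * i)%nat). split.
    + intros i Hi. apply (HX' _ H0). lia.
    + intros Y HY. destruct (HX' Y HY) as [_ H]. apply output_eval in H. destruct H as [Hc H].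
      now rewrite <- (chain_del B X Hc), <- (chain_eps B X Hc).
  - intros (X & HX & HXY). exists (witness B n X). intros Y.
    destruct (classic (boxed m Y 1)) as [HY|HY]; auto. right. split; [now apply witness_boxed|].
    apply output_eval. pose proof (witness_ok B n X) as Hc. split; auto.
    rewrite (chain_del B _ Hc), (chain_eps B _ Hc).
    assert (E : forall f, scoped n m f -> val (fun i => witness B n X (3 * i)%nat) Y f = val X Y f).
    { intros f Hf. apply (val_local n m); auto. intros i Hi. rewrite <- (Nat.add_0_r (3 * i)).
      rewrite witness_at by lia. apply Nat.ltb_lt in Hi. now rewrite Hi. }
    rewrite !E by auto. now apply HXY.
Qed.

Lemma tscoped_ttr n m N b t : tscoped n m t -> (3 * n <= N)%nat -> tscoped N m (ttr b t).
Proof.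
  intros H HN. induction t; simpl in *; destruct b; simpl; try tauto; try (split; auto; lia); lia.
Qed.

Lemma scoped_ftr n m N b f : scoped n m f -> (3 * n <= N)%nat -> (3 <= N)%nat -> scoped N m (ftr b f).
Proof.
  intros H HN H3. induction f; simpl in *.
  - destruct H. pose proof (tscoped_ttr n m N b t H HN). pose proof (tscoped_ttr n m N b t0 H0 HN).
    destruct b; simpl; intuition lia.
  - destruct b; simpl; tauto.
  - destruct b; simpl; tauto.
Qed.

Lemma scoped_output n m B Psi Phi : scoped n m Psi -> scoped n m Phi -> (n <= S B)%nat ->
  scoped (3 * S B) m (output B Psi Phi).
Proof.
  intros HPsi HPhi Hn. assert (H1 := scoped_ftr n m (3 * S B) true Psi HPsi ltac:(lia) ltac:(lia)).
  assert (H2 := scoped_ftr n m (3 * S B) false Phi HPhi ltac:(lia) ltac:(lia)).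
  unfold output. cbn [scoped]. split.
  - unfold init, eqf. cbn [scoped tscoped]. intuition lia.
  - assert (Hj : forall j, (j <= B)%nat -> scoped (3 * S B) m (chain j (FOr (ftr true Psi) (ftr false Phi))));
      [|apply Hj; lia].
    induction j as [|j IH]; intros Hj; cbn [chain scoped]; [tauto|]. split; [|apply IH; lia].
    unfold block, eqf. cbn [scoped tscoped]. intuition lia.
Qed.

(** The encoding has length [L + 2], so [B = (L + 6) ^ 3], which is at least [level + 2]. *)
Theorem output_correct n m B Psi Phi : scoped n m Psi -> scoped n m Phi -> promise n m Psi ->
  ((length (enc_input n m Psi Phi) + 4) ^ 3 = B)%nat ->
  scoped (3 * S B) m (output B Psi Phi) /\
  (bsig2_true (3 * S B) m (output B Psi Phi) <-> input_true n m Psi Phi).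
Proof.
  intros HPsi HPhi Hp HB.
  assert (HL : length (enc_input n m Psi Phi) = (n + m + length (enc_fml Psi) + length (enc_fml Phi) + 2)%nat).
  { unfold enc_input, enc_nat. rewrite !length_app, !repeat_length. simpl. lia. }
  set (L := (n + m + length (enc_fml Psi) + length (enc_fml Phi))%nat) in *.
  rewrite HL in HB.
  assert (HBL : ((L + 5) * (L + 5) * (L + 5) + 2 <= B)%nat).
  { rewrite <- HB. simpl. nia. }
  assert (Hn : (n <= S B)%nat) by (assert (n <= L)%nat by (unfold L; lia); nia).
  split; [now apply (scoped_output n)|].
  rewrite (output_relaxed n m B) by auto. apply (relaxed_iff n m); auto.
Qed.

End Out.

(** * Turing machines *)

Module Streams.
Local Open Scope nat_scope.

Definition stream := nat -> option bool.
Definition blanks : stream := fun _ => None.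
Definition scons (a : option bool) (s : stream) : stream := fun i => match i with O => a | S j => s j end.
Definition stl (s : stream) : stream := fun i => s (S i).
Definition sapp (l : list bool) (s : stream) : stream := fold_right (fun b => scons (Some b)) s l.
Definition view (l : list (option bool)) : stream := fun i => nth i l None.

Lemma scons_blanks : scons None blanks = blanks.
Proof. extensionality i. now destruct i. Qed.

Lemma stl_scons a s : stl (scons a s) = s.
Proof. now extensionality i. Qed.

Lemma view_cons a l : view (a :: l) = scons a (view l).
Proof. extensionality i. now destruct i. Qed.

Lemma view_nil : view [] = blanks.
Proof. extensionality i. now destruct i. Qed.

Lemma sapp_cons b l s : sapp (b :: l) s = scons (Some b) (sapp l s).
Proof. reflexivity. Qed.

Lemma sapp_app l m s : sapp (l ++ m) s = sapp l (sapp m s).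
Proof. apply fold_right_app. Qed.

Lemma view_bits w : view (map Some w) = sapp w blanks.
Proof. induction w as [|b w IH]; [apply view_nil|]. cbn [map]. now rewrite view_cons, IH, sapp_cons. Qed.

Lemma read_bits_view l w : view l = sapp w blanks -> read_bits l = w.
Proof.
  revert l. induction w as [|b w IH]; intros l H.
  - destruct l as [|a l]; auto. assert (E := f_equal (fun s => s O) H). change (a = None) in E. now rewrite E.
  - destruct l as [|a l]; [assert (E := f_equal (fun s => s O) H); discriminate|].
    assert (E := f_equal (fun s => s O) H). change (a = Some b) in E. subst a. simpl. f_equal. apply IH.
    rewrite view_cons, sapp_cons in H. assert (E := f_equal stl H). now rewrite !stl_scons in E.
Qed.

Definition shd (s : stream) : option bool := s O.

(* Streams identify the tapes that differ by trailing blanks only. *)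
Definition cview (c : config) : nat * stream * stream :=
  (cstate c, view (cleft c), view (chead c :: cright c)).

Definition move_tape (L R : stream) (w : option bool) (mv : move) : stream * stream :=
  match mv with
  | MStay => (L, scons w (stl R))
  | MRight => (scons w L, stl R)
  | MLeft => (stl L, scons (shd L) (scons w (stl R)))
  end.

(** On streams the case of an exhausted tape disappears, since the blanks are already there. *)
Lemma cview_step M c q L R : cview c = (q, L, R) -> q <> 1 ->
  cview (tm_step M c) =
  (fst (fst (delta M q (shd R))), fst (move_tape L R (snd (fst (delta M q (shd R)))) (snd (delta M q (shd R)))),
   snd (move_tape L R (snd (fst (delta M q (shd R)))) (snd (delta M q (shd R))))).
Proof.
  intros E Hq. injection E as <- <- <-. unfold tm_step. apply Nat.eqb_neq in Hq. rewrite Hq.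
  change (shd (view (chead c :: cright c))) with (chead c).
  destruct (delta M (cstate c) (chead c)) as [[q' w] mv]. cbn [fst snd].
  destruct c as [q l h r]; cbn [cstate cleft chead cright]. rewrite (view_cons h r).
  destruct mv; cbn [move_tape fst snd].
  - destruct l as [|a l]; unfold cview; cbn [cstate cleft chead cright].
    + rewrite view_nil, !view_cons, stl_scons. reflexivity.
    + rewrite !view_cons, !stl_scons. reflexivity.
  - destruct r as [|a r]; unfold cview; cbn [cstate cleft chead cright].
    + rewrite view_cons, stl_scons, view_cons, view_nil, scons_blanks. reflexivity.
    + rewrite !view_cons, !stl_scons. reflexivity.
  - unfold cview; cbn [cstate cleft chead cright]. rewrite !view_cons, !stl_scons. reflexivity.
Qed.

Lemma cview_init w : cview (tm_init w) = (0, blanks, sapp w blanks).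
Proof.
  unfold cview. destruct w as [|b w]; cbn [tm_init cstate cleft chead cright].
  - rewrite view_cons, view_nil, scons_blanks. reflexivity.
  - rewrite view_nil, view_cons, view_bits. reflexivity.
Qed.

End Streams.

(** * Turing machines over finite state types *)

Module FinTM.
Local Open Scope nat_scope.
Import all_boot.
Import Streams.

Section Code.
Variables (St : finType) (start : St).
Variable d : St -> option bool -> option St * option bool * move.

(* [None] is the halting state. *)
Definition code (s : option St) : nat :=
  match s with None => 1 | Some s => (enum_rank s).+2 end.

(** Number 0, the prescribed start state, is not a value of [code]; the default makes it behave like
    [start]. *)
Definition decode (n : nat) : St :=
  match n with
  | n'.+2 => match @idP (n' < #|St|)%N with ReflectT H => enum_val (Ordinal H) | _ => start end
  | _ => start
  end.

Lemma decodeK s : decode (code (Some s)) = s.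
Proof.
rewrite /decode /code; case: {-}_ / idP => [H|]; last by rewrite ltn_ord.
by rewrite (_ : Ordinal H = enum_rank s) ?enum_rankK //; apply: val_inj.
Qed.

Definition fdelta (q : nat) (a : option bool) : nat * option bool * move :=
  let: (s, w, mv) := d (decode q) a in (code s, w, mv).

Lemma code_bound s : lt (code s) #|St|.+2.
Proof. by case: s => [s|] /=; apply/ltP; rewrite // !ltnS ltn_ord. Qed.

Lemma fdelta_ok q a : lt q #|St|.+2 -> lt (fst (fst (fdelta q a))) #|St|.+2.
Proof. by move=> _; rewrite /fdelta; case: (d _ _) => [[s w] mv]; apply: code_bound. Qed.

Lemma two_le : le 2 #|St|.+2.
Proof. by apply/leP. Qed.

Definition machine : TM := Build_TM #|St|.+2 fdelta two_le fdelta_ok.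

Definition acfg := (option St * stream * stream)%type.

Definition astep (c : acfg) : acfg :=
  match c with
  | (None, L, R) => c
  | (Some s, L, R) =>
      let: (s', w, mv) := d s (shd R) in
      (s', fst (move_tape L R w mv), snd (move_tape L R w mv))
  end.

Definition arun (t : nat) (c : acfg) : acfg := Nat.iter t astep c.

Lemma arun_add t u c : arun (Nat.add t u) c = arun u (arun t c).
Proof. rewrite /arun PeanoNat.Nat.add_comm; elim: u => //= u IH; by rewrite IH. Qed.

Lemma arun_S t c : arun t.+1 c = arun t (astep c).
Proof. by rewrite -[t.+1]/(Nat.add 1 t) arun_add. Qed.

Definition ccode (c : acfg) : nat * stream * stream := (code c.1.1, c.1.2, c.2).

Lemma machine_step c ac : cview c = ccode ac -> cview (tm_step machine c) = ccode (astep ac).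
Proof.
case: ac => [[[s|] L] R] E.
  rewrite (cview_step _ _ _ _ _ E) //= /fdelta (decodeK s).
  by case: (d s (shd R)) => [[s' w] mv].
rewrite -E; congr cview; rewrite /tm_step.
by have -> : Nat.eqb (cstate c) 1 = true by move: E => [-> _ _].
Qed.

(** Stated for at least one step: before the first one the state number is 0, which [code] does not
    produce. *)
Lemma machine_run w t :
  cview (tm_run machine t.+1 w) = ccode (arun t.+1 (Some start, blanks, sapp w blanks)).
Proof.
elim: t => [|t IH]; last by rewrite /arun /tm_run /= in IH *; apply: machine_step.
rewrite /tm_run /arun /=; rewrite (cview_step _ _ _ _ _ (cview_init w)) //= /fdelta /=.
by case: (d start _) => [[s' w'] mv].
Qed.

Lemma machine_output w t L out :
  arun t.+1 (Some start, blanks, sapp w blanks) = (None, L, sapp out blanks) ->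
  cstate (tm_run machine t.+1 w) = 1 /\ tm_output (tm_run machine t.+1 w) = out.
Proof.
move=> E; have := machine_run w t; rewrite E /cview /ccode /= => - [-> _ E']; split=> //.
exact: read_bits_view.
Qed.

End Code.
End FinTM.

(** * Finite transducers run in passes on one tape *)

Module Pass.
Local Open Scope nat_scope.
Import all_boot.
Import Streams FinTM.

Ltac nlia := change addn with Init.Nat.add in *; change muln with Init.Nat.mul in *; (lia || nia).

Section Transducer.
Variables (Q : finType) (q0 : Q) (W : nat).
Variable step : Q -> bool -> Q * seq bool.
Variable eop : Q -> option (Q * seq bool).
Hypothesis stepW : forall q b, le (length (step q b).2) W.
Hypothesis eopW : forall q q' l, eop q = Some (q', l) -> le (length l) W.

Fixpoint feed (q : Q) (s : seq bool) : Q * seq bool :=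
  match s with
  | [::] => (q, [::])
  | b :: s' => let (q1, l) := step q b in let (q2, m) := feed q1 s' in (q2, app l m)
  end.

(** At the end of a pass [eop] either halts with the word just emitted, or appends a last piece and
    makes the result the input of the next pass. [S] bounds every word and the numeric index counts
    the passes. *)
Inductive runs (S : nat) : nat -> Q -> seq bool -> seq bool -> Prop :=
| runs_end q s q' r : le (length s) S -> le (length r) S ->
    feed q s = (q', r) -> eop q' = None -> runs S 1 q s r
| runs_next P q s q' m q2 l r : le (length s) S -> le (length (app m l)) S ->
    feed q s = (q', m) -> eop q' = Some (q2, l) -> runs S P q2 (app m l) r -> runs S P.+1 q s r.

Definition St : finType := ('I_5 * Q * W.-bseq bool * bool)%type.

(** The flag [f] marks the emission at the end of a pass: no unread word is left, so the return
    skips phase 3. *)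
Definition mk (i : nat) (q : Q) (l : seq bool) (f : bool) : St := (inord i, q, insub_bseq W l, f).

(* Tape layout: blanks, unread word, blank, emitted word, blanks. Phase 0 erases the first unread bit, phases 1
   and 2 move right over the unread and the emitted word and write the pending bits, phases 3 and 4 return. *)
Definition d (s : St) (a : option bool) : option St * option bool * move :=
  let: (i, q, l, f) := s in
  match val i, a with
  | 0, Some b => (Some (mk 1 (step q b).1 (step q b).2 false), None, MRight)
  | 0, None => match eop q with
               | None => (None, None, MRight)
               | Some (q', l') => (Some (mk 2 q' l' true), None, MRight)
               end
  | 1, Some b => (Some s, Some b, MRight)
  | 1, None => (Some (mk 2 q l false), None, MRight)
  | 2, Some b => (Some s, Some b, MRight)
  | 2, None => match bseqval l with
               | [::] => (Some (mk (if f then 4 else 3) q [::] false), None, MLeft)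
               | x :: l' => (Some (mk 2 q l' f), Some x, MRight)
               end
  | 3, Some b => (Some s, Some b, MLeft)
  | 3, None => (Some (mk 4 q [::] false), None, MLeft)
  | _, Some b => (Some s, Some b, MLeft)
  | _, None => (Some (mk 0 q [::] false), None, MRight)
  end.

Local Arguments d : simpl never.
Local Arguments mk : simpl never.
Local Arguments arun : simpl never.

Notation run := (arun St d).

Lemma insubW (l : seq bool) : le (length l) W -> bseqval (insub_bseq W l) = l.
Proof. by move=> /leP H; rewrite /insub_bseq insubdK. Qed.

Lemma mk_phase i q l f : lt i 5 -> le (length l) W -> forall a, d (mk i q l f) a =
  match i, a with
  | 0, Some b => (Some (mk 1 (step q b).1 (step q b).2 false), None, MRight)
  | 0, None => match eop q with
               | None => (None, None, MRight)
               | Some (q', l') => (Some (mk 2 q' l' true), None, MRight)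
               end
  | 1, Some b => (Some (mk i q l f), Some b, MRight)
  | 1, None => (Some (mk 2 q l false), None, MRight)
  | 2, Some b => (Some (mk i q l f), Some b, MRight)
  | 2, None => match l with
               | [::] => (Some (mk (if f then 4 else 3) q [::] false), None, MLeft)
               | x :: l' => (Some (mk 2 q l' f), Some x, MRight)
               end
  | 3, Some b => (Some (mk i q l f), Some b, MLeft)
  | 3, None => (Some (mk 4 q [::] false), None, MLeft)
  | _, Some b => (Some (mk i q l f), Some b, MLeft)
  | _, None => (Some (mk 0 q [::] false), None, MRight)
  end.
Proof.
move=> /ltP Hi Hl a; rewrite /d {1}/mk /= inordK // insubW //.
Qed.

Lemma go_right i q l f u L R : (i = 1 \/ i = 2) -> le (length l) W ->
  run (length u) (Some (mk i q l f), L, sapp u R) = (Some (mk i q l f), sapp (rev u) L, R).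
Proof.
move=> Hi Hl; have H5 : lt i 5 by lia.
have E L' R' b : astep St d (Some (mk i q l f), L', scons (Some b) R') = (Some (mk i q l f), scons (Some b) L',
  R').
  by rewrite /= mk_phase //; case: Hi => -> /=; rewrite stl_scons.
elim: u L => [|b u IH] L //.
by rewrite [length _]/= arun_S sapp_cons E IH rev_cons -cats1 -[cat _ _]/(app _ _) sapp_app.
Qed.

(* The configuration reached by moving left from the tape [(L, R)]. *)
Definition left_of (s : St) (L R : stream) : acfg St := (Some s, stl L, scons (shd L) R).

Lemma go_left i q l f u L R : (i = 3 \/ i = 4) -> le (length l) W ->
  run (length u) (left_of (mk i q l f) (sapp (rev u) (scons None L)) R) =
  (Some (mk i q l f), L, scons None (sapp u R)).
Proof.
move=> Hi Hl; have H5 : lt i 5 by lia.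
have E L' R' b : astep St d (Some (mk i q l f), L', scons (Some b) R') =
    left_of (mk i q l f) L' (scons (Some b) R').
  by rewrite /= mk_phase //; case: Hi => -> /=; rewrite stl_scons.
elim/last_ind: u R => [|u b IH] R; first by rewrite /left_of /= stl_scons.
rewrite rev_rcons /left_of sapp_cons stl_scons -cats1 -[cat _ _]/(app _ _) length_app Nat.add_1_r.
by rewrite arun_S [shd _]/= E IH sapp_app.
Qed.

Lemma go_write q l f L : le (length l) W ->
  run (length l).+1 (Some (mk 2 q l f), L, blanks) =
  left_of (mk (if f then 4 else 3) q [::] false) (sapp (rev l) L) blanks.
Proof.
elim: l L => [|x l IH] L Hl; rewrite arun_S /= mk_phase //; try lia.
  by rewrite /= scons_blanks.
rewrite /= IH; last by rewrite /= in Hl; lia.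
by rewrite rev_cons -cats1 -[cat _ _]/(app _ _) sapp_app.
Qed.

Lemma run_trans t u c c' c'' : run t c = c' -> run u c' = c'' -> run (Nat.add t u) c = c''.
Proof. by move=> <- <-; rewrite arun_add. Qed.

Lemma run_one s L R : run 1 (Some s, L, R) = astep St d (Some s, L, R).
Proof. by []. Qed.

(** One bit costs a round trip over the unread and the emitted word, so a pass takes quadratic
    time. *)
Lemma micro q b s o : let: (q', l) := step q b in
  run (2 * (length s + length o + length l) + 5)%coq_nat
    (Some (mk 0 q [::] false), blanks, sapp (b :: s) (scons None (sapp o blanks))) =
    (Some (mk 0 q' [::] false), blanks, sapp s (scons None (sapp (app o l) blanks))).
Proof.
have := stepW q b; case E: (step q b) => [q' l] /= Hl.
have H0 : le (length (@nil bool)) W by simpl; lia.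
have -> : (2 * (length s + length o + length l) + 5)%coq_nat =
  (1 + (length s + (1 + (length o + (S (length l) + (length (app o l) + (1 + (length s + 1))))))))%coq_nat.
  rewrite length_app; nlia.
apply: run_trans; first by rewrite run_one /= mk_phase ?E; try (simpl length; lia); rewrite /= ?E /=
  ?stl_scons; reflexivity.
rewrite ?scons_blanks ?stl_scons.
apply: run_trans; first by apply: go_right; auto.
apply: run_trans; first by rewrite run_one /= mk_phase; try (simpl length; lia); rewrite /= ?E /= ?stl_scons;
  reflexivity.
rewrite ?stl_scons.
apply: run_trans; first by apply: go_right; auto.
apply: run_trans; first exact: go_write.
rewrite -sapp_app (_ : app (rev l) (rev o) = rev (app o l)); last by rewrite -[app o l]/(cat o l) rev_cat.
apply: run_trans; first by apply: go_left; auto.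
(* Makes visible the blank left by the erased bit, at which the leftward walk stops. *)
rewrite -{1}scons_blanks.
apply: run_trans; first by rewrite run_one /= mk_phase; try (simpl length; lia); rewrite /= ?E /= ?stl_scons;
  reflexivity.
rewrite ?stl_scons -/(left_of _ (sapp (rev s) (scons None blanks)) _).
apply: run_trans; first by apply: go_left; auto.
by rewrite run_one /= mk_phase; try (simpl length; lia); rewrite /= stl_scons scons_blanks.
Qed.

Lemma run_feed q s o S : le (length (app o (feed q s).2)) S -> le (length s) S ->
  exists t, le t (length s * (4 * S + 6))%coq_nat /\
  run t (Some (mk 0 q [::] false), blanks, sapp s (scons None (sapp o blanks))) =
    (Some (mk 0 (feed q s).1 [::] false), blanks, scons None (sapp (app o (feed q s).2) blanks)).
Proof.
elim: s q o => [|b s IH] q o /=; first by move=> _ _; exists 0; rewrite List.app_nil_r; split; [lia|].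
have := micro q b s o; case E: (step q b) => [q1 l] Hm.
case F: (feed q1 s) => [q2 m] /=; rewrite List.app_assoc => HS Hs.
have HS' : le (length (app (app o l) (feed q1 s).2)) S by rewrite F.
have Hs' : le (length s) S by nlia.
have [t [Ht Hr]] := IH q1 (app o l) HS' Hs'; rewrite F in Hr.
exists (2 * (length s + length o + length l) + 5 + t)%coq_nat; split.
  rewrite !length_app in HS; simpl length in *; nlia.
by apply: run_trans; [exact: Hm|exact: Hr].
Qed.

Lemma run_eop_halt q o : eop q = None ->
  run 1 (Some (mk 0 q [::] false), blanks, scons None (sapp o blanks)) = (None, blanks, sapp o blanks).
Proof.
move=> E; rewrite run_one /= mk_phase; try (simpl length; lia).
by rewrite E /= scons_blanks stl_scons.
Qed.

Lemma run_eop_next q o q' l : eop q = Some (q', l) ->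
  run (2 * (length o + length l) + 3)%coq_nat (Some (mk 0 q [::] false), blanks, scons None (sapp o blanks)) =
    (Some (mk 0 q' [::] false), blanks, sapp (app o l) (scons None (sapp [::] blanks))).
Proof.
move=> E; have Hl := eopW _ _ _ E.
have H0 : le (length (@nil bool)) W by simpl; lia.
have -> : (2 * (length o + length l) + 3)%coq_nat =
  (1 + (length o + (S (length l) + (length (app o l) + 1))))%coq_nat.
  rewrite length_app; nlia.
apply: run_trans; first by rewrite run_one /= mk_phase ?E; try (simpl length; lia); rewrite /= ?E /=
  ?stl_scons; reflexivity.
rewrite ?scons_blanks ?stl_scons.
apply: run_trans.
  by rewrite -{1}[sapp o blanks]/(sapp o blanks); apply: go_right; auto.
apply: run_trans; first exact: go_write.
rewrite -sapp_app (_ : app (rev l) (rev o) = rev (app o l)); last by rewrite -[app o l]/(cat o l) rev_cat.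
rewrite -{1}scons_blanks.
apply: run_trans; first by apply: go_left; auto.
by rewrite run_one /= mk_phase; try (simpl length; lia); rewrite /= stl_scons scons_blanks.
Qed.

Lemma runs_run S P q s r : runs S P q s r ->
  exists t, le t (P * ((S + 1) * (4 * S + 10)))%coq_nat /\
  exists L, run t (Some (mk 0 q [::] false), blanks, sapp s blanks) = (None, L, sapp r blanks).
Proof.
elim=> {P q s r} [q s q' r Hs Hr Hf He|P q s q' m q2 l r Hs Hm Hf He _ [t [Ht [L HL]]]].
  have Hr' : le (length (app [::] (feed q s).2)) S by rewrite Hf.
  have [t [Ht H]] := run_feed q s [::] S Hr' Hs.
  exists (t + 1)%coq_nat; split; first nlia.
  exists blanks; apply: run_trans; last exact: run_eop_halt He.
  by rewrite (_ : scons None (sapp [::] blanks) = blanks) ?Hf in H; [exact: H|exact: scons_blanks].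
have Hm' : le (length m) S by rewrite length_app in Hm; nlia.
have Hm2 : le (length (app [::] (feed q s).2)) S by rewrite Hf.
have [t' [Ht' H]] := run_feed q s [::] S Hm2 Hs.
exists (t' + ((2 * (length m + length l) + 3) + t))%coq_nat; split.
  rewrite length_app in Hm; nlia.
exists L; apply: run_trans.
  by rewrite (_ : scons None (sapp [::] blanks) = blanks) ?Hf in H; [exact: H|exact: scons_blanks].
apply: run_trans; first exact: run_eop_next He.
by rewrite -[sapp [::] blanks]/blanks scons_blanks.
Qed.

Theorem transducer_machine : exists M : TM, forall S P w r, runs S P q0 w r ->
  exists t, le t (P * ((S + 1) * (4 * S + 10)))%coq_nat /\
    cstate (tm_run M t w) = 1 /\ tm_output (tm_run M t w) = r.
Proof.
exists (machine St (mk 0 q0 [::] false) d) => S P w r /runs_run [t [Ht [L H]]].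
case: t Ht H => [|t] Ht H; first by [].
exists t.+1; split=> //; exact: machine_output H.
Qed.

End Transducer.
End Pass.

(** * Queue programs *)

Module Queue.
Local Open Scope nat_scope.

Inductive instr : Type :=
| PushB (i : nat) (b : bool) (next : nat)
| PushF (i : nat) (b : bool) (next : nat)
| Nop (next : nat)
| Pop (i : nat) (on1 on0 onE : nat).

Definition regs := nat -> list bool.

Definition eff (I : instr) (j : nat) (l : list bool) : list bool :=
  match I with
  | PushB i b _ => if Nat.eqb j i then l ++ [b] else l
  | PushF i b _ => if Nat.eqb j i then b :: l else l
  | Nop _ => l
  | Pop i _ _ _ => if Nat.eqb j i then tl l else l
  end.

(** The popped bit as one pass accumulates it: [res] is what the preceding queues produced. *)
Definition effr (I : instr) (j : nat) (l : list bool) (res : option bool) : option bool :=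
  match I with
  | Pop i _ _ _ => if Nat.eqb j i then match l with [] => res | b :: _ => Some b end else res
  | _ => res
  end.

Definition next (I : instr) (res : option bool) : nat :=
  match I with
  | PushB _ _ n | PushF _ _ n | Nop n => n
  | Pop _ l1 l0 lE => match res with Some true => l1 | Some false => l0 | None => lE end
  end.

Definition target (I : instr) : option nat :=
  match I with PushB i _ _ | PushF i _ _ | Pop i _ _ _ => Some i | Nop _ => None end.

Definition result (I : instr) (s : regs) : option bool :=
  match I with Pop i _ _ _ => hd_error (s i) | _ => None end.

Definition instr_step (I : instr) (s : regs) : nat * regs :=
  (next I (result I s), fun j => eff I j (s j)).

(** Beyond the end of the code the default instruction jumps to itself, so halting means reaching
    the address [length code]. *)
Definition gostep (code : list instr) (c : nat * regs) : nat * regs :=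
  instr_step (nth (fst c) code (Nop (fst c))) (snd c).

Definition gorun (code : list instr) (t : nat) (c : nat * regs) : nat * regs :=
  Nat.iter t (gostep code) c.

Definition dbl (l : list bool) : list bool := flat_map (fun b => [true; b]) l.

(** The tape holds bits only, so tokens are pairs: [true b] is the bit [b], and [false false] ends a
    queue. *)
Fixpoint encs (s : regs) (a c : nat) : list bool :=
  match c with
  | O => []
  | S c' => dbl (s a) ++ [false; false] ++ encs s (S a) c'
  end.

Lemma dbl_cons b l : dbl (b :: l) = true :: b :: dbl l.
Proof. reflexivity. Qed.

Lemma dbl_length l : length (dbl l) = 2 * length l.
Proof. induction l as [|b l IH]; simpl; auto. rewrite IH. lia. Qed.

Lemma eff_length I j l : length (eff I j l) <= length l + match target I with Some i => if Nat.eqb j i then 1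
  else 0 | None => 0 end.
Proof.
  destruct I; simpl; try destruct (Nat.eqb j i); simpl; rewrite ?length_app; simpl; try lia.
  destruct l; simpl; lia.
Qed.

Lemma encs_eff_length I s a c : length (encs (fun j => eff I j (s j)) a c) <=
  length (encs s a c) + match target I with Some i => if andb (Nat.leb a i) (Nat.ltb i (a + c)) then 2 else 0 |
    None => 0 end.
Proof.
  revert a. induction c as [|c IH]; intros a; simpl; [lia|].
  rewrite !length_app, !dbl_length. simpl. specialize (IH (S a)). pose proof (eff_length I a (s a)) as He.
  destruct (target I) as [i|]; [|lia].
  destruct (Nat.eqb a i) eqn:E1, (Nat.leb a i) eqn:E2, (Nat.ltb i (a + S c)) eqn:E3,
    (Nat.leb (S a) i) eqn:E4, (Nat.ltb i (S a + c)) eqn:E5; simpl andb in *; cbn iota in *;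
  rewrite ?Nat.eqb_eq, ?Nat.eqb_neq, ?Nat.leb_le, ?Nat.leb_gt, ?Nat.ltb_lt, ?Nat.ltb_ge in *; lia.
Qed.

Lemma encs_step_length I s k : length (encs (fun j => eff I j (s j)) 0 k) <= length (encs s 0 k) + 2.
Proof.
  pose proof (encs_eff_length I s 0 k). destruct (target I) as [i|]; [|lia].
  destruct (andb (Nat.leb 0 i) (Nat.ltb i (0 + k))); lia.
Qed.

Definition load (w : list bool) : regs := fun i => match i with O => w | _ => [] end.

Lemma encs_empty s a c : (forall i, a <= i -> s i = []) -> encs s a c = concat (repeat [false; false] c).
Proof.
  revert a. induction c as [|c IH]; intros a H; simpl; auto. rewrite H by lia. simpl.
  now rewrite (IH (S a)) by (intros; apply H; lia).
Qed.

Lemma encs_load w c : encs (load w) 0 (S c) = dbl w ++ concat (repeat [false; false] (S c)).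
Proof.
  simpl. rewrite (encs_empty _ 1 c); auto. intros i Hi. destruct i; [lia|auto].
Qed.

End Queue.

(** * One queue instruction per pass *)

Module QueueTM.
Local Open Scope nat_scope.
Import all_boot.
Import Queue Pass.

Section Machine.
Variables (code : seq instr) (k out : nat).
Hypothesis kpos : lt 0 k.
Hypothesis out_lt : lt out k.
Let N := length code.
Hypothesis targets : forall pc, lt pc N -> forall i, target (List.nth pc code (Nop pc)) = Some i -> lt i k.
Hypothesis jumps : forall pc r, lt pc N -> le (next (List.nth pc code (Nop pc)) r) N.

(* Initial phase flag, program counter, current queue, first bit of a pair, start-of-queue flag, popped bit. *)
Definition Q : finType := (bool * 'I_N.+1 * 'I_k.+1 * option bool * bool * option bool)%type.

Definition mkq (pc a : nat) (buf : option bool) (st : bool) (res : option bool) : Q :=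
  (false, inord pc, inord a, buf, st, res).

Definition q0 : Q := (true, inord 0, inord 0, None, true, None).

(** Every instruction changes the encoding only at the first pair or at the end mark of its queue,
    so a finite memory suffices. At [pc = N] the pass decodes instead: it emits the bare bits of
    queue [out] and drops the rest. *)
Definition pairstep (pc a : nat) (st : bool) (res : option bool) (x b : bool) : Q * seq bool :=
  if Nat.eqb pc N then
    if x then (mkq pc a None false res, if Nat.eqb a out then [:: b] else [::])
    else (mkq pc a.+1 None true res, [::])
  else
  let I := List.nth pc code (Nop pc) in
  if x then
    match I with
    | PushF i c _ => (mkq pc a None false res, if st && Nat.eqb a i then [:: true; c; true; b] else [:: true;
      b])
    | Pop i _ _ _ => if st && Nat.eqb a i then (mkq pc a None false (Some b), [::])
                     else (mkq pc a None false res, [:: true; b])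
    | _ => (mkq pc a None false res, [:: true; b])
    end
  else
    (mkq pc a.+1 None true res,
     match I with
     | PushF i c _ => if st && Nat.eqb a i then [:: true; c; false; false] else [:: false; false]
     | PushB i c _ => if Nat.eqb a i then [:: true; c; false; false] else [:: false; false]
     | _ => [:: false; false]
     end).

Definition qstep (q : Q) (b : bool) : Q * seq bool :=
  let: (ini, pc, a, buf, st, res) := q in
  if ini then (q, [:: true; b])
  else match buf with
       | None => (mkq (val pc) (val a) (Some b) st res, [::])
       | Some x => pairstep (val pc) (val a) st res x b
       end.

(** The initial pass doubles the input bits; the [k] end marks appended to it close queue 0 and
    create the [k - 1] empty queues. *)
Definition qeop (q : Q) : option (Q * seq bool) :=
  let: (ini, pc, a, buf, st, res) := q in
  if ini then Some (mkq 0 0 None true None, concat (repeat [:: false; false] k))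
  else if Nat.eqb (val pc) N then None
  else Some (mkq (next (List.nth (val pc) code (Nop (val pc))) res) 0 None true None, [::]).

Definition W : nat := Nat.add (Nat.mul 2 k) 4.

Lemma qstepW q b : le (length (qstep q b).2) W.
Proof.
case: q => [[[[[ini pc] a] buf] st] res] /=; rewrite /W.
case: ini => /=; first by lia.
case: buf => [x|] /=; last by lia.
rewrite /pairstep; case: ifP => _; first by case: x => /=; [case: ifP => _ /=|]; lia.
by case: x; case: (List.nth _ _ _) => /= *; repeat case: ifP => _ /=; lia.
Qed.

Lemma qeopW q q' l : qeop q = Some (q', l) -> le (length l) W.
Proof.
case: q => [[[[[ini pc] a] buf] st] res] /=; rewrite /W.
case: ini => [[_ <-]|].
  have -> : length (concat (repeat [:: false; false] k)) = Nat.mul 2 k by elim: (k) => //= n ->; lia.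
  lia.
by case: ifP => // _ [_ <-] /=; lia.
Qed.

Notation feed := (feed Q qstep).

Lemma inord_val n i : le i n -> val (inord i : 'I_n.+1) = i.
Proof. by move=> /leP H; rewrite /= inordK. Qed.

Lemma feed_pair pc a st res x b s : le pc N -> le a k ->
  feed (mkq pc a None st res) (x :: b :: s) =
  let (q1, l) := pairstep pc a st res x b in let (q2, m) := feed q1 s in (q2, app l m).
Proof.
move=> Hpc Ha; rewrite /= !inord_val //.
by case: (pairstep _ _ _ _ _ _) => q1 l; case: (feed q1 s) => q2 m.
Qed.

(** Pairs are copied verbatim once no action at the front of the queue is due. *)
Lemma feed_rest pc a st res l s : lt pc N -> lt a k ->
  (forall i, target (List.nth pc code (Nop pc)) = Some i -> i = a -> st = false) ->
  feed (mkq pc a None st res) (app (dbl l) s) =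
  let (q, m) := feed (mkq pc a None (if l is [::] then st else false) res) s in (q, app (dbl l) m).
Proof.
move=> Hpc Ha; elim: l st => [|b l IH] st Ht; first by rewrite /=; case: (feed _ _).
rewrite dbl_cons -!app_comm_cons feed_pair; try lia.
have -> : pairstep pc a st res true b = (mkq pc a None false res, [:: true; b]).
  rewrite /pairstep; have /Nat.eqb_neq -> : pc <> N by lia.
  move: Ht; case: (List.nth pc code (Nop pc)) => //= [i c n|i l1 l0 lE] Ht.
    by case: (Nat.eqb_spec a i) => [E|]; [rewrite (Ht i) ?E|rewrite andbF].
  by case: (Nat.eqb_spec a i) => [E|]; [rewrite (Ht i) ?E|rewrite andbF].
rewrite IH //.
have -> : (match l with [::] => false | _ => false end) = false by case: l {IH}.
by case: (feed _ s) => q m.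
Qed.

Lemma feed_queue pc a res l s : lt pc N -> lt a k ->
  let I := List.nth pc code (Nop pc) in
  feed (mkq pc a None true res) (app (dbl l) (false :: false :: s)) =
  let (q, m) := feed (mkq pc a.+1 None true (effr I a l res)) s in
  (q, app (dbl (eff I a l)) (false :: false :: m)).
Proof.
move=> Hpc Ha I.
have HN : Nat.eqb pc N = false by apply/Nat.eqb_neq; lia.
have Hsep st r s' : feed (mkq pc a None st r) (false :: false :: s') =
   let (q, m) := feed (mkq pc a.+1 None true r) s' in
   (q, app (match I with
     | PushF i c _ => if st && Nat.eqb a i then [:: true; c; false; false] else [:: false; false]
     | PushB i c _ => if Nat.eqb a i then [:: true; c; false; false] else [:: false; false]
     | _ => [:: false; false]
     end) m).
  by rewrite feed_pair; try lia; rewrite /pairstep HN.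
case HI: I => [i c n|i c n|n|i l1 l0 lE].
- have Hl st : feed (mkq pc a None st res) (app (dbl l) (false :: false :: s)) =
    let (q, m) := feed (mkq pc a.+1 None true res) s in
    (q, app (dbl l) (if Nat.eqb a i then true :: c :: false :: false :: m else false :: false :: m)).
    elim: l st => [|b l IH] st.
      by rewrite Hsep HI; case: (feed _ s) => q m; case: ifP.
    rewrite dbl_cons -!app_comm_cons feed_pair; try lia.
    rewrite /pairstep HN -/I HI IH; by case: (feed _ s).
  rewrite Hl /=; case: (feed _ s) => q m; case: ifP => // _.
  by rewrite /dbl flat_map_app -List.app_assoc.
- case Ei: (Nat.eqb a i).
    case: l => [|b l]; first by rewrite Hsep HI Ei /= Ei; case: (feed _ s).
    rewrite dbl_cons -!app_comm_cons feed_pair; try lia.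
    rewrite /pairstep HN -/I HI Ei /= Ei feed_rest //.
    have -> : (match l with [::] => false | _ => false end) = false by case: l.
    by rewrite Hsep HI /=; case: (feed _ s).
  rewrite feed_rest //; last by rewrite -/I HI => j [<-] E; move: Ei; rewrite E Nat.eqb_refl.
  rewrite Hsep HI Ei andbF /= Ei; by case: (feed _ s).
- rewrite feed_rest //; last by rewrite -/I HI.
  rewrite Hsep HI /=; by case: (feed _ s).
- case Ei: (Nat.eqb a i).
    case: l => [|b l]; first by rewrite Hsep HI /= Ei; case: (feed _ s).
    rewrite dbl_cons -!app_comm_cons feed_pair; try lia.
    rewrite /pairstep HN -/I HI Ei /= Ei feed_rest //.
    have -> : (match l with [::] => false | _ => false end) = false by case: l.
    by rewrite Hsep HI /=; case: (feed _ s).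
  rewrite feed_rest //; last by rewrite -/I HI => j [<-] E; move: Ei; rewrite E Nat.eqb_refl.
  rewrite Hsep HI /= Ei; by case: (feed _ s).
Qed.

Lemma feed_encs pc a c res s : lt pc N -> Nat.add a c = k ->
  let I := List.nth pc code (Nop pc) in
  exists r, feed (mkq pc a None true res) (encs s a c) =
    (mkq pc k None true r, encs (fun j => eff I j (s j)) a c) /\
    (r = match target I with
         | Some i => if Nat.leb a i && Nat.ltb i k then effr I i (s i) res else res
         | None => res
         end).
Proof.
move=> Hpc; elim: c a res => [|c IH] a res Ha I /=.
  exists res; split; first by have -> : a = k by lia.
  case: (target I) => // i; case: ifP => // /andP [/Nat.leb_le H1 /Nat.ltb_lt H2]; lia.
rewrite feed_queue //; last by lia.
have [|r [-> ->]] := IH a.+1 (effr (List.nth pc code (Nop pc)) a (s a) res); first by lia.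
eexists; split; first by reflexivity.
rewrite -/I; case HI: I => [i b n|i b n|n|i l1 l0 lE]; rewrite /target /effr; try by repeat case: ifP.
case: (Nat.eqb_spec a i) => [E|E].
  rewrite -E; have -> : Nat.leb a.+1 a = false by apply/Nat.leb_gt; lia.
  have -> : Nat.leb a a by apply/Nat.leb_le; lia.
  rewrite Nat.eqb_refl; by have -> : Nat.ltb a k by apply/Nat.ltb_lt; lia.
rewrite Nat.eqb_refl; have -> // : Nat.leb a.+1 i = Nat.leb a i.
by apply/idP/idP => /Nat.leb_le H; apply/Nat.leb_le; lia.
Qed.

Lemma feed_final a c res s : Nat.add a c = k ->
  exists q, feed (mkq N a None true res) (encs s a c) =
    (q, if Nat.leb a out then s out else [::]) /\ qeop q = None.
Proof.
have HN : Nat.eqb N N by apply/Nat.eqb_eq.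
elim: c a res => [|c IH] a res Ha /=.
  exists (mkq N a None true res); split.
    have -> // : Nat.leb a out = false by apply/Nat.leb_gt; lia.
  by rewrite /= inord_val; [rewrite HN|lia].
have Hd st l s' : feed (mkq N a None st res) (app (dbl l) (false :: false :: s')) =
  let (q, m) := feed (mkq N a.+1 None true res) s' in (q, app (if Nat.eqb a out then l else [::]) m).
  elim: l st => [|b l IHl] st.
    rewrite feed_pair; try lia; rewrite /pairstep HN /=; case: (feed _ s') => q m.
    by case: ifP.
  rewrite dbl_cons -!app_comm_cons feed_pair; try lia.
  rewrite /pairstep HN IHl; case: (feed _ s') => q m; by case: ifP.
rewrite Hd.
have [|q [-> Hq]] := IH a.+1 res; first by lia.
exists q; split=> //; case: (Nat.eqb_spec a out) => [E|E].
  rewrite E; have -> : Nat.leb out.+1 out = false by apply/Nat.leb_gt; lia.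
  have -> : Nat.leb out out by apply/Nat.leb_le; lia.
  by rewrite List.app_nil_r.
by have -> : Nat.leb a.+1 out = Nat.leb a out
  by apply/idP/idP => /Nat.leb_le H; apply/Nat.leb_le; lia.
Qed.

(** One pass per instruction and a final one for decoding; an instruction lengthens the encoding by
    at most one pair, whence the bound with [2 * t]. *)
Lemma run_queues t S pc s s' : le pc N -> gorun code t (pc, s) = (N, s') ->
  le (Nat.add (length (encs s 0 k)) (Nat.mul 2 t)) S -> exists P, le P (Nat.add t 1) /\
  runs Q qstep qeop S P (mkq pc 0 None true None) (encs s 0 k) (s' out).
Proof.
have Hout (s1 : regs) : le (length (s1 out)) (length (encs s1 0 k)).
  have H a c : le a out -> lt out (Nat.add a c) -> le (length (s1 out)) (length (encs s1 a c)).
    elim: c a => [|c IH] a H1 H2 /=; first by lia.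
    rewrite !length_app dbl_length /=; case: (Nat.eq_dec a out) => [->|E]; first by lia.
    have := IH a.+1; lia.
  by apply: H; lia.
have Hend S1 s1 : le (length (encs s1 0 k)) S1 ->
    runs Q qstep qeop S1 1 (mkq N 0 None true None) (encs s1 0 k) (s1 out).
  move=> HS; have [|q [Hf Hq]] := feed_final 0 k None s1; first by lia.
  by apply: runs_end Hf Hq => //; have := Hout s1; lia.
elim: t pc s => [|t IH] pc s Hpc.
  move=> [-> ->] HS; exists 1; split; first by lia.
  by apply: Hend; lia.
move=> Hrun HS; case: (Nat.eq_dec pc N) => [E|E].
  (* The configuration is stationary at [N], so the run may be cut there. *)
  have HsS u : gorun code u (N, s) = (N, s).
    elim: u => //= u ->; rewrite /gostep /=.
    by rewrite nth_overflow; [rewrite /instr_step /=; congr pair|rewrite /N; lia].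
  move: Hrun; rewrite E HsS => - [<-]; exists 1; split; first by lia.
  by apply: Hend; lia.
have Hlt : lt pc N by lia.
have Hrun' : gorun code t (gostep code (pc, s)) = (N, s').
  by rewrite -Hrun /gorun -[Nat.iter t.+1 _ _]/(gostep code (Nat.iter t (gostep code) (pc, s))) -Nat.iter_succ
    Nat.iter_succ_r.
set I := List.nth pc code (Nop pc).
have HL := encs_step_length I s k.
have [|r [Hf Hr]] := feed_encs pc 0 k None s Hlt; first by lia.
rewrite -/I in Hf Hr.
have Hres : r = result I s.
  rewrite Hr; have := targets pc Hlt; rewrite -/I.
  case HI: I => [i b n|i b n|n|i l1 l0 lE] //= Ht; try by case: ifP.
  have Hi : lt i k by apply: Ht.
  by have -> : Nat.ltb i k; [apply/Nat.ltb_lt|rewrite Nat.eqb_refl; case: (s i)].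
have [|||P [HP HR]] := IH (next I (result I s)) (fun j => eff I j (s j)).
- exact: jumps.
- exact: Hrun'.
- lia.
exists P.+1; split; first by lia.
apply: (runs_next _ _ _ _ _ _ _ _ _ _ [::] _ _ _ Hf); last (by rewrite List.app_nil_r; exact: HR).
- lia.
- by rewrite List.app_nil_r; lia.
- rewrite /= !inord_val; try lia.
  have -> : Nat.eqb pc N = false by apply/Nat.eqb_neq.
  by rewrite -/I Hres.
Qed.

Theorem queue_machine : exists M : TM, forall w t s', gorun code t (0, load w) = (N, s') ->
  exists u, le u (Nat.mul (Nat.add t 2) (Nat.mul (Nat.add (Nat.mul 2 (length w + k + t)%coq_nat) 1)
                    (Nat.add (Nat.mul 4 (Nat.mul 2 (length w + k + t)%coq_nat)) 10))) /\
    cstate (tm_run M u w) = 1 /\ tm_output (tm_run M u w) = s' out.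
Proof.
have [M HM] := transducer_machine Q q0 W qstep qeop qstepW qeopW.
exists M => w t s' Hrun.
have Hf : feed q0 w = (q0, dbl w).
  by elim: w {Hrun} => //= b w ->.
have Hk : k = (k.-1).+1 by lia.
have Henc : encs (load w) 0 k = app (dbl w) (concat (repeat [:: false; false] k)).
  by rewrite Hk encs_load.
have Hlen : length (encs (load w) 0 k) = Nat.mul 2 (Nat.add (length w) k).
  rewrite Henc length_app dbl_length.
  have -> : length (concat (repeat [:: false; false] k)) = Nat.mul 2 k by elim: (k) => //= n ->; lia.
  lia.
have [||P [HP HR]] := run_queues t (Nat.mul 2 (Nat.add (Nat.add (length w) k) t)) 0 (load w) s' _ Hrun.
- lia.
- lia.
have HR' : runs Q qstep qeop (Nat.mul 2 (Nat.add (Nat.add (length w) k) t)) P.+1 q0 w (s' out).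
  apply: (@runs_next Q qstep qeop _ P q0 w q0 (dbl w) (mkq 0 0 None true None)
    (concat (repeat [:: false; false] k)) _ _ _ Hf) => //; rewrite -?Henc ?Hlen //; lia.
have [u [Hu [H1 H2]]] := HM _ _ _ _ HR'.
exists u; split=> //; apply: (Nat.le_trans _ _ _ Hu).
change addn with Init.Nat.add in *; change muln with Init.Nat.mul in *.
by apply: Nat.mul_le_mono_r; lia.
Qed.

End Machine.
End QueueTM.

(** * Structured programs on queues *)

Module While.
Local Open Scope nat_scope.
Import Queue.

(* [CIf i c1 c0] and [CWhile i z c1 c0] pop the queue [i] and branch on the popped bit; an empty queue counts
   as [0] for [CIf] and ends the loop for [CWhile], as does a popped [0] when [z] is set. *)
Inductive com : Type :=
| CNop
| CPush (i : nat) (b : bool)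
| CFront (i : nat) (b : bool)
| CSeq (c d : com)
| CIf (i : nat) (c1 c0 : com)
| CWhile (i : nat) (z : bool) (c1 c0 : com).

Fixpoint clen (c : com) : nat :=
  match c with
  | CNop | CPush _ _ | CFront _ _ => 1
  | CSeq c d => clen c + clen d
  | CIf _ c d | CWhile _ _ c d => 1 + clen c + clen d
  end.

(** [a] is the address of the code and [nx] the address where control continues. Every instruction
    names its successor, so a loop body is compiled with the address of the test as [nx] and no
    separate jump is emitted. *)
Fixpoint compile (c : com) (a nx : nat) : list instr :=
  match c with
  | CNop => [Nop nx]
  | CPush i b => [PushB i b nx]
  | CFront i b => [PushF i b nx]
  | CSeq c d => compile c a (a + clen c) ++ compile d (a + clen c) nx
  | CIf i c1 c0 => Pop i (S a) (S a + clen c1) (S a + clen c1) ::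
      compile c1 (S a) nx ++ compile c0 (S a + clen c1) nx
  | CWhile i z c1 c0 => Pop i (S a) (if z then nx else S a + clen c1) nx ::
      compile c1 (S a) a ++ compile c0 (S a + clen c1) a
  end.

Lemma compile_length c a nx : length (compile c a nx) = clen c.
Proof.
  revert a nx. induction c; intros a nx; simpl; auto; rewrite length_app; auto.
Qed.

Definition qs := list (list bool).
Definition getq (l : qs) (i : nat) : list bool := nth i l [].

Fixpoint setq (l : qs) (i : nat) (x : list bool) : qs :=
  match l, i with
  | [], _ => []
  | _ :: l', O => x :: l'
  | y :: l', S i' => y :: setq l' i' x
  end.

Lemma setq_length l i x : length (setq l i x) = length l.
Proof. revert i. induction l as [|y l IH]; intros [|i]; simpl; auto. Qed.

Lemma nth_setq l i x j : i < length l -> nth j (setq l i x) [] = if Nat.eqb j i then x else nth j l [].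
Proof.
  revert i j. induction l as [|y l IH]; intros [|i] [|j] H; simpl in *; try lia; auto.
  apply IH. lia.
Qed.

Fixpoint regs_below (k : nat) (c : com) : Prop :=
  match c with
  | CNop => True
  | CPush i _ | CFront i _ => i < k
  | CSeq c d => regs_below k c /\ regs_below k d
  | CIf i c d | CWhile i _ c d => i < k /\ regs_below k c /\ regs_below k d
  end.

(** The index is the exact number of queue instructions executed. *)
Inductive exec : com -> qs -> qs -> nat -> Prop :=
| ex_nop l : exec CNop l l 1
| ex_push i b l : exec (CPush i b) l (setq l i (getq l i ++ [b])) 1
| ex_front i b l : exec (CFront i b) l (setq l i (b :: getq l i)) 1
| ex_seq c d l l1 l2 t u : exec c l l1 t -> exec d l1 l2 u -> exec (CSeq c d) l l2 (t + u)
| ex_if1 i c d l l' x t : getq l i = true :: x -> exec c (setq l i x) l' t -> exec (CIf i c d) l l' (S t)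
| ex_if0 i c d l l' x t : getq l i = false :: x -> exec d (setq l i x) l' t -> exec (CIf i c d) l l' (S t)
| ex_while_nil i z c d l : getq l i = [] -> exec (CWhile i z c d) l l 1
| ex_while_end i c d l x : getq l i = false :: x -> exec (CWhile i true c d) l (setq l i x) 1
| ex_while1 i z c d l l1 l2 x t u : getq l i = true :: x -> exec c (setq l i x) l1 t ->
    exec (CWhile i z c d) l1 l2 u -> exec (CWhile i z c d) l l2 (S (t + u))
| ex_while0 i c d l l1 l2 x t u : getq l i = false :: x -> exec d (setq l i x) l1 t ->
    exec (CWhile i false c d) l1 l2 u -> exec (CWhile i false c d) l l2 (S (t + u)).

Definition toregs (l : qs) : regs := fun i => nth i l [].

Lemma exec_length c l l' t : exec c l l' t -> length l' = length l.
Proof. induction 1; rewrite ?setq_length in *; congruence. Qed.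

Definition code_at (code : list instr) (a : nat) (seg : list instr) : Prop :=
  forall i, i < length seg -> nth_error code (a + i) = nth_error seg i.

Lemma code_at_app code a s1 s2 : code_at code a (s1 ++ s2) ->
  code_at code a s1 /\ code_at code (a + length s1) s2.
Proof.
  intros H. split; intros i Hi.
  - rewrite H by (rewrite length_app; lia). now apply nth_error_app1.
  - rewrite <- Nat.add_assoc, H by (rewrite length_app; lia). rewrite nth_error_app2 by lia. f_equal. lia.
Qed.

Lemma code_at_cons code a I s : code_at code a (I :: s) ->
  (forall d, nth a code d = I) /\ code_at code (S a) s.
Proof.
  intros H. split.
  - intros d. specialize (H 0 ltac:(simpl; lia)). rewrite Nat.add_0_r in H. now apply nth_error_nth.
  - intros i Hi. assert (E := H (S i) ltac:(simpl; lia)). rewrite <- plus_n_Sm in E. exact E.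
Qed.

Lemma gorun_add code t u x : gorun code (t + u) x = gorun code u (gorun code t x).
Proof. unfold gorun. rewrite Nat.add_comm, Nat.iter_add. auto. Qed.

Lemma gorun_S code t x : gorun code (S t) x = gorun code t (gostep code x).
Proof. exact (gorun_add code 1 t x). Qed.

Lemma eff_set I l i x : i < length l ->
  (forall j, j <> i -> eff I j (nth j l []) = nth j l []) -> eff I i (getq l i) = x ->
  (fun j => eff I j (toregs l j)) = toregs (setq l i x).
Proof.
  intros Hi H1 H2. extensionality j. unfold toregs. rewrite nth_setq by auto.
  destruct (Nat.eqb_spec j i) as [->|Hn]; auto.
Qed.

Lemma step_pop code a l i l1 l0 lE x b : i < length l ->
  (forall d, nth a code d = Pop i l1 l0 lE) -> getq l i = b :: x ->
  gostep code (a, toregs l) = (if b then l1 else l0, toregs (setq l i x)).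
Proof.
  intros Hi Hc Hg. unfold gostep, instr_step. simpl fst. simpl snd. rewrite Hc. simpl next.
  unfold toregs at 1. unfold getq in Hg. rewrite Hg. simpl hd_error. f_equal.
  apply eff_set; auto.
  - intros j Hj. simpl. apply Nat.eqb_neq in Hj. now rewrite Hj.
  - simpl. rewrite Nat.eqb_refl. unfold getq. now rewrite Hg.
Qed.

(** Induction on the execution rather than on the program, so that the further rounds of a loop are
    covered by a hypothesis for the same code segment. *)
Lemma compile_correct code c l l' t : exec c l l' t -> regs_below (length l) c ->
  forall a nx, code_at code a (compile c a nx) -> gorun code t (a, toregs l) = (nx, toregs l').
Proof.
  induction 1; simpl regs_below; intros Hr a nx Hc; simpl compile in Hc.
  - apply code_at_cons in Hc. destruct Hc as [Hc _]. unfold gorun. simpl. unfold gostep. simpl. now rewrite Hc.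
  - apply code_at_cons in Hc. destruct Hc as [Hc _]. unfold gorun. simpl. unfold gostep. simpl fst. simpl snd.
    rewrite Hc.
    unfold instr_step. f_equal. apply eff_set; auto.
    + intros j Hj. simpl. apply Nat.eqb_neq in Hj. now rewrite Hj.
    + simpl. now rewrite Nat.eqb_refl.
  - apply code_at_cons in Hc. destruct Hc as [Hc _]. unfold gorun. simpl. unfold gostep. simpl fst. simpl snd.
    rewrite Hc.
    unfold instr_step. f_equal. apply eff_set; auto.
    + intros j Hj. simpl. apply Nat.eqb_neq in Hj. now rewrite Hj.
    + simpl. now rewrite Nat.eqb_refl.
  - apply code_at_app in Hc. destruct Hc as [H1 H2]. rewrite compile_length in H2. destruct Hr as [R1 R2].
    rewrite gorun_add, (IHexec1 R1 _ _ H1). apply IHexec2; auto. now rewrite (exec_length _ _ _ _ H).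
  - apply code_at_cons in Hc. destruct Hc as [Hp Hc]. apply code_at_app in Hc. destruct Hc as [H1 H2].
    destruct Hr as (R0 & R1 & R2). rewrite gorun_S, (step_pop _ _ _ _ _ _ _ _ _ R0 Hp H).
    apply IHexec; auto. now rewrite setq_length.
  - apply code_at_cons in Hc. destruct Hc as [Hp Hc]. apply code_at_app in Hc. destruct Hc as [H1 H2].
    rewrite compile_length in H2.
    destruct Hr as (R0 & R1 & R2). rewrite gorun_S, (step_pop _ _ _ _ _ _ _ _ _ R0 Hp H).
    apply IHexec; auto. now rewrite setq_length.
  - apply code_at_cons in Hc. destruct Hc as [Hp Hc]. destruct Hr as (R0 & R1 & R2).
    unfold gorun. simpl Nat.iter. unfold gostep, instr_step. simpl fst. simpl snd. rewrite Hp. simpl next.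
    unfold toregs at 1. unfold getq in H. rewrite H. simpl hd_error. f_equal.
    extensionality j. unfold toregs. simpl. destruct (Nat.eqb_spec j i) as [->|]; auto. now rewrite H.
  - apply code_at_cons in Hc. destruct Hc as [Hp Hc]. destruct Hr as (R0 & R1 & R2).
    unfold gorun. simpl Nat.iter. now rewrite (step_pop _ _ _ _ _ _ _ _ _ R0 Hp H).
  - assert (Hc' := Hc). apply code_at_cons in Hc. destruct Hc as [Hp Hc]. apply code_at_app in Hc.
    destruct Hc as [H2 H3].
    assert (Hr' := Hr). destruct Hr as (R0 & R1 & R2).
    rewrite gorun_S, (step_pop _ _ _ _ _ _ _ _ _ R0 Hp H), gorun_add. cbv iota.
    rewrite (IHexec1 ltac:(now rewrite setq_length) _ _ H2). apply IHexec2; auto.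
    simpl. now rewrite (exec_length _ _ _ _ H0), setq_length.
  - assert (Hc' := Hc). apply code_at_cons in Hc. destruct Hc as [Hp Hc]. apply code_at_app in Hc.
    destruct Hc as [H2 H3].
    rewrite compile_length in H3.
    assert (Hr' := Hr). destruct Hr as (R0 & R1 & R2).
    rewrite gorun_S, (step_pop _ _ _ _ _ _ _ _ _ R0 Hp H), gorun_add. cbv iota.
    change (S (a + clen c)) with (S a + clen c). rewrite (IHexec1 ltac:(now rewrite setq_length) _ _ H3).
    apply IHexec2; auto.
    simpl. now rewrite (exec_length _ _ _ _ H0), setq_length.
Qed.

Lemma compile_instrs k c : regs_below k c -> forall a nx I, In I (compile c a nx) ->
  (forall i, target I = Some i -> i < k) /\ forall r, next I r <= Nat.max nx (a + clen c).
Proof.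
  induction c; simpl regs_below; intros Hr a nx I HI; simpl in HI.
  - destruct HI as [<-|[]]. split; [discriminate|]. intros; simpl; lia.
  - destruct HI as [<-|[]]. split; [intros j E; injection E as <-; auto|]. intros; simpl; lia.
  - destruct HI as [<-|[]]. split; [intros j E; injection E as <-; auto|]. intros; simpl; lia.
  - destruct Hr as [R1 R2]. apply in_app_or in HI. destruct HI as [HI|HI].
    + destruct (IHc1 R1 _ _ _ HI) as [A B]. split; auto. intros r. specialize (B r). simpl. lia.
    + destruct (IHc2 R2 _ _ _ HI) as [A B]. split; auto. intros r. specialize (B r). simpl. lia.
  - destruct Hr as (R0 & R1 & R2). destruct HI as [<-|HI].
    + split; [intros j E; injection E as <-; auto|]. intros [[|]|]; simpl; lia.
    + apply in_app_or in HI. destruct HI as [HI|HI].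
      * destruct (IHc1 R1 _ _ _ HI) as [A B]. split; auto. intros r. specialize (B r). simpl. lia.
      * destruct (IHc2 R2 _ _ _ HI) as [A B]. split; auto. intros r. specialize (B r). simpl. lia.
  - destruct Hr as (R0 & R1 & R2). destruct HI as [<-|HI].
    + split; [intros j E; injection E as <-; auto|]. intros [[|]|]; destruct z; simpl; lia.
    + apply in_app_or in HI. destruct HI as [HI|HI].
      * destruct (IHc1 R1 _ _ _ HI) as [A B]. split; auto. intros r. specialize (B r). simpl. lia.
      * destruct (IHc2 R2 _ _ _ HI) as [A B]. split; auto. intros r. specialize (B r). simpl. lia.
Qed.

Theorem while_machine c k out : regs_below k c -> out < k -> exists M : TM, forall w t l',
  exec c (w :: repeat [] (k - 1)) l' t ->
  exists u, u <= (t + 2) * ((2 * (length w + k + t) + 1) * (4 * (2 * (length w + k + t)) + 10)) /\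
    cstate (tm_run M u w) = 1 /\ tm_output (tm_run M u w) = getq l' out.
Proof.
  intros Hr Hout. set (code := compile c 0 (clen c)).
  assert (Hlen : length code = clen c) by apply compile_length.
  destruct (QueueTM.queue_machine code k out) as (M & HM); [lia|auto| | |].
  - intros pc Hpc i Hi. destruct (compile_instrs k c Hr 0 (clen c) (nth pc code (Nop pc))) as [A _]; auto.
    now apply nth_In.
  - intros pc r Hpc. destruct (compile_instrs k c Hr 0 (clen c) (nth pc code (Nop pc))) as [_ A].
    + now apply nth_In.
    + specialize (A r). lia.
  - exists M. intros w t l' He.
    assert (HL : length (w :: repeat [] (k - 1)) = k) by (simpl; rewrite repeat_length; lia).
    assert (Hrun : gorun code t (0, load w) = (length code, toregs l')).
    { replace (load w) with (toregs (w :: repeat [] (k - 1))).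
      - rewrite Hlen. apply (compile_correct code c _ _ _ He); [now rewrite HL|].
        intros i Hi. auto.
      - extensionality i. unfold toregs, load. destruct i; auto. simpl.
        destruct (Nat.lt_ge_cases i (k - 1)); [now rewrite nth_repeat_lt|].
        apply nth_overflow. now rewrite repeat_length. }
    exact (HM w t (toregs l') Hrun).
Qed.

End While.

(** * The reduction as a program *)

Module Program.
Local Open Scope nat_scope.
Import While Out.

Definition does (c : com) (l l' : qs) (T : nat) : Prop := exists t, t <= T /\ exec c l l' t.

Lemma does_le c l l' T T' : T <= T' -> does c l l' T -> does c l l' T'.
Proof. intros H (t & Ht & He). exists t. split; [lia|auto]. Qed.

Lemma does_nop l : does CNop l l 1.
Proof. exists 1. split; auto. constructor. Qed.

Lemma does_push i b l : does (CPush i b) l (setq l i (getq l i ++ [b])) 1.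
Proof. exists 1. split; auto. constructor. Qed.

Lemma does_front i b l : does (CFront i b) l (setq l i (b :: getq l i)) 1.
Proof. exists 1. split; auto. constructor. Qed.

Lemma does_seq c d l l1 l2 T U : does c l l1 T -> does d l1 l2 U -> does (CSeq c d) l l2 (T + U).
Proof. intros (t & Ht & He) (u & Hu & Hf). exists (t + u). split; [lia|]. econstructor; eauto. Qed.

Lemma does_if1 i c d l l' x T : getq l i = true :: x -> does c (setq l i x) l' T -> does (CIf i c d) l l' (S T).
Proof. intros H (t & Ht & He). exists (S t). split; [lia|]. econstructor; eauto. Qed.

Lemma does_if0 i c d l l' x T : getq l i = false :: x -> does d (setq l i x) l' T -> does (CIf i c d) l l' (S
  T).
Proof. intros H (t & Ht & He). exists (S t). split; [lia|]. eapply ex_if0; eauto. Qed.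

Lemma does_while_nil i z c d l : getq l i = [] -> does (CWhile i z c d) l l 1.
Proof. intros H. exists 1. split; [lia|]. now constructor. Qed.

Lemma does_while_end i c d l x : getq l i = false :: x -> does (CWhile i true c d) l (setq l i x) 1.
Proof. intros H. exists 1. split; [lia|]. now constructor. Qed.

Lemma does_while1 i z c d l l1 l2 x T U : getq l i = true :: x -> does c (setq l i x) l1 T ->
  does (CWhile i z c d) l1 l2 U -> does (CWhile i z c d) l l2 (S (T + U)).
Proof. intros H (t & Ht & He) (u & Hu & Hf). exists (S (t + u)). split; [lia|]. eapply ex_while1; eauto. Qed.

Lemma does_while0 i c d l l1 l2 x T U : getq l i = false :: x -> does d (setq l i x) l1 T ->
  does (CWhile i false c d) l1 l2 U -> does (CWhile i false c d) l l2 (S (T + U)).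
Proof. intros H (t & Ht & He) (u & Hu & Hf). exists (S (t + u)). split; [lia|]. eapply ex_while0; eauto. Qed.

Fixpoint emit (i : nat) (w : list bool) : com :=
  match w with [] => CNop | b :: w' => CSeq (CPush i b) (emit i w') end.

Lemma setq_setq l i x y : setq (setq l i x) i y = setq l i y.
Proof. revert i. induction l as [|z l IH]; intros [|i]; simpl; auto. now rewrite IH. Qed.

Lemma getq_setq l i x : i < length l -> getq (setq l i x) i = x.
Proof. intros H. unfold getq. now rewrite nth_setq, Nat.eqb_refl. Qed.

Lemma does_emit i w l : i < length l -> does (emit i w) l (setq l i (getq l i ++ w)) (length w + 1).
Proof.
  revert l. induction w as [|b w IH]; intros l Hi.
  - replace (setq l i (getq l i ++ [])) with l; [apply does_nop|].
    rewrite app_nil_r. unfold getq. clear. revert i. induction l as [|y l IH]; intros [|i]; simpl; auto.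
    now rewrite <- IH.
  - cbn [emit length]. replace (S (length w) + 1) with (1 + (length w + 1)) by lia.
    eapply does_seq; [apply does_push|].
    specialize (IH (setq l i (getq l i ++ [b]))).
    rewrite setq_length, setq_setq, getq_setq, <- app_assoc in IH by auto.
    now apply IH.
Qed.

Definition ones (u : nat) : list bool := repeat true u.

Lemma ones_S_r u : ones u ++ [true] = ones (S u).
Proof. unfold ones. rewrite <- repeat_cons. reflexivity. Qed.

Lemma ones_app u v : ones (u + v) = ones u ++ ones v.
Proof. apply repeat_app. Qed.

(* Loops over a queue [r] holding a unary number; [St n q] is the state after [n] iterations of the body, the
   queue [r] containing [q]. *)
Section Loops.
Variables (r : nat) (c : com) (T : nat) (St : nat -> list bool -> qs).
Hypothesis Hget : forall n q, getq (St n q) r = q.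
Hypothesis Hset : forall n q q', setq (St n q) r q' = St n q'.
Hypothesis Hbody : forall n q, does c (St n q) (St (S n) q) T.

Lemma consume_loop u rest n :
  does (CWhile r true c CNop) (St n (ones u ++ false :: rest)) (St (u + n) rest) (u * (T + 1) + 1).
Proof.
  revert n. induction u as [|u IH]; intros n.
  - cbn [Nat.add]. rewrite <- (Hset n (ones 0 ++ false :: rest) rest).
    eapply does_le; [|eapply does_while_end]; [lia|]. now rewrite Hget.
  - eapply does_le; [|eapply does_while1; [rewrite Hget; reflexivity|rewrite Hset; apply Hbody|]].
    2:{ replace (S u + n) with (u + S n) by lia. apply IH. }
    simpl. lia.
Qed.

(** Each popped [true] is pushed behind the end mark, so the counter is restored when the mark comes
    up and can be used again. *)
Definition rotate : com := CSeq (CWhile r true (CSeq (CPush r true) c) CNop) (CPush r false).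

Lemma rotate_loop u : does rotate (St 0 (ones u ++ [false])) (St u (ones u ++ [false])) (u * (T + 2) + 3).
Proof.
  assert (H : forall u v n, does (CWhile r true (CSeq (CPush r true) c) CNop)
     (St n (ones u ++ false :: ones v)) (St (u + n) (ones (u + v))) (u * (T + 2) + 1)).
  { clear u. induction u as [|u IH]; intros v n.
    - cbn [Nat.add]. rewrite <- (Hset n (ones 0 ++ false :: ones v) (ones v)).
      eapply does_le; [|eapply does_while_end]; [lia|]. now rewrite Hget.
    - eapply does_le; [|eapply does_while1; [rewrite Hget; reflexivity| |]].
      2:{ rewrite Hset. eapply does_seq; [apply does_push|]. rewrite Hget, Hset. apply Hbody. }
      2:{ rewrite <- app_assoc. cbn [app]. rewrite ones_S_r.
          replace (S u + n) with (u + S n) by lia. replace (S u + v) with (u + S v) by lia. apply IH. }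
      simpl. lia. }
  unfold rotate. apply (does_le _ _ _ (u * (T + 2) + 1 + 1)); [lia|].
  eapply does_seq; [apply (H u 0 0)|]. rewrite !Nat.add_0_r.
  assert (E := does_push r false (St u (ones u))). rewrite Hget, Hset in E. exact E.
Qed.

End Loops.

(** Queues: 0 input, 1 output, 2 stack of the parser, 3, 5 and 6 copies of a unary counter, 4 copy
    of the input, 7 the unary number [B]. *)
Definition st (i o s x p y z b : list bool) : qs := [i; o; s; x; p; y; z; b].

Lemma does_emit_out w i o s x p y z b : does (emit 1 w) (st i o s x p y z b) (st i (o ++ w) s x p y z b)
  (length w + 1).
Proof. apply (does_emit 1 w (st i o s x p y z b)). simpl. lia. Qed.

Definition count : com :=
  CWhile 0 false
    (CSeq (CPush 4 true) (CSeq (CPush 3 true) (CSeq (CPush 5 true) (CPush 6 true))))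
    (CSeq (CPush 4 false) (CSeq (CPush 3 true) (CSeq (CPush 5 true) (CPush 6 true)))).

Lemma does_count w o s p b u : does count (st w o s (ones u) p (ones u) (ones u) b)
  (st [] o s (ones (u + length w)) (p ++ w) (ones (u + length w)) (ones (u + length w)) b) (5 * length w + 1).
Proof.
  revert p u. induction w as [|a w IH]; intros p u.
  - rewrite Nat.add_0_r, app_nil_r. eapply does_while_nil. reflexivity.
  - specialize (IH (p ++ [a]) (S u)). rewrite <- app_assoc in IH. cbn [app] in IH.
    replace (S u + length w) with (u + length (a :: w)) in IH by (simpl; lia).
    apply (does_le _ _ _ (S (4 + (5 * length w + 1)))); [simpl; lia|].
    assert (Hb : does (CSeq (CPush 4 a) (CSeq (CPush 3 true) (CSeq (CPush 5 true) (CPush 6 true))))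
      (st w o s (ones u) p (ones u) (ones u) b) (st w o s (ones (S u)) (p ++ [a]) (ones (S u)) (ones (S u)) b)
        4).
    { rewrite <- ones_S_r. apply (does_seq _ _ _ _ _ 1 3 (does_push _ _ _)).
      apply (does_seq _ _ _ _ _ 1 2 (does_push _ _ _)). apply (does_seq _ _ _ _ _ 1 1 (does_push _ _ _)).
      apply does_push. }
    destruct a.
    + eapply does_while1; [reflexivity|apply Hb|apply IH].
    + eapply does_while0; [reflexivity|apply Hb|apply IH].
Qed.

(** Three nested loops, each over its own copy of the counter; the inner two have to restore theirs,
    the outermost may consume it. Unary arithmetic is affordable because [B] is polynomial in the
    input length. *)
Definition cube : com :=
  CWhile 3 true (rotate 5 (rotate 6 (CPush 7 true))) CNop.

Lemma does_cube a i o s p : does cube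
  (st i o s (ones a ++ [false]) p (ones a ++ [false]) (ones a ++ [false]) [])
  (st i o s [] p (ones a ++ [false]) (ones a ++ [false]) (ones (a * (a * a))))
  (a * ((a * ((a * (1 + 2) + 3) + 2) + 3) + 1) + 1).
Proof.
  assert (H1 : forall x y n, does (rotate 6 (CPush 7 true))
    (st i o s x p y (ones a ++ [false]) (ones n)) (st i o s x p y (ones a ++ [false]) (ones (a + n))) (a * (1 +
      2) + 3)).
  { intros x y n. apply (rotate_loop 6 (CPush 7 true) 1 (fun u q => st i o s x p y q (ones (u + n)))); auto.
    intros u q. cbn [Nat.add]. rewrite <- ones_S_r. apply does_push. }
  assert (H2 : forall x n, does (rotate 5 (rotate 6 (CPush 7 true)))
    (st i o s x p (ones a ++ [false]) (ones a ++ [false]) (ones n))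
    (st i o s x p (ones a ++ [false]) (ones a ++ [false]) (ones (a * a + n))) (a * ((a * (1 + 2) + 3) + 2) +
      3)).
  { intros x n. apply (rotate_loop 5 (rotate 6 (CPush 7 true)) _ (fun u q => st i o s x p q (ones a ++ [false])
    (ones (u * a + n)))); auto.
    intros u q. replace (S u * a + n) with (a + (u * a + n)) by lia. apply H1. }
  assert (H3 := consume_loop 3 (rotate 5 (rotate 6 (CPush 7 true))) (a * ((a * (1 + 2) + 3) + 2) + 3)
    (fun u q => st i o s q p (ones a ++ [false]) (ones a ++ [false]) (ones (u * (a * a))))
    (fun _ _ => eq_refl) (fun _ _ _ => eq_refl)).
  specialize (H3 ltac:(intros n q; apply H2) a [] 0). rewrite Nat.add_0_r in H3. exact H3.
Qed.

Inductive titem := Lit (w : list bool) | Ones.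

(* [Ones] stands for the unary number [3 * j], where the queue 7 holds [j]. *)
Definition titem_out (j : nat) (it : titem) : list bool :=
  match it with Lit w => w | Ones => ones (3 * j) end.

Definition tout (j : nat) (its : list titem) : list bool := flat_map (titem_out j) its.

Definition emit_ones : com := rotate 7 (emit 1 [true; true; true]).

Fixpoint tmpl (its : list titem) : com :=
  match its with
  | [] => CNop
  | Lit w :: its' => CSeq (emit 1 w) (tmpl its')
  | Ones :: its' => CSeq emit_ones (tmpl its')
  end.

Fixpoint tcost (j : nat) (its : list titem) : nat :=
  match its with
  | [] => 1
  | Lit w :: its' => length w + 1 + tcost j its'
  | Ones :: its' => j * 6 + 3 + tcost j its'
  end.

Lemma does_emit_ones j i o s x p y z : does emit_ones
  (st i o s x p y z (ones j ++ [false])) (st i (o ++ ones (3 * j)) s x p y z (ones j ++ [false])) (j * 6 + 3).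
Proof.
  set (St := fun u q => st i (o ++ ones (3 * u)) s x p y z q).
  assert (Hb : forall n q, does (emit 1 [true; true; true]) (St n q) (St (S n) q) 4).
  { intros n q. unfold St. replace (3 * S n) with (3 * n + 3) by lia. rewrite ones_app, app_assoc.
  apply does_emit_out. }
  assert (H := rotate_loop 7 (emit 1 [true; true; true]) 4 St (fun _ _ => eq_refl) (fun _ _ _ => eq_refl) Hb j).
  unfold St in H at 1. change (ones (3 * 0)) with (@nil bool) in H. rewrite app_nil_r in H. exact H.
Qed.

Lemma does_tmpl its j i o s x p y z : does (tmpl its)
  (st i o s x p y z (ones j ++ [false])) (st i (o ++ tout j its) s x p y z (ones j ++ [false])) (tcost j its).
Proof.
  revert o. induction its as [|[w|] its IH]; intros o; cbn [tmpl tcost tout flat_map titem_out].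
  - rewrite app_nil_r. apply does_nop.
  - rewrite app_assoc. eapply does_seq; [apply does_emit_out|apply IH].
  - rewrite app_assoc. eapply does_seq; [apply does_emit_ones|apply IH].
Qed.

(** Variable indices are encoded in unary, so [3 * j + r] is written as two runs of ones. *)
Definition tvar (r : nat) : list titem := [Lit [false; false; true]; Ones; Lit (ones r ++ [false])].

Definition teq (s t : list titem) : list titem :=
  Lit [false; true] :: Lit [false; false] :: s ++ t ++ Lit [false; false] :: t ++ s.

Definition tinit : list titem :=
  Lit [false; true] :: Lit [false; true] ::
  teq (Lit [false; true; true] :: tvar 1 ++ tvar 1) [Lit (enc_term (TConst 1))] ++
  teq (tvar 2) [Lit (enc_term (TX 1))].

Definition tblock : list titem :=
  Lit [false; true] :: Lit [false; true] ::
  teq (tvar 1) (Lit [true; false; false] :: tvar 4 ++ tvar 4) ++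
  teq (tvar 2) (Lit [true; false; false] :: tvar 5 ++ tvar 5).

Lemma tout_app j a b : tout j (a ++ b) = tout j a ++ tout j b.
Proof. apply flat_map_app. Qed.

Lemma tout_var j r : tout j (tvar r) = enc_term (TX (3 * j + r)).
Proof.
  cbn [tvar tout flat_map titem_out enc_term]. unfold enc_nat. rewrite repeat_app, app_nil_r, <- app_assoc.
  reflexivity.
Qed.

Lemma tout_cons j w its : tout j (Lit w :: its) = w ++ tout j its.
Proof. reflexivity. Qed.

Lemma tout_eq j s t s' t' : tout j s = enc_term s' -> tout j t = enc_term t' ->
  tout j (teq s t) = enc_fml (eqf s' t').
Proof.
  intros Hs Ht. unfold teq. rewrite !tout_cons, !tout_app, tout_cons, tout_app, Hs, Ht.
  cbn [enc_fml eqf]. rewrite <- !app_assoc. reflexivity.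
Qed.

Lemma tout_init B : tout B tinit = [false; true] ++ enc_fml (init B).
Proof.
  unfold tinit. rewrite !tout_cons, tout_app.
  rewrite (tout_eq B _ _ (TAdd (TX (3 * B + 1)) (TX (3 * B + 1))) (TConst 1)), (tout_eq B _ _ (TX (3 * B + 2))
    (TX 1)); auto.
  - apply tout_var.
  - rewrite tout_cons, tout_app, tout_var. reflexivity.
Qed.

Lemma tout_block j : tout j tblock = [false; true] ++ enc_fml (block j).
Proof.
  unfold tblock. rewrite !tout_cons, tout_app.
  rewrite (tout_eq j _ _ (TX (3 * j + 1)) (TMul (TX (3 * j + 4)) (TX (3 * j + 4)))),
    (tout_eq j _ _ (TX (3 * j + 2)) (TMul (TX (3 * j + 5)) (TX (3 * j + 5)))); auto; try apply tout_var.
  - rewrite tout_cons, tout_app, tout_var. reflexivity.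
  - rewrite tout_cons, tout_app, tout_var. reflexivity.
Qed.

Fixpoint chain_enc (j : nat) : list bool :=
  match j with O => [] | S j' => [false; true] ++ enc_fml (block j') ++ chain_enc j' end.

Lemma chain_enc_eq j g : enc_fml (chain j g) = chain_enc j ++ enc_fml g.
Proof.
  induction j as [|j IH]; auto. cbn [chain enc_fml chain_enc]. rewrite IH, <- !app_assoc. reflexivity.
Qed.

(** Popping before the body leaves [B - 1], ..., 0 in queue 7, the block indices in the order in
    which [chain] nests them. *)
Definition emit_chain : com := CWhile 7 true (tmpl tblock) CNop.

Lemma tcost_block j : tcost j tblock <= 300 * (j + 1).
Proof. cbn -[Nat.mul]. lia. Qed.

Lemma tcost_init j : tcost j tinit <= 300 * (j + 1).
Proof. cbn -[Nat.mul]. lia. Qed.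

Lemma does_emit_chain B i o s x p y z : does emit_chain
  (st i o s x p y z (ones B ++ [false])) (st i (o ++ chain_enc B) s x p y z []) (B * (300 * (B + 1)) + B + 1).
Proof.
  revert o. induction B as [|B IH]; intros o.
  - cbn [chain_enc]. rewrite app_nil_r.
    apply (does_while_end 7 (tmpl tblock) CNop (st i o s x p y z [false]) []). reflexivity.
  - specialize (IH (o ++ [false; true] ++ enc_fml (block B))). rewrite <- !app_assoc in IH.
    apply (does_le _ _ _ (S (300 * (B + 1) + (B * (300 * (B + 1)) + B + 1)))); [nia|].
    eapply does_while1; [reflexivity| |apply IH].
    rewrite <- tout_block. eapply does_le; [apply tcost_block|]. apply does_tmpl.
Qed.

(** A stack entry is [true], which keeps the parsing loop going, followed by the category: [true]
    for a term, [false] for a formula. *)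
Definition push_item (k : bool) : com := CSeq (CFront 2 k) (CFront 2 true).

Lemma does_push_item k i o s x p y z b :
  does (push_item k) (st i o s x p y z b) (st i o (true :: k :: s) x p y z b) 2.
Proof. exact (does_seq _ _ _ _ _ 1 1 (does_front 2 k _) (does_front 2 true _)). Qed.

Definition leaf_prefix (b : bool) : list bool :=
  if b then [true; false; false] ++ enc_term neg1 else [].

Definition le_string (b : bool) : list bool :=
  [false; false] ++ [false; true; true] ++ enc_term (if b then TX 2 else TMul neg1 (TX 1)).

Definition copy_unary (w : list bool) : com :=
  CSeq (CWhile 4 true (emit 1 w) CNop) (emit 1 [false]).

Definition copy_bit : com := CIf 4 (CPush 1 true) (CPush 1 false).

Definition copy_int : com :=
  CSeq (CWhile 4 true (CSeq (CPush 1 true) copy_bit) CNop) (CSeq (CPush 1 false) copy_bit).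

Definition push_two (k : bool) : com := CSeq (push_item k) (push_item k).

(** The encoding is in Polish notation, so a stack of the syntactic categories still expected
    suffices for parsing. The polarity [b] is the same for all parts of a formula and is therefore
    kept in the program, not on the stack. *)
Definition parse_term (b : bool) : com :=
  CIf 4
    (CIf 4 CNop (CIf 4 CNop (CSeq (emit 1 (leaf_prefix b ++ [true; false; false])) (push_two true))))
    (CIf 4
      (CIf 4
        (CSeq (emit 1 [false; true; true]) (push_two true))
        (CSeq (emit 1 (leaf_prefix b ++ [false; true; false])) (copy_unary [true])))
      (CIf 4
        (CSeq (emit 1 (leaf_prefix b ++ [false; false; true])) (copy_unary [true; true; true]))
        (CSeq (emit 1 (leaf_prefix b ++ [false; false; false])) copy_int))).

Definition parse_fml (b : bool) : com :=
  CIf 4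
    (CIf 4 CNop (CSeq (emit 1 (if b then [false; true] else [true; false])) (push_two false)))
    (CIf 4
      (CSeq (emit 1 (if b then [true; false] else [false; true])) (push_two false))
      (CSeq (emit 1 (le_string b)) (push_two true))).

Definition parse_loop (b : bool) : com := CWhile 2 true (CIf 2 (parse_term b) (parse_fml b)) CNop.

Definition parse (b : bool) : com := CSeq (push_item false) (parse_loop b).

Inductive item := IF (f : qff_le) | IT (t : term).

Definition kind (it : item) : bool := match it with IF _ => false | IT _ => true end.
Definition ienc (it : item) : list bool := match it with IF f => enc_fml f | IT t => enc_term t end.
Definition iout (b : bool) (it : item) : list bool :=
  match it with IF f => enc_fml (ftr b f) | IT t => enc_term (ttr b t) end.

Lemma does_copy_bit c rest i o s x y z b :
  does copy_bit (st i o s x (c :: rest) y z b) (st i (o ++ [c]) s x rest y z b) 2.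
Proof.
  destruct c; [eapply does_if1|eapply does_if0]; try reflexivity; apply does_push.
Qed.

(** Sign and digits are alike pairs [true b], closed by [false false], so an integer can be copied
    without telling them apart. *)
Lemma enc_Z_pairs c : exists bs, enc_Z c = flat_map (fun b => [true; b]) bs ++ [false; false].
Proof.
  assert (H : forall p, exists bs, enc_pos p = flat_map (fun b => [true; b]) bs ++ [false; false]).
  { induction p as [p (bs & IH)|p (bs & IH)|].
    - exists (true :: bs). simpl. now rewrite IH.
    - exists (false :: bs). simpl. now rewrite IH.
    - exists []. reflexivity. }
  destruct c as [|p|p].
  - exists []. reflexivity.
  - destruct (H p) as (bs & E). exists (false :: bs). simpl. now rewrite E.
  - destruct (H p) as (bs & E). exists (true :: bs). simpl. now rewrite E.
Qed.

Lemma does_copy_int c rest i o s x y z b :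
  does copy_int (st i o s x (enc_Z c ++ rest) y z b) (st i (o ++ enc_Z c) s x rest y z b) (4 * length (enc_Z c)
    + 4).
Proof.
  destruct (enc_Z_pairs c) as (bs & E). rewrite E. rewrite <- app_assoc. cbn [app].
  assert (H : forall bs o, does (CWhile 4 true (CSeq (CPush 1 true) copy_bit) CNop)
     (st i o s x (flat_map (fun b => [true; b]) bs ++ false :: false :: rest) y z b)
     (st i (o ++ flat_map (fun b => [true; b]) bs) s x (false :: rest) y z b) (4 * length bs + 1)).
  { clear. induction bs as [|a bs IH]; intros o.
    - cbn [flat_map]. rewrite app_nil_r.
      apply (does_while_end 4 _ CNop (st i o s x (false :: false :: rest) y z b)). reflexivity.
    - cbn [flat_map app]. specialize (IH ((o ++ [true]) ++ [a])). rewrite <- !app_assoc in IH. cbn [app] in IH.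
      apply (does_le _ _ _ (S (3 + (4 * length bs + 1)))); [simpl; lia|].
      eapply does_while1; [reflexivity| |apply IH].
      apply (does_seq _ _ _ _ _ 1 2 (does_push _ _ _)). cbn [setq getq nth st].
      assert (Hc := does_copy_bit a (flat_map (fun b => [true; b]) bs ++ false :: false :: rest) i (o ++
        [true]) s x y z b).
      rewrite <- app_assoc in Hc. exact Hc. }
  apply (does_le _ _ _ (4 * length bs + 1 + (1 + 2))).
  { rewrite length_app. assert (length (flat_map (fun b => [true; b]) bs) = 2 * length bs).
    { clear. induction bs as [|a bs IH]; simpl; lia. }
    simpl. lia. }
  eapply does_seq; [apply H|].
  apply (does_seq _ _ _ _ _ 1 2 (does_push _ _ _)). cbn [setq getq nth st].
  assert (Hc := does_copy_bit false rest i ((o ++ flat_map (fun b => [true; b]) bs) ++ [false]) s x y z b).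
  rewrite <- !app_assoc in Hc. rewrite <- !app_assoc. exact Hc.
Qed.

Lemma does_copy_unary w n rest i o s x y z b :
  does (copy_unary w) (st i o s x (enc_nat n ++ rest) y z b)
    (st i (o ++ concat (repeat w n) ++ [false]) s x rest y z b) (n * (length w + 2) + 3).
Proof.
  assert (H : forall o, does (CWhile 4 true (emit 1 w) CNop)
     (st i o s x (enc_nat n ++ rest) y z b) (st i (o ++ concat (repeat w n)) s x rest y z b) (n * (length w +
       2) + 1)).
  { unfold enc_nat. rewrite <- app_assoc. cbn [app]. induction n as [|n IH]; intros o'.
    - cbn [repeat concat]. rewrite app_nil_r.
      apply (does_while_end 4 _ CNop (st i o' s x (false :: rest) y z b)). reflexivity.
    - cbn [repeat concat app]. rewrite app_assoc.
      apply (does_le _ _ _ (S ((length w + 1) + (n * (length w + 2) + 1)))); [simpl; lia|].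
      eapply does_while1; [reflexivity|apply does_emit_out|apply IH]. }
  apply (does_le _ _ _ ((n * (length w + 2) + 1) + 2)); [lia|].
  rewrite app_assoc. eapply does_seq; [apply H|]. apply (does_emit_out [false]).
Qed.

Lemma does_push_two k i o s x p y z b :
  does (push_two k) (st i o s x p y z b) (st i o (true :: k :: true :: k :: s) x p y z b) 4.
Proof. exact (does_seq _ _ _ _ _ 2 2 (does_push_item k i o s x p y z b) (does_push_item k i o (true :: k :: s)
  x p y z b)). Qed.

Lemma concat_repeat1 w n : concat (repeat (repeat true w) n) = repeat true (w * n).
Proof.
  induction n as [|n IH]; simpl; [now rewrite Nat.mul_0_r|]. rewrite IH, <- repeat_app. f_equal. lia.
Qed.

Lemma leaf_prefix_length b : length (leaf_prefix b) <= 10.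
Proof. destruct b; simpl; lia. Qed.

Lemma le_string_length b : length (le_string b) <= 20.
Proof. destruct b; simpl; lia. Qed.

Ltac popbit := first [eapply does_if1; [reflexivity|] | eapply does_if0; [reflexivity|]]; cbn [setq st].

Ltac simp_len := cbn [flat_map ienc enc_fml enc_term app length]; unfold enc_nat; rewrite ?length_app,
  ?repeat_length; cbn [length]; lia.

(** Induction on the remaining encoded length: an iteration consumes a leaf, or strips a tag and
    stacks the two children. The rate of 40 steps per consumed bit covers every case. *)
Lemma does_parse_loop bb its : forall i o x y z b rest,
  does (parse_loop bb) (st i o (flat_map (fun it => [true; kind it]) its) x (flat_map ienc its ++ rest) y z b)
    (st i (o ++ flat_map (iout bb) its) [] x rest y z b) (40 * length (flat_map ienc its) + 1).
Proof.
  remember (length (flat_map ienc its)) as N eqn:HN. revert its HN.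
  induction N as [N IH] using (well_founded_induction lt_wf). intros its HN i o x y z b rest.
  destruct its as [|it its].
  { cbn [flat_map app]. rewrite app_nil_r. eapply does_le; [|apply does_while_nil; reflexivity]. lia. }
  assert (Hp := leaf_prefix_length bb).
  (* one iteration replaces the first item by [its'] after emitting [w] *)
  assert (Hstep : forall its' w cost, length (flat_map ienc its') < length (ienc it) ->
    cost + 1 <= 40 * (length (ienc it) - length (flat_map ienc its')) ->
    iout bb it = w ++ flat_map (iout bb) its' ->
    does (CIf 2 (parse_term bb) (parse_fml bb))
      (st i o (kind it :: flat_map (fun it => [true; kind it]) its) x (ienc it ++ flat_map ienc its ++ rest) y
        z b)
      (st i (o ++ w) (flat_map (fun it => [true; kind it]) (its' ++ its)) x (flat_map ienc (its' ++ its) ++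
        rest) y z b) cost ->
    does (parse_loop bb) (st i o (flat_map (fun it => [true; kind it]) (it :: its)) x (flat_map ienc (it ::
      its) ++ rest) y z b)
      (st i (o ++ flat_map (iout bb) (it :: its)) [] x rest y z b) (40 * N + 1)).
  { intros its' w cost Hlt0 Hcost0 Ho Hd.
    assert (EN : N = length (ienc it) + length (flat_map ienc its)) by (rewrite HN; cbn [flat_map]; apply
      length_app).
    assert (EN' : length (flat_map ienc (its' ++ its)) = length (flat_map ienc its') + length (flat_map ienc
      its))
      by (rewrite flat_map_app; apply length_app).
    assert (Hlt : length (flat_map ienc (its' ++ its)) < N) by lia.
    assert (Hcost : cost + 1 <= 40 * (N - length (flat_map ienc (its' ++ its)))) by lia.
    apply (does_le _ _ _ (S (cost + (40 * length (flat_map ienc (its' ++ its)) + 1)))); [lia|].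
    unfold parse_loop. eapply does_while1; [reflexivity| |].
    - cbn [setq st flat_map app]. rewrite <- app_assoc. apply Hd.
    - cbn [flat_map]. rewrite Ho. rewrite <- app_assoc, <- flat_map_app, app_assoc. eapply IH; auto. }
  destruct it as [[s t|f g|f g]|[c|k|j|s t|s t]].
  - apply (Hstep [IT s; IT t] (le_string bb) (3 + (length (le_string bb) + 1) + 4)).
    + simp_len.
    + pose proof (le_string_length bb). simp_len.
    + cbn [iout ftr enc_fml ttr enc_term flat_map app]. unfold le_string.
      destruct bb; cbn [enc_fml enc_term]; rewrite <- ?app_assoc, ?app_nil_r; reflexivity.
    + cbn [kind ienc enc_fml app]. apply (does_le _ _ _ (S (S (S (length (le_string bb) + 1 + 4))))); [lia|].
      popbit. popbit. popbit. eapply does_seq; [apply does_emit_out|].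
      cbn [flat_map ienc]. rewrite <- !app_assoc. apply does_push_two.
  - apply (Hstep [IF f; IF g] (if bb then [true; false] else [false; true]) 10).
    + simp_len.
    + simp_len.
    + cbn [iout ftr flat_map]. destruct bb; cbn [enc_fml]; rewrite ?app_nil_r; reflexivity.
    + cbn [kind ienc enc_fml app].
      apply (does_le _ _ _ (S (S (S (length (if bb then [true; false] else [false; true]) + 1 + 4)))));
        [destruct bb; simpl; lia|].
      popbit. popbit. popbit. eapply does_seq; [apply does_emit_out|].
      cbn [flat_map ienc]. rewrite <- !app_assoc. apply does_push_two.
  - apply (Hstep [IF f; IF g] (if bb then [false; true] else [true; false]) 10).
    + simp_len.
    + simp_len.
    + cbn [iout ftr flat_map]. destruct bb; cbn [enc_fml]; rewrite ?app_nil_r; reflexivity.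
    + cbn [kind ienc enc_fml app].
      apply (does_le _ _ _ (S (S (S (length (if bb then [false; true] else [true; false]) + 1 + 4)))));
        [destruct bb; simpl; lia|].
      popbit. popbit. popbit. eapply does_seq; [apply does_emit_out|].
      cbn [flat_map ienc]. rewrite <- !app_assoc. apply does_push_two.
  - apply (Hstep [] ((leaf_prefix bb ++ [false; false; false]) ++ enc_Z c) (4 + 14 + (4 * length (enc_Z c) +
      4))).
    + simp_len.
    + simp_len.
    + cbn [iout ttr flat_map]. unfold leaf_prefix.
      destruct bb; cbn [enc_term app]; rewrite <- ?app_assoc, ?app_nil_r; reflexivity.
    + cbn [kind ienc enc_term app].
      apply (does_le _ _ _ (S (S (S (S (length (leaf_prefix bb ++ [false; false; false]) + 1 + (4 * length
        (enc_Z c) + 4))))))).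
      { rewrite length_app. simpl length at 2. lia. }
      popbit. popbit. popbit. popbit. eapply does_seq; [apply does_emit_out|].
      rewrite (app_assoc o (leaf_prefix bb ++ _) _). apply does_copy_int.
  - apply (Hstep [] ((leaf_prefix bb ++ [false; false; true]) ++ concat (repeat [true; true; true] k) ++
      [false]) (4 + 14 + (k * 5 + 3))).
    + simp_len.
    + unfold enc_nat. simp_len.
    + cbn [iout ttr flat_map]. rewrite (concat_repeat1 3). unfold leaf_prefix.
      destruct bb; cbn [enc_term app]; rewrite <- ?app_assoc, ?app_nil_r; reflexivity.
    + cbn [kind ienc enc_term app].
      apply (does_le _ _ _ (S (S (S (S (length (leaf_prefix bb ++ [false; false; true]) + 1 + (k * 5 + 3))))))).
      { rewrite length_app. simpl length at 2. lia. }
      popbit. popbit. popbit. popbit. eapply does_seq; [apply does_emit_out|].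
      rewrite (app_assoc o (leaf_prefix bb ++ _) _). apply (does_copy_unary [true; true; true]).
  - apply (Hstep [] ((leaf_prefix bb ++ [false; true; false]) ++ concat (repeat [true] j) ++ [false]) (4 + 14 +
      (j * 3 + 3))).
    + simp_len.
    + unfold enc_nat. simp_len.
    + cbn [iout ttr flat_map]. rewrite (concat_repeat1 1), Nat.mul_1_l. unfold leaf_prefix.
      destruct bb; cbn [enc_term app]; rewrite <- ?app_assoc, ?app_nil_r; reflexivity.
    + cbn [kind ienc enc_term app].
      apply (does_le _ _ _ (S (S (S (S (length (leaf_prefix bb ++ [false; true; false]) + 1 + (j * 3 + 3))))))).
      { rewrite length_app. simpl length at 2. lia. }
      popbit. popbit. popbit. popbit. eapply does_seq; [apply does_emit_out|].
      rewrite (app_assoc o (leaf_prefix bb ++ _) _). apply (does_copy_unary [true]).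
  - apply (Hstep [IT s; IT t] [false; true; true] 12).
    + simp_len.
    + simp_len.
    + cbn [iout ttr flat_map enc_term]. rewrite ?app_nil_r; reflexivity.
    + cbn [kind ienc enc_term app]. apply (does_le _ _ _ (S (S (S (S (4 + 4)))))); [lia|].
      popbit. popbit. popbit. popbit. eapply does_seq; [apply does_emit_out|].
      cbn [flat_map ienc]. rewrite <- !app_assoc. apply does_push_two.
  - apply (Hstep [IT s; IT t] (leaf_prefix bb ++ [true; false; false]) (4 + 14 + 4)).
    + simp_len.
    + simp_len.
    + cbn [iout ttr flat_map]. unfold leaf_prefix.
      destruct bb; cbn [enc_term app]; rewrite <- ?app_assoc, ?app_nil_r; reflexivity.
    + cbn [kind ienc enc_term app].
      apply (does_le _ _ _ (S (S (S (S (length (leaf_prefix bb ++ [true; false; false]) + 1 + 4)))))).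
      { rewrite length_app. simpl length at 2. lia. }
      popbit. popbit. popbit. popbit. eapply does_seq; [apply does_emit_out|].
      cbn [flat_map ienc]. rewrite <- !app_assoc. apply does_push_two.
Qed.

Lemma does_parse bb f rest i o x y z b :
  does (parse bb) (st i o [] x (enc_fml f ++ rest) y z b)
    (st i (o ++ enc_fml (ftr bb f)) [] x rest y z b) (40 * length (enc_fml f) + 3).
Proof.
  apply (does_le _ _ _ (2 + (40 * length (enc_fml f) + 1))); [lia|].
  eapply does_seq; [apply does_push_item|].
  assert (H := does_parse_loop bb [IF f] i o x y z b rest). cbn [flat_map ienc iout kind app] in H.
  rewrite !app_nil_r in H. exact H.
Qed.

(** The number of [X] variables changes, so [n] is dropped from queue 4, whereas [m] is copied.
    Appending four ones and an end mark to the counters turns the length [l] into [l + 4], the base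
    of the cube [B]. *)
Definition program : com :=
  CSeq count (CSeq (emit 3 [true; true; true; true; false]) (CSeq (emit 5 [true; true; true; true; false])
  (CSeq (emit 6 [true; true; true; true; false]) (CSeq cube (CSeq (CPush 7 false)
  (CSeq emit_ones (CSeq (emit 1 [true; true; true; false]) (CSeq (CWhile 4 true CNop CNop)
  (CSeq (copy_unary [true]) (CSeq (tmpl tinit) (CSeq emit_chain (CSeq (emit 1 [true; false])
  (CSeq (parse true) (parse false)))))))))))))).

Definition prog_time (a : nat) : nat :=
  (a * ((a * ((a * (1 + 2) + 3) + 2) + 3) + 1) + 1) +
  (a ^ 3 * (300 * (a ^ 3 + 1)) + a ^ 3 + 1) + 306 * (a ^ 3 + 1) + 90 * a + 100.

Lemma does_program n m Psi Phi l B : l = length (enc_input n m Psi Phi) -> B = (l + 4) ^ 3 ->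
  exists l', does program (st (enc_input n m Psi Phi) [] [] [] [] [] [] []) l' (prog_time (l + 4)) /\
    getq l' 1 = enc_sentence (3 * S B) m (output B Psi Phi).
Proof.
  intros Hl HB. set (w := enc_input n m Psi Phi) in *. set (a := l + 4) in *.
  assert (HB' : a * (a * a) = B) by (rewrite HB; simpl; lia).
  set (on := ones a ++ [false]).
  set (o1 := ones (3 * B) ++ [true; true; true; false]).
  set (o2 := o1 ++ concat (repeat [true] m) ++ [false]).
  set (o3 := o2 ++ tout B tinit). set (o4 := o3 ++ chain_enc B). set (o5 := o4 ++ [true; false]).
  set (o6 := o5 ++ enc_fml (ftr true Psi)). set (o7 := o6 ++ enc_fml (ftr false Phi)).
  assert (Hw : w = enc_nat n ++ enc_nat m ++ enc_fml Psi ++ enc_fml Phi ++ []) by (rewrite app_nil_r;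
    reflexivity).
  assert (Hlen : l = n + 1 + (m + 1) + length (enc_fml Psi) + length (enc_fml Phi)).
  { rewrite Hl. unfold w, enc_input, enc_nat. rewrite !length_app, !repeat_length. simpl. lia. }
  assert (Ha : ones l ++ [true; true; true; true; false] = on).
  { unfold on, a. rewrite ones_app, <- app_assoc. reflexivity. }
  exists (st [] o7 [] [] [] on on []). split.
  - apply (does_le _ _ _ ((5 * l + 1) + (6 + (6 + (6 + ((a * ((a * ((a * (1 + 2) + 3) + 2) + 3) + 1) + 1) +
      (1 + ((B * 6 + 3) + (5 + ((n * 2 + 1) + ((m * 3 + 3) + (300 * (B + 1) + ((B * (300 * (B + 1)) + B + 1) +
      (3 + ((40 * length (enc_fml Psi) + 3) + (40 * length (enc_fml Phi) + 3)))))))))))))))).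
    { unfold prog_time. rewrite <- HB. assert (l <= a) by (unfold a; lia). lia. }
    eapply does_seq.
    { rewrite Hl. apply (does_count w [] [] [] [] 0). }
    rewrite <- Hl. change (0 + l) with l. cbn [app].
    eapply does_seq; [apply (does_emit 3 [true; true; true; true; false]); cbn; lia|]. cbn [setq getq nth st].
    eapply does_seq; [apply (does_emit 5 [true; true; true; true; false]); cbn; lia|]. cbn [setq getq nth st].
    eapply does_seq; [apply (does_emit 6 [true; true; true; true; false]); cbn; lia|]. cbn [setq getq nth st].
    rewrite Ha. eapply does_seq; [apply does_cube|]. rewrite HB'.
    eapply does_seq; [apply does_push|]. cbn [setq getq nth st].
    eapply does_seq; [apply does_emit_ones|]. cbn [app].
    eapply does_seq; [apply does_emit_out|]. fold o1.
    eapply does_seq.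
    { rewrite Hw. unfold enc_nat at 1. rewrite <- app_assoc. cbn [app].
      apply (does_le _ _ _ (n * (1 + 1) + 1)); [lia|].
      apply (consume_loop 4 CNop 1 (fun _ q => st [] o1 [] [] q on on (ones B ++ [false]))
        (fun _ _ => eq_refl) (fun _ _ _ => eq_refl) (fun _ _ => does_nop _) n _ 0). }
    eapply does_seq; [apply (does_copy_unary [true])|]. fold o2.
    eapply does_seq; [eapply does_le; [apply tcost_init|apply does_tmpl]|]. fold o3.
    eapply does_seq; [apply does_emit_chain|]. fold o4.
    eapply does_seq; [apply does_emit_out|]. fold o5.
    eapply does_seq; [apply does_parse|]. fold o6.
    apply does_parse.
  - unfold getq. cbn [nth st]. unfold o7, o6, o5, o4, o3, o2, o1, enc_sentence, output, enc_nat.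
    rewrite tout_init, (concat_repeat1 1), Nat.mul_1_l. cbn [enc_fml]. rewrite chain_enc_eq. cbn [enc_fml].
    replace (3 * S B) with (3 * B + 3) by lia. rewrite repeat_app. unfold ones. rewrite <- !app_assoc.
    reflexivity.
Qed.

Lemma program_regs : regs_below 8 program.
Proof. cbn. repeat split; lia. Qed.

(** The dominant cost is writing [B] blocks whose unary indices have length of order [B], and [B] is
    cubic in the input length. *)
Lemma prog_time_bound l : prog_time (l + 4) <= 4000 * 4000 * (l + 1) ^ 6.
Proof.
  set (u := l + 1). assert (Hu : 1 <= u) by (unfold u; lia).
  assert (Ha : l + 4 <= 4 * u) by (unfold u; lia).
  set (a := l + 4) in *.
  assert (Hp : forall i j, i <= j -> u ^ i <= u ^ j) by (intros; apply Nat.pow_le_mono_r; lia).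
  assert (H3 : a ^ 3 <= 64 * u ^ 3).
  { apply Nat.le_trans with ((4 * u) ^ 3); [now apply Nat.pow_le_mono_l|]. rewrite Nat.pow_mul_l.
  simpl (4 ^ 3). lia. }
  assert (H6 : u ^ 3 * u ^ 3 = u ^ 6) by (rewrite <- Nat.pow_add_r; auto).
  assert (U3 := Hp 3 6 ltac:(lia)). assert (U1 := Hp 1 6 ltac:(lia)). assert (U0 := Hp 0 6 ltac:(lia)).
  rewrite Nat.pow_1_r in U1. simpl (u ^ 0) in U0.
  assert (Hc : a * (a * a) = a ^ 3) by (simpl; lia).
  assert (Hc2 : a * a <= a * (a * a)) by (unfold a; nia).
  assert (Hc1 : a <= a * a) by (unfold a; nia).
  assert (E : prog_time a = 3 * (a * (a * a)) + 5 * (a * a) + 4 * a + 1 + (300 * (a ^ 3 * a ^ 3) + 301 * a ^ 3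
    + 1) +
     306 * (a ^ 3 + 1) + 90 * a + 100) by (unfold prog_time; ring).
  rewrite E, Hc. rewrite Hc in Hc2.
  assert (Hs : a ^ 3 * a ^ 3 <= 64 * 64 * u ^ 6).
  { rewrite <- H6. apply Nat.le_trans with ((64 * u ^ 3) * (64 * u ^ 3)); [now apply Nat.mul_le_mono|]. lia. }
  lia.
Qed.

(** The number of passes is linear and the cost of a pass quadratic in the time of the program, so
    the exponent 6 becomes 18. *)
Lemma run_time_bound C l t : t <= C * (l + 1) ^ 6 ->
  (t + 2) * ((2 * (l + 8 + t) + 1) * (4 * (2 * (l + 8 + t)) + 10)) <= 16 * (C + 100) ^ 3 * (l + 1) ^ 18.
Proof.
  intros Ht. set (D := C + 100). set (v := (l + 1) ^ 6).
  assert (Hv : 1 <= v) by (apply Nat.neq_0_lt_0, Nat.pow_nonzero; lia).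
  assert (Hl : l + 1 <= v).
  { unfold v. rewrite <- (Nat.pow_1_r (l + 1)) at 1. apply Nat.pow_le_mono_r; lia. }
  replace ((l + 1) ^ 18) with (v * v * v) by (unfold v; rewrite <- !Nat.pow_add_r; reflexivity).
  fold v in Ht. assert (HD : C * v + 100 * v = D * v) by (unfold D; ring).
  replace (16 * D ^ 3 * (v * v * v)) with ((D * v) * ((2 * (D * v)) * (8 * (D * v)))) by (simpl; ring).
  apply Nat.mul_le_mono; [lia|]. apply Nat.mul_le_mono; lia.
Qed.

End Program.

Theorem mainTheorem10 :
  exists (M : TM) (c k : nat),
    forall (n m : nat) (Psi0 Phi0 : qff_le),
      scoped n m Psi0 -> scoped n m Phi0 -> promise n m Psi0 ->
      exists t : nat,
        (t <= c * (length (enc_input n m Psi0 Phi0) + 1) ^ k)%nat /\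
        cstate (tm_run M t (enc_input n m Psi0 Phi0)) = 1%nat /\
        exists (n' m' : nat) (Phi' : qff_le),
          scoped n' m' Phi' /\
          tm_output (tm_run M t (enc_input n m Psi0 Phi0)) = enc_sentence n' m' Phi' /\
          (bsig2_true n' m' Phi' <-> input_true n m Psi0 Phi0).
Proof.
  (* Eight queues, with the output in queue 1. *)
  destruct (While.while_machine Program.program 8 1 Program.program_regs) as (M & HM); [lia|].
  exists M, (16 * (4000 * 4000 + 100) ^ 3)%nat, 18%nat. intros n m Psi Phi HPsi HPhi Hp.
  set (w := enc_input n m Psi Phi). set (B := ((length w + 4) ^ 3)%nat).
  destruct (Program.does_program n m Psi Phi (length w) B eq_refl eq_refl) as (l' & (t & Ht & He) & Hout).
  destruct (HM w t l' He) as (u & Hu & Hstate & Htape).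
  exists u. split; [|split; [exact Hstate|]].
  - eapply Nat.le_trans; [apply Hu|]. apply Program.run_time_bound.
    eapply Nat.le_trans; [apply Ht|]. apply Program.prog_time_bound.
  - exists (3 * S B)%nat, m, (Out.output B Psi Phi).
    destruct (Out.output_correct n m B Psi Phi HPsi HPhi Hp eq_refl) as [H1 H2].
    split; [exact H1|]. split; [|exact H2].
    now rewrite Htape, Hout.
Qed.
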